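(* Let $1<p<\infty$ and let $L_p\equiv L_p[0,1]$. If a Banach space $Y$ is a coarse quotient of $L_p$, then $Y$ is isomorphic to a linear quotient of $L_p$.
   Context: $B(x,r)$ denotes the closed ball with center $x$ and radius $r$. For $\varepsilon\ge 0$ and a subset $A$ of a metric space $Y$, $A^{\varepsilon}:=\{y\in Y: d(y,a)\le\varepsilon \text{ for some } a\in A\}$. A mapping $f:X\to Y$ between metric spaces is coarsely continuous if for every $R>0$ there exists $S=S(R)>0$ such that $d(x,y)<R$ implies $d(f(x),f(y))<S$. Given a constant $K\ge 0$, $f$ is co-coarsely continuous with constant $K$ if for every $\epsilon>0$ there exists $\delta=\delta(\epsilon)>0$ such that for every $x\in X$, $B(f(x),\epsilon)\subset f(B(x,\delta))^K$. A mapping that is coarsely continuous and co-coarsely continuous with constant $K$ is called a coarse quotient mapping with constant $K$. $Y$ is a coarse quotient of $X$ if there exists a coarse quotient mapping from $X$ to $Y$ (with some constant $K\ge 0$; surjectivity is not required). A linear quotient of a Banach space $X$ is a Banach space that is the image of $X$ under a surjective bounded linear operator; ''isomorphic'' means linearly isomorphic as Banach spaces. *)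

(* Defs.v *)
From HB Require Import structures.
From mathcomp Require Import all_boot all_order all_algebra.
From mathcomp Require Import all_classical all_reals all_analysis.
From mathcomp Require Import ess_sup_inf measurable_realfun.

Set Implicit Arguments.
Unset Strict Implicit.
Unset Printing Implicit Defensive.

Import Order.TTheory GRing.Theory Num.Theory.
Import numFieldNormedType.Exports.

Local Open Scope classical_set_scope.
Local Open Scope ring_scope.

Section coarse_maps.
Context {R : realType} {X Y : metricType R}.
Implicit Types (f : X -> Y) (r K : R).

(* The library's closed_ball is the closure of the open ball, which may be
   strictly smaller in a general metric space. *)
Definition metric_cball {M : metricType R} (x : M) r : set M :=
  [set y | mdist x y <= r].

Definition enlargement {M : metricType R} (A : set M) r : set M :=
  [set y | exists2 a, A a & mdist y a <= r].

Definition coarsely_continuous f : Prop :=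
  forall r, 0 < r -> exists2 s, 0 < s &
    forall x y, mdist x y < r -> mdist (f x) (f y) < s.

Definition co_coarsely_continuous K f : Prop :=
  forall e, 0 < e -> exists2 d, 0 < d &
    forall x, metric_cball (f x) e `<=` enlargement (f @` metric_cball x d) K.

Definition coarse_quotient_map K f : Prop :=
  coarsely_continuous f /\ co_coarsely_continuous K f.

End coarse_maps.

Definition coarse_quotient {R : realType} (X Y : metricType R) : Prop :=
  exists2 K : R, 0 <= K & exists f : X -> Y, coarse_quotient_map K f.

(* Normed modules are not declared as metric spaces in the library: norm_metric
   V is V with the distance |x - y| (and its own uniform structure). *)
Definition norm_metric (V : Type) : Type := V.

Section norm_metric.
Context {R : realType} {V : normedModType R}.

HB.instance Definition _ := PseudoMetric.copy (norm_metric V) V.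

Let dist (x y : norm_metric V) : R := `|(x : V) - (y : V)|.

Let dist_ge0 x y : 0 <= dist x y.
Proof. exact: normr_ge0. Qed.

Let dist_positivity x y : dist x y = 0 -> x = y.
Proof. by move=> /eqP; rewrite normr_eq0 subr_eq0 => /eqP. Qed.

Let ball_dist (x : norm_metric V) d : ball x d = [set y | dist x y < d].
Proof. exact: (congr1 (fun b => b x d) (@pseudo_metric_ball_norm R V)). Qed.

HB.instance Definition _ := PseudoMetric_isMetric.Build R (norm_metric V)
  dist_ge0 dist_positivity ball_dist.

End norm_metric.

Section linear_notions.
Context {R : realType}.

(* For a linear map, bounded_near at 0 amounts to |T x| <= C * |x| for some C:
   see linear_boundedP. *)
Definition linear_quotient (X Z : normedModType R) : Prop :=
  exists T : {linear X -> Z},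
    bounded_near T (nbhs (0 : X)) /\ (forall z, exists x, T x = z).

Definition isomorphic (Y Z : normedModType R) : Prop :=
  exists (T : {linear Y -> Z}) (S : {linear Z -> Y}),
    [/\ cancel T S, cancel S T,
        bounded_near T (nbhs (0 : Y)) & bounded_near S (nbhs (0 : Z))].

End linear_notions.

(* The library's LspaceType (almost everywhere classes of measurable functions
   with finite L^p norm) comes without vector space structure and norm. *)
Section Lspace_normed.
Context d (T : measurableType d) (R : realType).
Variables (mu : {measure set T -> \bar R}) (p : \bar R) (p1 : (1 <= p)%E).

Local Notation Lp := (LspaceType mu p1).
Local Notation fn := (LfunType mu p1).

HB.instance Definition _ := gen_eqMixin Lp.
HB.instance Definition _ := gen_choiceMixin Lp.

Let Lnorm_ae_eq (f g : T -> R) : measurable_fun [set: T] f ->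
  measurable_fun [set: T] g -> f = g %[ae mu] ->
  ('N[mu]_p[EFin \o f] = 'N[mu]_p[EFin \o g])%E.
Proof.
move=> mf mg fg; rewrite unlock; case: p p1 => [r r1|_|//].
- congr (_ `^ _)%E; apply: ge0_ae_eq_integral => //=.
  + apply/measurable_EFinP/(measurableT_comp (measurable_powR _)).
    exact: measurableT_comp.
  + apply/measurable_EFinP/(measurableT_comp (measurable_powR _)).
    exact: measurableT_comp.
  + by apply: filterS fg => x /= /(_ I) ->.
- case: ifPn => // _; apply: eq_ess_sup.
  by apply: filterS fg => x /= /(_ I) ->.
Qed.

Let Lrepr_subproof (f : Lp) : ((f : T -> R) \in Lfun mu p).
Proof.
apply/andP; split; rewrite inE/=.
  exact: (@measurable_funPT _ _ _ _ (repr (LebesgueSpace.sort f))).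
exact: Lebesgue_finite.
Qed.

Definition Lrepr (f : Lp) : fn := Lfun_Sub p1 (Lrepr_subproof f).

(* The library puts the almost everywhere quotient on the Borel measurable
   functions into measurableTypeR R, a copy of R. *)
Let mfunR (f : fn) : {mfun T >-> measurableTypeR R} :=
  HB.pack (f : T -> measurableTypeR R)
    (@isMeasurableFun.Build _ _ T (measurableTypeR R) f (measurable_funPT f)).

Let pi (f : fn) : {mfun_ mu, T >-> measurableTypeR R} :=
  \pi_({mfun_ mu, T >-> measurableTypeR R})%qT (mfunR f).

Let pi_ae (f : fn) : (pi f : T -> R) = (f : T -> R) %[ae mu].
Proof.
have /eqmodP/asboolP // : repr (pi f) = mfunR f
    %[mod {mfun_ mu, T >-> measurableTypeR R}]%qT by rewrite reprK.
Qed.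

Let Lclass_subproof (f : fn) : finite_norm mu p (pi f : T -> R).
Proof.
rewrite /finite_norm.
rewrite (Lnorm_ae_eq _ _ (pi_ae f)); first exact: Lfunction_finite.
  exact: (@measurable_funPT _ _ _ _ (repr (pi f))).
exact: (measurable_funPT f).
Qed.

Definition Lclass (f : fn) : Lp :=
  LebesgueSpace.Pack (LebesgueSpace.Class
    (isFinLebesgue.Axioms_ _ _ mu p p1 (pi f) (Lclass_subproof f))).

Lemma Lspace_eqP (f g : Lp) : f = g <-> (f : T -> R) = g %[ae mu].
Proof.
split=> [->|]; first exact: ae_eq_refl.
move: f g => [f [[f1]]] [g [[g1]]] /= fg.
have efg : f = g.
  by rewrite -(reprK f) -(reprK g); apply/eqmodP/asboolP.
by move: f1 g1; rewrite {}efg => f1 g1; rewrite (Prop_irrelevance f1 g1).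
Qed.

Lemma LreprK : cancel Lrepr Lclass.
Proof. by move=> f; apply/Lspace_eqP; exact: pi_ae. Qed.

Lemma LclassK (f : fn) : (Lrepr (Lclass f) : T -> R) = f %[ae mu].
Proof. exact: pi_ae. Qed.

Lemma Lclass_eqP (f g : fn) : Lclass f = Lclass g <-> (f : T -> R) = g %[ae mu].
Proof.
split=> [fg|fg].
  apply: filterS2 (LclassK f) (LclassK g) => x /(_ I) fx /(_ I) gx _.
  by rewrite -fx -gx fg.
apply/Lspace_eqP.
apply: filterS3 fg (LclassK f) (LclassK g) => x /(_ I) fg /(_ I) fx /(_ I) gx _.
exact: etrans fx (etrans fg (esym gx)).
Qed.

Let Lind (P : Lp -> Prop) : (forall f, P (Lclass f)) -> forall x, P x.
Proof. by move=> PL x; rewrite -(LreprK x). Qed.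

Let Ladd (f g : Lp) := Lclass (Lrepr f + Lrepr g).
Let Lopp (f : Lp) := Lclass (- Lrepr f).
Let Lscale (a : R) (f : Lp) := Lclass (a *: Lrepr f).

Let LaddE f g : Ladd (Lclass f) (Lclass g) = Lclass (f + g).
Proof.
apply/Lclass_eqP.
apply: filterS2 (LclassK f) (LclassK g) => x /(_ I) fx /(_ I) gx _.
exact: congr2 fx gx.
Qed.

Let LoppE f : Lopp (Lclass f) = Lclass (- f).
Proof.
apply/Lclass_eqP; apply: filterS (LclassK f) => x /(_ I) fx _.
exact: congr1 fx.
Qed.

Let LscaleE a f : Lscale a (Lclass f) = Lclass (a *: f).
Proof.
apply/Lclass_eqP; apply: filterS (LclassK f) => x /(_ I) fx _.
exact: (congr1 ( *%R a) fx).
Qed.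

Let LaddA : associative Ladd.
Proof.
by elim/Lind=> f; elim/Lind=> g; elim/Lind=> h; rewrite !LaddE addrA.
Qed.

Let LaddC : commutative Ladd.
Proof. by elim/Lind=> f; elim/Lind=> g; rewrite !LaddE addrC. Qed.

Let Ladd0 : left_id (Lclass 0) Ladd.
Proof. by elim/Lind=> f; rewrite LaddE add0r. Qed.

Let LaddN : left_inverse (Lclass 0) Lopp Ladd.
Proof. by elim/Lind=> f; rewrite LoppE LaddE addNr. Qed.

HB.instance Definition _ := GRing.isZmodule.Build Lp LaddA LaddC Ladd0 LaddN.

Let LscaleA a b f : Lscale a (Lscale b f) = Lscale (a * b) f.
Proof. by elim/Lind: f => f; rewrite !LscaleE scalerA. Qed.

Let Lscale1 : left_id 1 Lscale.
Proof. by elim/Lind=> f; rewrite LscaleE scale1r. Qed.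

Let LscaleDr : right_distributive Lscale +%R.
Proof.
move=> a; elim/Lind=> f; elim/Lind=> g.
by rewrite [_ + _]LaddE !LscaleE [RHS]LaddE scalerDr.
Qed.

Let LscaleDl f : {morph Lscale^~ f : a b / a + b}.
Proof.
by move=> a b; elim/Lind: f => f; rewrite !LscaleE [RHS]LaddE scalerDl.
Qed.

HB.instance Definition _ := GRing.Zmodule_isLmodule.Build R Lp
  LscaleA Lscale1 LscaleDr LscaleDl.

Lemma LclassD f g : Lclass (f + g) = Lclass f + Lclass g.
Proof. by rewrite [RHS]LaddE. Qed.

Lemma LclassZ a f : Lclass (a *: f) = a *: Lclass f.
Proof. by rewrite [RHS]LscaleE. Qed.

Definition Lspace_norm (f : Lp) : R := fine 'N[mu]_p[EFin \o f]%E.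

Lemma Lspace_normE (f : fn) :
  Lspace_norm (Lclass f) = fine 'N[mu]_p[EFin \o f]%E.
Proof.
by rewrite /Lspace_norm (Lnorm_ae_eq _ _ (LclassK f)).
Qed.

Let Lspace_normD f g : Lspace_norm (f + g) <= Lspace_norm f + Lspace_norm g.
Proof.
elim/Lind: f => f; elim/Lind: g => g.
by rewrite -LclassD !Lspace_normE ler_LnormD.
Qed.

Let Lspace_normZ a f : Lspace_norm (a *: f) = `|a| * Lspace_norm f.
Proof.
elim/Lind: f => f; rewrite -LclassZ !Lspace_normE.
by rewrite LnormZ -finite_norm_fine -EFinM.
Qed.

Let Lspace_norm0_eq0 f : Lspace_norm f = 0 -> f = 0.
Proof.
elim/Lind: f => f; rewrite Lspace_normE => /fine_Lnormr_eq0 f0.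
exact/Lclass_eqP.
Qed.

HB.instance Definition _ := Lmodule_isNormed.Build R Lp
  Lspace_normD Lspace_normZ Lspace_norm0_eq0.

End Lspace_normed.

(* L^p[0,1] is modelled as L^p of this measure on the Borel sets of R, which is
   concentrated on [0,1]: functions are identified when they agree almost
   everywhere on [0,1]. *)
Definition lebesgue01 {R : realType} : set (measurableTypeR R) -> \bar R :=
  mrestr (@lebesgue_measure R) (measurable_itv `[0, 1]).

HB.instance Definition _ (R : realType) := Measure.on (@lebesgue01 R).

Definition Lp01 (R : realType) (p : \bar R) (p1 : (1 <= p)%E) :
  normedModType R := LspaceType (@lebesgue01 R) p1.

(* Main.v *)
Require Import Defs.
From HB Require Import structures.
From mathcomp Require Import all_boot all_order all_algebra.
From mathcomp Require Import all_classical all_reals all_analysis.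
From mathcomp Require Import measurable_realfun ring lra.

Set Implicit Arguments.
Unset Strict Implicit.
Unset Printing Implicit Defensive.

Import Order.TTheory GRing.Theory Num.Theory.
Import numFieldNormedType.Exports.

Local Open Scope classical_set_scope.
Local Open Scope ring_scope.

(* Let f : Lp -> Y be a coarse quotient mapping and 1/p + 1/q = 1. For a linear
   functional phi on Y of norm at most 1, phi o f is Lipschitz for large
   distances. Uniform smoothness of Lp yields, for finitely many such phi_i at
   once, a common large ball on which every phi_i o f is close to an affine
   function, with linear part h_i in Lq. Since f is Lipschitz and co-Lipschitz
   for large distances, the norms of sum a_i h_i and sum a_i phi_i are
   equivalent up to a small error, with constants that depend only on f.

   Y is separable, so a sequence (phi_i) is almost norming. Bounded arrays in
   Lq have limits g_i in Lq along an ultrafilter, in the sense that the norms of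
   all finite linear combinations converge: only the joint law of the functions
   matters, relative to a dominating density, and the limit law is realised on
   [0, 1] by coding points of [-1, 1] by binary digits. Hence the norms of
   sum a_i g_i and sum a_i phi_i are equivalent. The relation
   "<m, g_i> = phi_i y for all i" between m in Lp and y in Y is then the graph of
   a bounded linear surjection from Lp to Y: totality and surjectivity follow
   from the representation of functionals on subspaces, which again comes from
   smoothness. *)

(** * Riesz representation by smoothness *)

(** [Y] carries no structure in which [f] could be differentiated, so only the scalar functions phi
    o f are linearised; this is why the argument lives in the dual and recovers [Y] from a copy of
    the span of the [phi_i] in Lq. A ball on which phi o f is nearly affine exists because a failure
    produces a shorter segment with a slope larger by a fixed amount, and slopes are bounded by the
    Lipschitz constant. The number of failures, hence the loss of scale, is bounded in advance, so a
    large enough initial radius still swallows the additive constants of [f] at the end. The linear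
    parts change with the number n of functionals and carry an error of size 1/(n+1), so an honest
    embedding appears only in the limit. Weak limits in Lq would not do: they can lose norm, and the
    lower estimate would be lost. What must converge are the norms of all finite combinations. An
    ultrapower achieves this but leaves [0, 1]; as only countably many functions matter, their joint
    law is a measure on a product of intervals and can be carried back to [0, 1]. *)

Section pairing_def.
Context {R : realType} {X X' : normedModType R}.

(* Everything used about Lp and Lq: a pairing whose norm one points w have a
   duality map in X' differentiating the norm uniformly, and completeness of X,
   in a weak form and for geometrically bounded series only. *)
Record half_duality (B : X -> X' -> R) : Prop := HalfDuality {
  pairDl : forall u v g, B (u + v) g = B u g + B v g;
  pairZl : forall a u g, B (a *: u) g = a * B u g;
  pair_le : forall u g, `|B u g| <= `|u| * `|g|;
  pair_smooth : forall e : R, 0 < e -> exists2 r : R, 0 < r &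
    forall w : X, `|w| = 1 -> exists2 g : X', `|g| <= 1 &
    forall u, `|u| <= r -> `|w + u| <= 1 + B u g + e * `|u|;
  pair_sum : forall (C : R) (m : nat -> X),
    (forall k, `|m k| <= C * 2^-1 ^+ k) ->
    exists2 s : X, `|s| <= 2 * C &
      forall g, (fun n => B (\sum_(k < n) m k) g) @ \oo --> B s g }.

End pairing_def.

Definition duality {R : realType} {X X' : normedModType R} (B : X -> X' -> R) :=
  half_duality B /\ half_duality (fun g u => B u g).

Section duality_flip.
Context {R : realType} {X X' : normedModType R} (B : X -> X' -> R).
Hypothesis dB : duality B.

Lemma duality_flip : duality (fun g u => B u g).
Proof. by case: dB => ? ?; split. Qed.

Lemma pairDr u g h : B u (g + h) = B u g + B u h.
Proof. exact: (pairDl dB.2). Qed.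

Lemma pairZr a u g : B u (a *: g) = a * B u g.
Proof. exact: (pairZl dB.2). Qed.

Lemma pairNl u g : B (- u) g = - B u g.
Proof. by rewrite -scaleN1r (pairZl dB.1) mulN1r. Qed.

Lemma pairBl u v g : B (u - v) g = B u g - B v g.
Proof. by rewrite (pairDl dB.1) pairNl. Qed.

Lemma pair0l g : B 0 g = 0.
Proof. by rewrite -(scale0r 0) (pairZl dB.1) mul0r. Qed.

Lemma pair0r u : B u 0 = 0.
Proof. by rewrite -(scale0r 0) pairZr mul0r. Qed.

Lemma pair_sumr I (r : seq I) P (F : I -> X') u :
  B u (\sum_(i <- r | P i) F i) = \sum_(i <- r | P i) B u (F i).
Proof.
by elim/big_rec2: _ => [|i x y _ <-]; rewrite ?pair0r ?pairDr.
Qed.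

Lemma dual_norm_le (C : R) g : 0 <= C ->
  (forall u, `|B u g| <= C * `|u|) -> `|g| <= C.
Proof.
move=> C0 gC; apply/ler_addgt0Pr => e e0.
have [->|g0] := eqVneq g 0; first by rewrite normr0; lra.
have ng0 : 0 < `|g| by rewrite normr_gt0.
have e'0 : 0 < e / `|g| by rewrite divr_gt0.
have [r r0 sm] := pair_smooth dB.2 e'0.
pose w := `|g|^-1 *: g.
have w1 : `|w| = 1 by rewrite normrZ ger0_norm ?invr_ge0// mulVf ?normr_eq0.
have [m m1 hm] := sm _ w1.
(* testing the smoothness inequality in the direction of w itself *)
have [rw nrw] : `|r *: w| <= r /\ `|w + r *: w| = 1 + r.
  split; first by rewrite normrZ w1 mulr1 gtr0_norm.
  by rewrite -{1}[w]scale1r -scalerDl normrZ w1 mulr1 ger0_norm//; lra.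
have := hm _ rw; rewrite nrw normrZ w1 mulr1 gtr0_norm// pairZr.
rewrite -addrA lerD2l mulrC -mulrDl -[X in X <= _ -> _]mul1r ler_pM2r//.
have -> : B m w = `|g|^-1 * B m g by rewrite pairZr.
move=> h; have h2 : `|g| <= B m g + e.
  rewrite -[leRHS]mulr1 -(@mulVf _ `|g|) ?normr_eq0//.
  rewrite mulrA -[leLHS]mul1r ler_pM2r//.
  by apply: le_trans h _; rewrite mulrDl [_^-1 * _]mulrC.
apply: le_trans h2 _; rewrite lerD2r.
apply: le_trans (ler_norm _) _; apply: le_trans (gC _) _.
by rewrite ler_piMr.
Qed.

End duality_flip.

Section riesz.
Context {R : realType} {X X' : normedModType R} (B : X -> X' -> R).
Hypothesis dB : duality B.
Context {E : lmodType R} (D : set E) (J : E -> X') (l : E -> R).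
Hypothesis D0 : D 0.
Hypothesis DD : forall a e e', D e -> D e' -> D (a *: e + e').
Hypothesis JD : forall a e e', J (a *: e + e') = a *: J e + J e'.

Let riesz_bound (l' : E -> R) C := forall e, D e -> `|l' e| <= C * `|J e|.

Let J0 : J 0 = 0.
Proof. by have := JD (-1) 0 0; rewrite scaler0 addr0 scaleN1r addNr. Qed.

Let JZ a e : J (a *: e) = a *: J e.
Proof. by have := JD a e 0; rewrite J0 !addr0. Qed.

Let DZ a e : D e -> D (a *: e).
Proof. by move=> De; rewrite -[_ *: _]addr0; exact: DD. Qed.

(* The functional is close to a multiple of the duality map at a point where
   it almost attains its norm. *)
Let riesz_approx (l' : E -> R) C :
    (forall a e e', l' (a *: e + e') = a * l' e + l' e') ->
    0 <= C -> riesz_bound l' C ->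
  exists2 m, `|m| <= C & riesz_bound (fun e => l' e - B m (J e)) (C / 2).
Proof.
move=> lD C0 lC.
have l0 : l' 0 = 0 by have := lD (-1) 0 0; rewrite scaler0 addr0; lra.
have lZ a e : l' (a *: e) = a * l' e by have := lD a e 0; rewrite l0 !addr0.
have [small|/existsNP[e1 /not_implyP[De1 /negP]]] :=
    pselect (riesz_bound l' (C / 2)).
  exists 0; first by rewrite normr0.
  by move=> e De; rewrite (pair0l dB) subr0; exact: small.
rewrite -ltNge => le1.
have Je1 : 0 < `|J e1|.
  rewrite normr_gt0; apply/eqP => Je0; have := lC _ De1.
  by move: le1; rewrite Je0 normr0 !mulr0; lra.
pose V := [set l' e | e in [set e | D e /\ `|J e| = 1]].
have Vub : ubound V C.
  by move=> _ [e [De Je] <-]; apply: le_trans (ler_norm _) _;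
    apply: le_trans (lC _ De) _; rewrite Je mulr1.
pose sg : R := if 0 <= l' e1 then 1 else -1.
have Ve1 : V (`|l' e1| / `|J e1|).
  exists ((sg / `|J e1|) *: e1); first split; first exact: DZ.
    rewrite JZ normrZ normrM normfV normr_id.
    by rewrite /sg; case: ifP; rewrite ?normrN normr1 div1r mulVf// gt_eqF.
  rewrite lZ mulrAC /sg; congr (_ / _); case: ifP => h.
    by rewrite mul1r ger0_norm.
  by rewrite mulN1r ltr0_norm// ltNge h.
have Vs : has_sup V by split; [exists (`|l' e1| / `|J e1|)|exists C].
set s := sup V.
have sC : s <= C by apply: ge_sup => //; exists (`|l' e1| / `|J e1|).
have sC2 : C / 2 < s.
  apply: lt_le_trans (ub_le_sup Vs.2 Ve1).
  by rewrite ltr_pdivlMr.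
have s0 : 0 < s by apply: le_lt_trans sC2; rewrite divr_ge0.
have ls e : D e -> l' e <= s * `|J e|.
  move=> De; have [/eqP Je0|Je0] := eqVneq `|J e| 0.
    have := lC _ De; rewrite (eqP Je0) !mulr0 => le0.
    exact: le_trans (ler_norm _) le0.
  have Jp : 0 < `|J e| by rewrite lt_neqAle eq_sym Je0 normr_ge0.
  rewrite -ler_pdivrMr//; apply: (ub_le_sup Vs.2).
  exists (`|J e|^-1 *: e); first split; first exact: DZ.
    by rewrite JZ normrZ normfV normr_id mulVf.
  by rewrite lZ mulrC.
have h4 : 0 < 4^-1 :> R by rewrite invr_gt0.
have [r r0 sm] := pair_smooth dB.2 h4.
(* Near maximality of [e0] and smoothness with constant 1/4 each cost [s * r / 4] on perturbations
   of length r. The total [s * r / 2] is half of what the norm s allows there. *)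
have [|_ [e0 [De0 Je0] <-] he0] := @sup_adherent _ V (s * (r / 4)) _ Vs.
  by rewrite mulr_gt0// divr_gt0.
have [m m1 hm] := sm _ Je0.
exists (s *: m).
  rewrite normrZ gtr0_norm//; apply: le_trans sC.
  by rewrite ler_piMr// ltW.
have half e : D e -> `|J e| = r -> l' e - s * B m (J e) <= s * (r / 2).
  move=> De Jer; have := ls _ (DD 1 De0 De).
  rewrite lD JD mul1r scale1r => h.
  have := hm (J e); rewrite Jer lexx => /(_ isT) h2.
  have : s * `|J e0 + J e| <= s * (1 + B m (J e) + 4^-1 * r).
    by rewrite ler_pM2l.
  move: he0; rewrite -/s; lra.
have halfN e : D e -> `|J e| = r -> `|l' e - s * B m (J e)| <= s * (r / 2).
  move=> De Jer; rewrite ler_norml half// andbT.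
  have := half ((-1) *: e) (DZ _ De).
  rewrite JZ normrZ normrN1 mul1r => /(_ Jer).
  by rewrite lZ (pairZr dB); lra.
move=> e De; have [/eqP Je|Je] := eqVneq `|J e| 0.
  have := lC _ De; rewrite (eqP Je) !mulr0 normr_le0 => /eqP ->.
  by move: Je; rewrite normr_eq0 => /eqP ->; rewrite (pair0r dB) subr0 normr0.
have Jp : 0 < `|J e| by rewrite lt_neqAle eq_sym Je normr_ge0.
have := halfN ((r / `|J e|) *: e) (DZ _ De).
rewrite JZ normrZ gtr0_norm ?divr_gt0// divfK// => /(_ erefl).
rewrite lZ (pairZr dB) (pairZl dB.1) mulrCA -mulrBr normrM gtr0_norm ?divr_gt0//.
rewrite mulrAC ler_pdivrMr// mulrA [s * _]mulrC -!mulrA ler_pM2l// => h.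
apply: le_trans h _.
have : s * `|J e| <= C * `|J e| by rewrite ler_pM2r.
lra.
Qed.

(** Iterating [riesz_approx] halves the error each time, so the corrections are geometrically
    bounded and [pair_sum] adds them up. The subspace of X' is given as the image of [D] under [J]:
    the bound on [l] already forces [l] to factor through [J], so this need not be shown
    beforehand. *)
Lemma riesz_subspace C :
    (forall a e e', l (a *: e + e') = a * l e + l e') ->
    0 <= C -> (forall e, D e -> `|l e| <= C * `|J e|) ->
  exists m, forall e, D e -> B m (J e) = l e.
Proof.
move=> lD C0 lC.
pose good (k : nat) (S : X) :=
  riesz_bound (fun e => l e - B S (J e)) (C * 2^-1 ^+ k).
(* The condition on the partial sum is put under the existential, so that [choice] gives a total
   function of the stage and the partial sum. *)
have step (kS : nat * X) : exists m, good kS.1 kS.2 ->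
    `|m| <= C * 2^-1 ^+ kS.1 /\ good kS.1.+1 (kS.2 + m).
  case: kS => k S /=; have [gS|nS] := pselect (good k S); last by exists 0.
  have [| |m mC hm] := riesz_approx _ _ gS.
  - move=> a e e'; rewrite lD JD (pairDr dB) (pairZr dB); ring.
  - by rewrite mulr_ge0// exprn_ge0.
  exists m => _; split=> // e De.
  rewrite (pairDl dB.1) opprD addrA exprS mulrCA [_^-1 * _]mulrC.
  exact: hm e De.
have [nx hnx] := choice step.
pose S := fix S k := if k is k'.+1 then S k' + nx (k', S k') else 0.
have gS k : good k (S k).
  elim: k => [|k IH] /=; last by case: (hnx (k, S k) IH).
  by move=> e De; rewrite (pair0l dB) subr0 expr0 mulr1; exact: lC.
have SE n : S n = \sum_(k < n) nx (val k, S k).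
  by elim: n => [|n IH]; rewrite ?big_ord0// big_ord_recr /= -IH.
have [s _ hs] := pair_sum dB.1 (fun k => (hnx (k, S k) (gS k)).1).
exists s => e De.
have c1 := hs (J e).
have c2 : (fun n => B (\sum_(k < n) nx (val k, S k)) (J e)) @ \oo --> l e.
  have -> : (fun n => B (\sum_(k < n) nx (val k, S k)) (J e)) =
    (fun n => B (S n) (J e)) by apply/funext => n; rewrite SE.
  apply/cvgrPdist_le => /= d d0.
  have : (fun k => (C * `|J e|) * 2^-1 ^+ k) @ \oo --> (C * `|J e|) * 0.
    apply: cvgM; first exact: cvg_cst.
    by apply: cvg_expr; rewrite ger0_norm ?invr_ge0//; lra.
  rewrite mulr0 => /cvgrPdist_le /(_ _ d0); apply: filterS => k.
  rewrite sub0r normrN => h; apply: le_trans h.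
  apply: le_trans (ler_norm _); rewrite mulrAC.
  exact: gS.
exact: (cvg_unique _ c1 c2).
Qed.

End riesz.

(** * Affine approximation at large scale *)

Section affine_approximation.
Context {R : realType} {X X' : normedModType R} (B : X -> X' -> R).
Hypothesis dB : duality B.

Definition lipschitz_above (L s : R) (g : X -> R) (x0 : X) (r : R) :=
  forall x y, `|x - x0| <= r -> `|y - x0| <= r -> s <= `|x - y| ->
    g x - g y <= L * `|x - y|.

Definition affine_on (e : R) (g : X -> R) (m : X) (r : R) (h : X') :=
  forall z, `|z - m| <= r -> `|g z - g m - B (z - m) h| <= e * r.

Definition smooth_at_scale (e r : R) := forall d w, 0 < d -> `|w| = d ->
  exists h : X', forall u, `|u| <= r * d -> `|w + u| <= d + B u h + e * `|u|.

Lemma smooth_scale (e : R) : 0 < e ->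
  exists2 r : R, 0 < r <= 2^-1 & smooth_at_scale e r.
Proof.
move=> e0; have [r r0 sm] := pair_smooth dB.1 e0.
exists (Num.min r 2^-1).
  by rewrite lt_min r0 invr_gt0 ltr0n /= ge_min lexx orbT.
move=> d w d0 wd.
have [|h _ hu] := sm (d^-1 *: w).
  by rewrite normrZ wd gtr0_norm ?invr_gt0// mulVf// gt_eqF.
exists h => u ur.
have : `|d^-1 *: u| <= r.
  rewrite normrZ gtr0_norm ?invr_gt0// ler_pdivrMl// mulrC.
  by apply: le_trans ur _; rewrite ler_pM2r// ge_min lexx.
move=> /hu; rewrite -scalerDr !normrZ gtr0_norm ?invr_gt0//.
rewrite ler_pdivrMl// (pairZl dB.1) => h1; apply: le_trans h1 _.
by rewrite le_eqVlt; apply/orP; left; apply/eqP; field; rewrite gt_eqF.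
Qed.

(** All slopes involved are at most [L + 1], so the smoothness constant [e / (4 * (L + 1))] costs at
    most e/4 after multiplication by a slope; [dl <= e * r / 4] makes the gain [dl] in the slope
    negligible on a ball of relative radius r. *)
Definition slope_params (L e dl r : R) :=
  [/\ 0 < e /\ 0 <= L, 0 < dl <= 1, 0 < r <= 2^-1, dl <= e * r / 4 &
      smooth_at_scale (e / (4 * (L + 1))) r].

(* At the midpoint of [x, y] smoothness pins g between two nearly equal affine
   functions, unless some slope from x or to y exceeds the slope s by dl. *)
Lemma slope_step (L e dl r : R) (g : X -> R) (x y : X) (d s : R) :
    slope_params L e dl r ->
    `|y - x| = d -> 0 < d -> 0 <= s <= L -> g y - g x = s * d ->
    let m := x + 2^-1 *: (y - x) in
    (exists h, affine_on e g m (r / 2 * d) h) \/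
  exists2 z, `|z - m| <= r / 2 * d &
    (s + dl) * `|z - x| < g z - g x \/ (s + dl) * `|y - z| < g y - g z.
Proof.
move=> [[e0 L0] /andP[dl0 dl1] /andP[r0 r2] dle sm].
move=> yxd d0 /andP[s0 sL] gxy m.
pose w := 2^-1 *: (y - x).
have wd : `|w| = d / 2 by rewrite normrZ gtr0_norm ?invr_gt0// mulrC yxd.
have mx : m - x = w by rewrite /m addrC addKr.
have ym : y - m = w.
  rewrite /m opprD addrA -{1}[y - x]scale1r -scalerBl /w.
  by congr (_ *: _); field.
have d20 : 0 < d / 2 by rewrite divr_gt0.
have [h hu] := sm _ _ d20 wd.
have [out|/forall2NP noz] := pselect (exists2 z, `|z - m| <= r / 2 * d &
    (s + dl) * `|z - x| < g z - g x \/ (s + dl) * `|y - z| < g y - g z).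
  by right.
(* Since [g y - g x = s * d], the upper bound for g z seen from x and the lower bound seen from y
   are centred at the same mean value, up to [dl * d / 2], and have the same linear part. *)
left; exists ((s + dl) *: h).
pose A := (g x + g y) / 2.
have sd0 : 0 <= s + dl by lra.
have near z : `|z - m| <= r / 2 * d ->
    `|g z - A - B (z - m) ((s + dl) *: h)| <= e / 2 * (r / 2 * d).
  move=> zr; set u := z - m in zr *.
  have [/negP|/not_orP[/negP + /negP]] := noz z.
    by rewrite zr.
  rewrite -!leNgt => h1 h2.
  have ur : `|u| <= r * (d / 2) by apply: le_trans zr _; lra.
  have zx : `|z - x| <= d / 2 + B u h + e / (4 * (L + 1)) * `|u|.
    by rewrite (_ : z - x = w + u) ?hu// /u -mx [RHS]addrC addrA subrK.
  have yz : `|y - z| <= d / 2 - B u h + e / (4 * (L + 1)) * `|u|.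
    rewrite (_ : y - z = w - u); last by rewrite /u -ym opprB addrA subrK.
    by rewrite -(pairNl dB) -[`|u|]normrN hu// normrN.
  rewrite (pairZr dB).
  have h3 := le_trans h1 (ler_wpM2l sd0 zx).
  have h4 := le_trans h2 (ler_wpM2l sd0 yz).
  have err : (s + dl) * (e / (4 * (L + 1)) * `|u|) <= e / 4 * (r / 2 * d).
    rewrite mulrA; apply: ler_pM => //; first by rewrite mulr_ge0// divr_ge0//; lra.
    rewrite mulrA ler_pdivrMr; last by lra.
    rewrite (_ : e / 4 * (4 * (L + 1)) = (L + 1) * e); last by field.
    by rewrite ler_pM2r//; lra.
  have dlerr : dl * d <= e / 4 * (r * d).
    by rewrite !mulrA ler_pM2r//; move: dle; lra.
  rewrite ler_norml /A; apply/andP; split; lra.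
move=> z zr; have nz := near z zr.
have := near m; rewrite subrr normr0 (pair0l dB) subr0.
have rd : 0 <= r / 2 * d by rewrite mulr_ge0 ?divr_ge0// ltW.
move=> /(_ rd); rewrite !ler_norml in nz *.
by move=> /andP[nm1 nm2]; move/andP: nz => [nz1 nz2]; apply/andP; split; lra.
Qed.

(** As [r <= 1/2], the point found by [slope_step] is within d/4 of the midpoint. So the steeper
    segment is shorter by a definite factor, but at most 4 times shorter. *)
Lemma steeper_pair (L e dl r : R) (g : X -> R) (x y : X) (d s : R) :
    slope_params L e dl r ->
    `|y - x| = d -> 0 < d -> 0 <= s <= L -> g y - g x = s * d ->
    (exists m h, (forall z, `|z - m| <= r / 2 * d -> `|z - x| <= d) /\
                 affine_on e g m (r / 2 * d) h) \/
  exists a b, [/\ 4^-1 * d <= `|b - a|, `|b - a| <= 3 / 4 * d,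
    `|a - x| <= 3 / 4 * d, `|b - x| <= d & (s + dl) * `|b - a| < g b - g a].
Proof.
move=> pars yxd d0 sL gxy.
case: (pars) => [_ _ /andP[r0 r2] _ _].
have := slope_step pars yxd d0 sL gxy; set m := x + _ => /=.
have mx : `|m - x| = d / 2.
  by rewrite /m [x + _]addrC addrK normrZ gtr0_norm ?invr_gt0// yxd mulrC.
have ym : `|y - m| = d / 2.
  rewrite /m opprD addrA -{1}[y - x]scale1r -scalerBl.
  rewrite (_ : 1 - 2^-1 = 2^-1 :> R); last by field.
  by rewrite normrZ gtr0_norm ?invr_gt0// yxd mulrC.
have rd : r / 2 * d <= d / 4 by nra.
have zx z : `|z - m| <= r / 2 * d -> `|z - x| <= 3 / 4 * d.
  by move=> zm; apply: le_trans (ler_distD m _ _) _; lra.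
have xx : `|x - x| = 0 by rewrite subrr normr0.
case=> [[h ah]|[z zm zs]].
  by left; exists m, h; split=> // z /zx; lra.
right; have zx3 := zx _ zm; case: zs => zs.
  exists x, z; split=> //; rewrite ?xx; try lra.
  by have := ler_distD z m x; rewrite [`|m - z|]distrC; lra.
exists z, y; split=> //; rewrite ?yxd//.
  by have := ler_distD z y m; lra.
by apply: le_trans (ler_distD m _ _) _; rewrite [`|m - z|]distrC; lra.
Qed.

(** Each steeper pair raises the slope by [dl], and a slope above [L] is impossible, so n bounds the
    number of repetitions, each of which costs a factor 4 in length. The radius [4 * |y - x|]
    reproduces itself, because the next pair starts within 3/4 of the length and 3/4 + 4 * 3/4 <=
    4. *)
Lemma slope_descent (L e dl r : R) (n : nat) : slope_params L e dl r ->
  forall g x y, 0 < `|y - x| ->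
    0 <= g y - g x -> (L - n%:R * dl) * `|y - x| <= g y - g x ->
    lipschitz_above L (4^-1 ^+ n.+1 * `|y - x|) g x (4 * `|y - x|) ->
  exists m r' h, [/\ r / 2 * 4^-1 ^+ n * `|y - x| <= r',
    (forall z, `|z - m| <= r' -> `|z - x| <= 4 * `|y - x|) &
    affine_on e g m r' h].
Proof.
move=> pars; case: (pars) => [[e0 L0] /andP[dl0 dl1] /andP[r0 r2] dle sm].
have h41 k : (4^-1 : R) ^+ k <= 1.
  by rewrite exprn_ile1// invf_le1// ler1n.
have h40 k : 0 <= (4^-1 : R) ^+ k by rewrite exprn_ge0.
have start g x y k : 0 < `|y - x| -> 0 <= g y - g x ->
    (L - k%:R * dl) * `|y - x| <= g y - g x ->
    lipschitz_above L (4^-1 ^+ k.+1 * `|y - x|) g x (4 * `|y - x|) ->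
    exists s, [/\ 0 <= s <= L, g y - g x = s * `|y - x| & L - k%:R * dl <= s].
  move=> d0 gxy0 gxy lip; exists ((g y - g x) / `|y - x|).
  split; [|by rewrite divfK ?gt_eqF//|by rewrite ler_pdivlMr].
  rewrite divr_ge0 ?(ltW d0)//= ler_pdivrMr//.
  apply: lip; rewrite ?subrr ?normr0; try lra.
  by rewrite ler_piMl// ltW.
elim: n => [|n IH] g x y d0 gxy0 gxy lip.
all: have [s [s0L gE sg]] := start _ _ _ _ d0 gxy0 gxy lip.
all: have [[m [h [mx ah]]]|[a [b [ab1 ab2 ax bx abs]]]] :=
  steeper_pair pars erefl d0 s0L gE.
- exists m, (r / 2 * `|y - x|), h; rewrite expr0 mulr1; split=> //.
  by move=> z /mx; lra.
- have := lip b a; rewrite expr1 => /(_ _ _ ab1) h.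
  have {}h : g b - g a <= L * `|b - a| by apply: h; lra.
  have : (s + dl) * `|b - a| < L * `|b - a| by apply: lt_le_trans abs _.
  by rewrite ltr_pM2r; lra.
- exists m, (r / 2 * `|y - x|), h; split=> //; last by move=> z /mx; lra.
  rewrite mulrAC; apply: ler_piMr => //.
  by rewrite mulr_ge0 ?divr_ge0// ltW.
have ab0 : 0 < `|b - a| by lra.
have sdl : 0 <= s + dl by lra.
have [|||m [r' [h [hr' hz ah]]]] := IH g a b ab0.
- by apply: le_trans (ltW abs); rewrite mulr_ge0.
- apply: le_trans (ltW abs); rewrite ler_pM2r//.
  by move: sg; rewrite -natr1; lra.
- move=> c c' cx c'x cc'; apply: lip.
  + by apply: le_trans (ler_distD a _ _) _; lra.
  + by apply: le_trans (ler_distD a _ _) _; lra.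
  + apply: le_trans cc'; rewrite exprSr -mulrA; apply: ler_wpM2l => //.
exists m, r', h; split=> //.
  apply: le_trans hr'; rewrite exprSr -!mulrA.
  by do 2 (apply: ler_wpM2l => //; rewrite ?invr_ge0 ?(ltW r0)//);
   apply: ler_wpM2l.
move=> z /hz => za; apply: le_trans (ler_distD a _ _) _; lra.
Qed.

End affine_approximation.

Section affine_families.
Context {R : realType} {X X' : normedModType R} (B : X -> X' -> R).
Hypothesis dB : duality B.

Lemma lipschitz_above_sub (L s s' : R) (g : X -> R) x0 x1 r r' :
    s <= s' -> (forall z, `|z - x1| <= r' -> `|z - x0| <= r) ->
  lipschitz_above L s g x0 r -> lipschitz_above L s' g x1 r'.
Proof.
by move=> ss' sub lip x y /sub xr /sub yr h; apply: lip => //; exact: le_trans h.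
Qed.

Lemma affine_ball (u : X) (L e : R) : `|u| = 1 -> 0 <= L -> 0 < e ->
  exists2 c : R, 0 < c <= 1 & forall g x0 r0, 0 < r0 ->
    lipschitz_above L (c * r0) g x0 r0 ->
  exists m r h, [/\ c * r0 <= r, (forall z, `|z - m| <= r -> `|z - x0| <= r0) &
    affine_on B e g m r h].
Proof.
move=> u1 L0 e0.
have e'0 : 0 < e / (4 * (L + 1)) by rewrite divr_gt0// mulr_gt0//; lra.
have [r /andP[r0 r2] sm] := smooth_scale dB e'0.
pose dl := Num.min 1 (e * r / 4).
have er0 : 0 < e * r / 4 by rewrite divr_gt0// mulr_gt0.
have dl0 : 0 < dl by rewrite lt_min ltr01 er0.
have dl1 : dl <= 1 by rewrite ge_min lexx.
have dle : dl <= e * r / 4 by rewrite ge_min lexx orbT.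
have pars : slope_params B L e dl r by split=> //; apply/andP; split.
(* For this n every nonnegative slope exceeds [L - n * dl], so the descent can start from an
   arbitrary pair of points. *)
have [n nL] : exists n : nat, L <= n%:R * dl.
  exists (Num.bound (L / dl)); rewrite -ler_pdivrMr//.
  by apply/ltW/archi_boundP; rewrite divr_ge0// ltW.
have p0 k : 0 < (4^-1 : R) ^+ k by rewrite exprn_gt0.
have p1 k : (4^-1 : R) ^+ k <= 1 by rewrite exprn_ile1// invf_le1// ler1n.
exists (r / 2 * 4^-1 ^+ n.+1 / 5).
  have a0 : 0 < r / 2 <= 1 by apply/andP; split; lra.
  have := p0 n.+1; have := p1 n.+1; move: (4^-1 ^+ n.+1) => a a1 a00.
  apply/andP; split; first by rewrite divr_gt0// mulr_gt0//; case/andP: a0.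
  have : r / 2 * a <= 1 by apply: mulr_ile1; lra.
  lra.
move=> g x0 s0 s00 lip.
(* The descent stays within [4 * d] of its first point, which lies within d of [x0]; together this
   is [s0]. *)
have [d dE] : {d | d = s0 / 5} by exists (s0 / 5).
have d0 : 0 < d by rewrite dE divr_gt0.
pose y0 := x0 + d *: u.
have yx : `|y0 - x0| = d by rewrite /y0 [x0 + _]addrC addrK normrZ u1 gtr0_norm// mulr1.
have key x y : `|x - x0| <= d -> `|y - x| = d -> 0 <= g y - g x ->
  exists m r' h, [/\ r / 2 * 4^-1 ^+ n.+1 / 5 * s0 <= r',
    (forall z, `|z - m| <= r' -> `|z - x0| <= s0) & affine_on B e g m r' h].
  move=> xd yxd gxy.
  have sub z : `|z - x| <= 4 * d -> `|z - x0| <= s0.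
    by move=> zx; apply: le_trans (ler_distD x _ _) _; lra.
  have [||||m [r' [h [hr hz ah]]]] := @slope_descent _ _ _ _ dB L e dl r n pars g x y.
  - by rewrite yxd.
  - by [].
  - by apply: le_trans gxy; rewrite mulr_le0_ge0//; lra.
  - rewrite yxd; apply: lipschitz_above_sub sub lip.
    rewrite -mulrA -mulrA dE; have := p0 n.+1; move: (4^-1 ^+ n.+1) => a a0.
    have : 0 < a * s0 by rewrite mulr_gt0.
    by nra.
  exists m, r', h; split=> //; last first.
    by move=> z /hz; rewrite yxd; exact: sub.
  apply: le_trans hr; rewrite yxd dE exprSr; have := p0 n.
  move: (4^-1 ^+ n) => a a0.
  have : 0 < r * a * s0 by rewrite !mulr_gt0.
  lra.
have [h|h] := leP 0 (g y0 - g x0).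
  by apply: (key x0 y0) => //; rewrite subrr normr0 ltW.
by apply: (key y0 x0); rewrite ?yx// 1?distrC ?yx//; lra.
Qed.

Lemma affine_ball_family (u : X) (L e : R) n : `|u| = 1 -> 0 <= L -> 0 < e ->
  exists2 c : R, 0 < c <= 1 & forall (g : nat -> X -> R) x0 r0, 0 < r0 ->
    (forall i, (i < n)%N -> lipschitz_above L (c * r0) (g i) x0 r0) ->
  exists m r h, [/\ c * r0 <= r, (forall z, `|z - m| <= r -> `|z - x0| <= r0) &
    forall i, (i < n)%N -> affine_on B e (g i) m r (h i)].
Proof.
move=> u1 L0; elim: n e => [|n IH] e e0.
  exists 1; first by rewrite ltr01 lexx.
  by move=> g x0 r0 r00 _; exists x0, r0, (fun=> 0); rewrite mul1r.
have [c /andP[c0 c1] hc] := IH _ e0.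
(* [g n] is linearised first, on a ball of radius r1; the other functions then force a ball of
   radius r with [c * r1 <= r] and a new centre. The error of [g n] is doubled by the change of
   centre and must be small relative to the smaller radius. *)
have e1 : 0 < e * c / 2 by rewrite divr_gt0// mulr_gt0.
have [c' /andP[c'0 c'1] hc'] := affine_ball u1 L0 e1.
have cc : c' * c <= c' by rewrite ler_piMr// ltW.
exists (c' * c); first by rewrite mulr_gt0//=; lra.
move=> g x0 r0 r00 lip.
have [|m1 [r1 [h1 [cr1 sub1 ah1]]]] := hc' (g n) x0 r0 r00.
  by apply: lipschitz_above_sub (lip n _) => //; rewrite ler_pM2r.
have r10 : 0 < r1 by apply: lt_le_trans cr1; rewrite mulr_gt0.
have [i ni|m [r [h [cr sub ah]]]] := hc g m1 r1 r10.
  apply: lipschitz_above_sub (lip i _) => //; last exact: ltnW.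
  by rewrite mulrAC mulrC ler_pM2l.
have le_r : c' * c * r0 <= r.
  by apply: le_trans cr; rewrite mulrAC mulrC ler_pM2l.
exists m, r, (fun i => if i == n then h1 else h i); split=> //.
  by move=> z /sub /sub1.
move=> i; rewrite ltnS leq_eqVlt => /predU1P[->|ni]; last first.
  by rewrite ltn_eqF//; exact: ah.
rewrite eqxx => z zm.
have mm : `|m - m| <= r by rewrite subrr normr0; nra.
have k1 := ah1 z (sub _ zm); have k2 := ah1 m (sub _ mm).
have er : e * c / 2 * r1 <= e * r / 2.
  have : e * (c * r1) <= e * r by rewrite ler_pM2l.
  lra.
have -> : z - m = (z - m1) - (m - m1) by rewrite opprB addrA subrK.
rewrite (pairBl dB); rewrite !ler_norml in k1 k2 *.
move/andP: k1 => [? ?]; move/andP: k2 => [? ?]; apply/andP; split; lra.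
Qed.

End affine_families.

(** * Coarse quotient mappings *)

Section coarse_quotients.
Context {R : realType} {X Y : normedModType R}.

Definition coarse_lipschitz_quotient (L D K : R) (f : X -> Y) :=
  (forall x y, `|f x - f y| <= L * (`|x - y| + 1)) /\
  (forall x y, exists2 z, `|z - x| <= D * (`|y - f x| + 1) & `|y - f z| <= K).

Let intermediate (V : normedModType R) (x y : V) n : `|y - x| <= n.+2%:R ->
  exists z, `|z - x| <= n.+1%:R /\ `|y - z| <= 1.
Proof.
move=> xy; exists (y - n.+2%:R^-1 *: (y - x)).
have n0 : 0 < n.+2%:R :> R by rewrite ltr0n.
have e : `|y - x| / n.+2%:R <= 1 by rewrite ler_pdivrMr// mul1r.
split; last by rewrite opprB addrC subrK normrZ ger0_norm ?invr_ge0 ?ler0n// mulrC.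
rewrite addrAC -{1}[y - x]scale1r -scalerBl normrZ ger0_norm.
  rewrite mulrBl mul1r mulrC.
  apply: (@le_trans _ _ ((1 - n.+2%:R^-1) * n.+2%:R)).
    rewrite mulrBl mul1r mulVf ?gt_eqF//.
    have : (1 - n.+2%:R^-1) * `|y - x| <= (1 - n.+2%:R^-1) * n.+2%:R.
      by rewrite ler_wpM2l// subr_ge0 invf_le1// ler1n.
    by rewrite !mulrBl !mul1r mulVf ?gt_eqF// [_^-1 * _]mulrC.
  by rewrite mulrBl mul1r mulVf ?gt_eqF// -[n.+2%:R]natr1 addrK.
by rewrite subr_ge0 invf_le1// ler1n.
Qed.

(** Points of a normed space are joined by chains of unit steps, whose number exceeds the distance
    by at most one. When such a chain in [Y] is lifted, the error does not accumulate: each step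
    asks for a point within K + 1 of the current image, namely the old error K plus the step, and
    again lands within K. *)
Lemma coarse_quotient_lipschitz :
  coarse_quotient (norm_metric X) (norm_metric Y) ->
  exists f L D K, [/\ 0 < L, 0 < D, 0 <= K & coarse_lipschitz_quotient L D K f].
Proof.
move=> [K K0 [f [cc co]]].
(* Coarse continuity uses a strict inequality and the steps may have length exactly 1, hence the
   scale 2. *)
have [s s0 hs] := cc 2 (ltr0n _ 2).
have [|d d0 hd] := co (K + 1); first by rewrite ltr_wpDl.
exists f, s, d, K; split=> //; split=> x y.
  have chain n : forall x y, `|y - x| <= n.+1%:R -> `|f y - f x| <= s * n.+1%:R.
    elim: n => [|n IH] {}x {}y xy.
      rewrite mulr1; apply: ltW; apply: (hs y x).
      by apply: le_lt_trans xy _; rewrite ltr1n.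
    have [z [zx yz]] := intermediate xy.
    apply: le_trans (ler_distD (f z) _ _) _.
    rewrite -[n.+2]add1n natrD mulrDr mulr1; apply: lerD; last exact: IH.
    apply: ltW; apply: (hs y z).
    by apply: le_lt_trans yz _; rewrite ltr1n.
  have := truncn_itv (normr_ge0 (x - y)) => /andP[h1 h2].
  apply: le_trans (chain _ _ _ (ltW h2)) _.
  by rewrite ler_pM2l// -natr1 lerD2r.
have chain n : forall y, `|y - f x| <= n.+1%:R ->
    exists2 z, `|z - x| <= d * n.+1%:R & `|y - f z| <= K.
  have one x' y' : `|y' - f x'| <= K + 1 ->
      exists2 z, `|z - x'| <= d & `|y' - f z| <= K.
    move=> xy; have [|_ [z zx <-] yz] := hd x' y'.
      by rewrite /metric_cball /= distrC in xy *.
    by exists z => //; rewrite distrC.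
  elim: n => [|n IH] {}y xy.
    have [|z zx yz] := one x y; first by apply: le_trans xy _; rewrite lerDr.
    by exists z; rewrite ?mulr1.
  have [y' [yx yy]] := intermediate xy.
  have [z' zx' yz'] := IH _ yx.
  have [|z zz yz] := one z' y.
    by apply: le_trans (ler_distD y' _ _) _; rewrite addrC lerD.
  exists z => //; apply: le_trans (ler_distD z' _ _) _.
  by rewrite -[n.+2]add1n natrD mulrDr mulr1 lerD.
have /andP[h1 h2] := truncn_itv (normr_ge0 (y - f x)).
have [z zx yz] := chain _ _ (ltW h2); exists z => //.
apply: le_trans zx _.
by rewrite ler_pM2l// -natr1 lerD2r.
Qed.

End coarse_quotients.

Section functional_approximation.
Context {R : realType} {X X' Y : normedModType R} (B : X -> X' -> R).
Hypothesis dB : duality B.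

(* The linear parts of the affine approximations of the ys i \o f on a large
   ball reproduce the norm of the span of the ys i up to constants. *)
Lemma functional_approximation (f : X -> Y) (L D K : R) (u : X)
    (ys : nat -> Y -> R) :
    `|u| = 1 -> 0 < L -> 0 < D -> 0 <= K -> coarse_lipschitz_quotient L D K f ->
    (forall i y z, ys i (y - z) = ys i y - ys i z) ->
    (forall i a y, ys i (a *: y) = a * ys i y) ->
    (forall i y, `|ys i y| <= `|y|) ->
  forall n e, 0 < e -> exists h : nat -> X', forall a : nat -> R,
    (forall C, 0 <= C ->
      (forall y, `|\sum_(i < n) a i * ys i y| <= C * `|y|) ->
      `|\sum_(i < n) a i *: h i| <= 2 * L * C + e * \sum_(i < n) `|a i|) /\
    (forall y, `|\sum_(i < n) a i * ys i y| <=
       (2 * D * `|\sum_(i < n) a i *: h i| + e * \sum_(i < n) `|a i|) * `|y|).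
Proof.
move=> u1 L0 D0 K0 [fL fD] ysB ysZ ys1 n e e0.
pose e1 := e / (4 * (D + 1)).
have D4 : 0 < 4 * (D + 1) by lra.
have e10 : 0 < e1 by rewrite divr_gt0.
have e1e : e1 * (4 * D + 4) = e.
  by rewrite (_ : 4 * D + 4 = 4 * (D + 1)) ?divfK ?gt_eqF//; lra.
have L20 : 0 <= 2 * L by lra.
have [c /andP[c0 c1] hc] := affine_ball_family dB n u1 L20 e10.
(* the radius absorbs the additive constants of f *)
pose r0 := (1 + 2 * D + 4 * D * (K + 1) / e) / c.
have De0 : 0 < 4 * D * (K + 1) / e by rewrite divr_gt0// !mulr_gt0//; lra.
have r00 : 0 < r0 by rewrite divr_gt0//; lra.
have cr0 : c * r0 = 1 + 2 * D + 4 * D * (K + 1) / e.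
  by rewrite /r0 mulrC divfK// gt_eqF.
(* At distances at least 1 the additive constant is absorbed, [|x - y| + 1 <= 2 * |x - y|], which
   gives the Lipschitz constant [2 * L]. *)
have [i ni x y _ _ xy|m [r [h [cr _ ah]]]] := hc (fun i x => ys i (f x)) 0 r0 r00.
  rewrite -ysB; apply: le_trans (ler_norm _) _; apply: le_trans (ys1 _ _) _.
  apply: le_trans (fL _ _) _.
  have xy1 : 1 <= `|x - y| by apply: le_trans xy; rewrite cr0; lra.
  have : L * 1 <= L * `|x - y| by rewrite ler_pM2l.
  lra.
rewrite cr0 in cr.
have r1 : 1 <= r by lra.
have r_gt0 : 0 < r by lra.
exists h => a.
set H := \sum_(i < n) a i *: h i; set A := \sum_(i < n) `|a i|.
have A0 : 0 <= A by apply: sumr_ge0.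
pose y' y := \sum_(i < n) a i * ys i y.
have y'B y z : y' (y - z) = y' y - y' z.
  by rewrite /y' -sumrB; apply: eq_bigr => i _; rewrite ysB mulrBr.
have y'Z b y : y' (b *: y) = b * y' y.
  by rewrite /y' mulr_sumr; apply: eq_bigr => i _; rewrite ysZ mulrCA.
have y'A y : `|y' y| <= A * `|y|.
  apply: le_trans (ler_norm_sum _ _ _) _; rewrite mulr_suml.
  by apply: ler_sum => i _; rewrite normrM ler_wpM2l.
have approx z : `|z - m| <= r ->
    `|y' (f z - f m) - B (z - m) H| <= e1 * A * r.
  move=> zm; rewrite /H (pair_sumr dB) y'B /y' -!sumrB.
  apply: le_trans (ler_norm_sum _ _ _) _.
  rewrite mulrAC mulrC mulr_suml; apply: ler_sum => i _.
  rewrite (pairZr dB) -!mulrBr normrM ler_wpM2l//.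
  exact: ah.
split=> [C C0 hC|y].
  have eA0 : 0 <= e * A by rewrite mulr_ge0// ltW.
  apply: (dual_norm_le dB) => [|v]; first by rewrite addr_ge0// !mulr_ge0//; lra.
  have [->|v0] := eqVneq v 0; first by rewrite (pair0l dB) !normr0 mulr0.
  have nv0 : 0 < `|v| by rewrite normr_gt0.
  pose z := m + (r / `|v|) *: v.
  have zm : z - m = (r / `|v|) *: v by rewrite /z addrC addKr.
  have nzm : `|z - m| = r.
    by rewrite zm normrZ gtr0_norm ?divr_gt0// divfK ?gt_eqF.
  have := approx z; rewrite nzm lexx => /(_ isT) h1.
  have h2 : `|y' (f z - f m)| <= C * (L * (r + 1)).
    by apply: le_trans (hC _) _; rewrite ler_wpM2l// -nzm.
  have h3 : `|B (z - m) H| <= (2 * L * C + e * A) * r.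
    have CL : 0 <= C * L by rewrite mulr_ge0// ltW.
    have : C * L * (r + 1) <= C * L * (2 * r) by rewrite ler_wpM2l//; lra.
    have e1A : e1 * A <= e * A.
      by rewrite ler_wpM2r// -e1e ler_pMr//; lra.
    have : e1 * A * r <= e * A * r by rewrite ler_pM2r.
    rewrite !ler_norml in h1 h2 *; move/andP: h1 => [? ?]; move/andP: h2 => [? ?].
    by move=> ? ?; apply/andP; split; lra.
  move: h3; rewrite zm (pairZl dB.1) normrM gtr0_norm ?divr_gt0//.
  by rewrite mulrAC ler_pdivrMr// mulrC mulrAC ler_pM2r.
have [->|y0] := eqVneq y 0.
  by have := y'A 0; rewrite normr0 !mulr0.
have ny0 : 0 < `|y| by rewrite normr_gt0.
(* a point at distance s from f m in the direction of y *)
pose s := r / (2 * D).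
have D20 : 0 < 2 * D by lra.
have s1 : 1 <= s by rewrite ler_pdivlMr//; lra.
have s0 : 0 < s by lra.
have rs : r = 2 * D * s by rewrite /s mulrC divfK ?gt_eqF.
have Ds : D * (s + 1) <= r.
  have : D * (s + 1) <= D * (2 * s) by rewrite ler_pM2l//; lra.
  lra.
pose v := f m + (s / `|y|) *: y.
have vm : v - f m = (s / `|y|) *: y by rewrite /v addrC addKr.
have nvm : `|v - f m| = s.
  by rewrite vm normrZ gtr0_norm ?divr_gt0// divfK ?gt_eqF.
have [z zm fz] := fD m v.
rewrite nvm in zm.
have zr : `|z - m| <= r by apply: le_trans zm _.
have h1 := approx z zr.
have h2 : `|y' (v - f z)| <= A * K by apply: le_trans (y'A _) _; rewrite ler_wpM2l.
have h3 : `|B (z - m) H| <= r * `|H|.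
  by apply: le_trans (pair_le dB.1 _ _) _; rewrite ler_wpM2r.
have h4 : `|y' (v - f m)| <= A * K + e1 * A * r + r * `|H|.
  have -> : v - f m = (v - f z) + (f z - f m) by rewrite addrA subrK.
  have -> : y' ((v - f z) + (f z - f m)) = y' (v - f z) + y' (f z - f m).
    have := y'B (v - f z) (- (f z - f m)); rewrite opprK => ->.
    by rewrite -(scaleN1r (f z - f m)) y'Z mulN1r opprK.
  have h5 : `|y' (f z - f m)| <= e1 * A * r + r * `|H|.
    rewrite !ler_norml in h1 h3 *.
    by move/andP: h1 => [? ?]; move/andP: h3 => [? ?]; apply/andP; split; lra.
  by apply: le_trans (ler_normD _ _) _; move: (lerD h2 h5); rewrite addrA.
(* The choice of [r0] makes the lifting error K at most [e / 2 * s]; the other half of e pays for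
   the affine error [e1]. *)
have h5 : A * K + e1 * A * r + r * `|H| <= (2 * D * `|H| + e * A) * s.
  have Ks : K <= e / 2 * s.
    have : 4 * D * (K + 1) <= 2 * D * s * e by rewrite -ler_pdivrMr// -rs; lra.
    rewrite (_ : 4 * D * (K + 1) = 2 * D * (2 * (K + 1))); last by ring.
    rewrite (_ : 2 * D * s * e = 2 * D * (s * e)); last by ring.
    by rewrite ler_pM2l//; lra.
  have KA : A * K <= A * (e / 2 * s) by rewrite ler_wpM2l.
  have e1e2 : 2 * D * e1 <= e / 2 by rewrite -e1e; nra.
  have : A * (2 * D * e1) * s <= A * (e / 2) * s.
    by rewrite ler_pM2r// ler_wpM2l.
  rewrite rs; lra.
have : `|y' (v - f m)| = s / `|y| * `|y' y|.
  by rewrite vm y'Z normrM gtr0_norm ?divr_gt0.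
move=> h6; have : s / `|y| * `|y' y| <= (2 * D * `|H| + e * A) * s.
  by rewrite -h6; apply: le_trans h4 h5.
by rewrite mulrAC ler_pdivrMr// => h7; rewrite -(ler_pM2l s0) mulrA [s * (_ + _)]mulrC.
Qed.

End functional_approximation.

(** * Norming functionals *)

Section hahn_banach.
Context {R : realType} {Y : normedModType R}.
Implicit Types (q : Y -> R) (x y : Y).

Definition sublinear q := (forall x y, q (x + y) <= q x + q y) /\
  (forall (a : R) x, 0 <= a -> q (a *: x) <= a * q x).

Let inf_le (V : set R) b v : lbound V b -> V v -> inf V <= v.
Proof. by move=> lb Vv; apply: ge_inf => //; exists b. Qed.

Let le_mul_inf (V : set R) (a b c : R) : V !=set0 -> lbound V b -> 0 <= a ->
  (forall v, V v -> c <= a * v) -> c <= a * inf V.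
Proof.
move=> V0 lb; rewrite le_eqVlt => /predU1P[<-|a0] h.
  by case: V0 => v /h; rewrite !mul0r.
rewrite -ler_pdivrMl//; apply: lb_le_inf => // v /h.
by rewrite ler_pdivrMl.
Qed.

Let le_add_inf (V W : set R) c : V !=set0 -> W !=set0 ->
  (forall v w, V v -> W w -> c <= v + w) -> c <= inf V + inf W.
Proof.
move=> V0 W0 h; rewrite -lerBlDr; apply: lb_le_inf => // v Vv.
rewrite lerBlDr addrC -lerBlDr; apply: lb_le_inf => // w Ww.
by rewrite lerBlDr addrC; exact: h.
Qed.

Lemma sublinear0 q : sublinear q -> q 0 = 0.
Proof.
move=> [qD qZ]; apply/eqP; rewrite eq_le; apply/andP; split.
  by have := qZ 0 0 (lexx _); rewrite scaler0 mul0r.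
by have := qD 0 0; rewrite addr0; lra.
Qed.

Lemma sublinearN q x : sublinear q -> - q (- x) <= q x.
Proof.
by move=> sq; have := sq.1 x (- x); rewrite subrr (sublinear0 sq); lra.
Qed.

(** The functional is the infimum over t >= 0 of [q (x + t *: y) - t * q y]. For a minimal q it
    equals q, and the last inequality becomes the missing half of additivity. *)
Lemma sublinear_slide q y : sublinear q -> exists q', [/\ sublinear q',
  forall x, q' x <= q x & forall x, q' x <= q (x + y) - q y].
Proof.
move=> sq; have [qD qZ] := sq.
pose V x := [set q (x + t *: y) - t * q y | t in [set t : R | 0 <= t]].
have V0 x : V x !=set0 by exists (q (x + 0 *: y) - 0 * q y), 0 => /=.
have lbV x : lbound (V x) (- q (- x)).
  move=> _ [t /= t0 <-].
  have := qD (x + t *: y) (- x); rewrite [x + _]addrC addrK.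
  have : t * q y <= q (t *: y).
    move: t0; rewrite le_eqVlt => /predU1P[<-|t0].
      by rewrite scale0r mul0r (sublinear0 sq).
    have := qZ t^-1 (t *: y); rewrite invr_ge0 => /(_ (ltW t0)).
    by rewrite scalerA mulVf ?gt_eqF// scale1r ler_pdivlMl.
  lra.
exists (fun x => inf (V x)); split; first split.
- move=> x z; apply: le_add_inf => // _ _ [t /= t0 <-] [s /= s0 <-].
  apply: (@le_trans _ _ (q (x + z + (t + s) *: y) - (t + s) * q y)).
    by apply: inf_le (lbV _) _; exists (t + s) => //=; rewrite addr_ge0.
  have := qD (x + t *: y) (z + s *: y); rewrite addrACA -scalerDl; lra.
- move=> a x a0; apply: (le_mul_inf _ (lbV _) a0) => // _ [t /= t0 <-].
  apply: (@le_trans _ _ (q (a *: x + (a * t) *: y) - (a * t) * q y)).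
    by apply: inf_le (lbV _) _; exists (a * t) => //=; rewrite mulr_ge0.
  have := qZ a (x + t *: y) a0; rewrite scalerDr scalerA; lra.
- move=> x; apply: inf_le (lbV _) _; exists 0 => //=.
  by rewrite scale0r addr0 mul0r subr0.
- move=> x; apply: inf_le (lbV _) _; exists 1 => //=.
  by rewrite scale1r mul1r.
Qed.

Let sub_le q0 := {q | sublinear q /\ forall x, q x <= q0 x}.

Lemma minimal_sublinear q0 : sublinear q0 -> exists q, [/\ sublinear q,
  forall x, q x <= q0 x &
  forall q', sublinear q' -> (forall x, q' x <= q x) -> q' = q].
Proof.
move=> s0.
(* The order is reversed, so that a maximal element is a minimal functional; a nonempty chain is
   bounded by its pointwise infimum. *)
have [| | | |q qmin] := @Zorn (sub_le q0)
    (fun s t => `[< forall x, sval t x <= sval s x >]).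
- by move=> s; apply/asboolP.
- by move=> r s t /asboolP rs /asboolP st; apply/asboolP => x; apply: le_trans (rs x).
- move=> [s ?] [t ?] /asboolP /= st /asboolP /= ts; apply: eq_exist.
  by apply/funext => x; apply/eqP; rewrite eq_le st ts.
- move=> A tot; have [->|/set0P[s1 As1]] := eqVneq A set0.
    by exists (exist _ q0 (conj s0 (fun x => lexx (q0 x)))).
  pose V x := [set sval s x | s in A].
  have V0 x : V x !=set0 by exists (sval s1 x), s1.
  have lbV x : lbound (V x) (- q0 (- x)).
    move=> _ [s As <-]; have [ss sle] := svalP s.
    by apply: le_trans (sublinearN x ss); rewrite lerN2.
  have sI : sublinear (fun x => inf (V x)).
    split=> [x y|a x a0].
      apply: le_add_inf => // _ _ [s As <-] [t At <-].
      wlog st : s t x y As At / forall z, sval t z <= sval s z.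
        move=> wl; have [/asboolP st|/asboolP ts] := tot _ _ As At.
          exact: wl.
        by rewrite [x + y]addrC [leRHS]addrC; exact: wl.
      apply: (@le_trans _ _ (sval t (x + y))).
        by apply: inf_le (lbV _) _; exists t.
      apply: le_trans ((svalP t).1.1 x y) _.
      by rewrite lerD2r.
    apply: (le_mul_inf _ (lbV _) a0) => // _ [s As <-].
    apply: le_trans ((svalP s).1.2 a x a0).
    by apply: inf_le (lbV _) _; exists s.
  have Ile s : A s -> forall x, inf (V x) <= sval s x.
    by move=> As x; apply: inf_le (lbV _) _; exists s.
  have I0 x : inf (V x) <= q0 x.
    by apply: le_trans (Ile _ As1 x) _; exact: (svalP s1).2.
  exists (exist _ (fun x => inf (V x)) (conj sI I0)) => s As.
  by apply/asboolP => x /=; exact: Ile.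
exists (sval q); have [sq qle] := svalP q; split=> // q' sq' q'q.
have q'0 x : q' x <= q0 x by apply: le_trans (q'q x) _.
have /= := qmin (exist _ q' (conj sq' q'0)).
by move=> /(_ (asboolT q'q)) <-.
Qed.

(** The norm is slid along y before it is minimised: the resulting [q0] satisfies
    [q0 (- y) <= - |y|], so every linear functional below it takes at least the value |y| at y. *)
Lemma norming_functional y : exists phi : Y -> R,
  [/\ forall a x z, phi (a *: x + z) = a * phi x + phi z,
      forall x, `|phi x| <= `|x| & phi y = `|y| ].
Proof.
have sn : sublinear (fun x => `|x|).
  split; first exact: ler_normD.
  by move=> a x a0; rewrite normrZ ger0_norm.
have [q0 [s0 q0n q0y]] := sublinear_slide y sn.
have [q [sq qq0 qmin]] := minimal_sublinear s0.
have qD x z : q (x + z) = q x + q z.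
  have [q' [sq' q'q q'z]] := sublinear_slide z sq.
  apply/eqP; rewrite eq_le sq.1/= -lerBrDr.
  by rewrite -{1}(qmin _ sq' q'q).
have qN x : q (- x) = - q x.
  by apply/eqP; rewrite -addr_eq0 -qD addNr (sublinear0 sq).
have qZ0 a x : 0 <= a -> q (a *: x) = a * q x.
  move=> a0; apply/eqP; rewrite eq_le sq.2//=.
  by rewrite -[leRHS]opprK -qN -scalerN lerNr -mulrN -qN; exact: sq.2.
have qZ a x : q (a *: x) = a * q x.
  have [a0|a0] := leP 0 a; first exact: qZ0.
  by rewrite -[a]opprK scaleNr qN qZ0 ?oppr_ge0 1?ltW// !mulNr.
have qn x : q x <= `|x| by apply: le_trans (qq0 x) (q0n x).
have qn' x : `|q x| <= `|x|.
  by rewrite ler_norml qn andbT lerNl -qN; apply: le_trans (qn _) _; rewrite normrN.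
exists q; split=> //.
  by move=> a x z; rewrite qD qZ.
apply/eqP; rewrite eq_le qn /= -[leRHS]opprK -qN lerNr.
apply: le_trans (qq0 _) _; apply: le_trans (q0y _) _.
by rewrite addNr normr0 sub0r.
Qed.

End hahn_banach.

(** * Construction of the linear quotient *)

Section lincomb.
Context {R : realType} {V : lmodType R}.
Implicit Types (F : nat -> V) (P Q : {poly R}).

(** Polynomials stand for finitely supported coefficient sequences, so that the span of F is the
    image of a vector space under a linear map, as [riesz_subspace] requires. *)
Definition lincomb F P : V := \sum_(i < size P) P`_i *: F i.

Lemma lincombE N F P : (size P <= N)%N -> lincomb F P = \sum_(i < N) P`_i *: F i.
Proof.
move=> PN; rewrite /lincomb (big_ord_widen N (fun i => P`_i *: F i))//.
rewrite big_mkcond /=; apply: eq_bigr => i _; case: ltnP => // Pi.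
by rewrite nth_default// scale0r.
Qed.

Lemma lincombD F a P Q : lincomb F (a *: P + Q) = a *: lincomb F P + lincomb F Q.
Proof.
pose N := maxn (size P) (size Q).
have PN : (size P <= N)%N by rewrite leq_maxl.
have QN : (size Q <= N)%N by rewrite leq_maxr.
have PQN : (size (a *: P + Q)%R <= N)%N.
  rewrite (leq_trans (size_polyD _ _))// geq_max QN andbT.
  exact: leq_trans (size_scale_leq _ _) PN.
rewrite (lincombE _ PN) (lincombE _ QN) (lincombE _ PQN) scaler_sumr -big_split.
by apply: eq_bigr => i _ /=; rewrite coefD coefZ scalerDl scalerA.
Qed.

Lemma lincomb0 F : lincomb F 0 = 0.
Proof. by rewrite /lincomb size_poly0 big_ord0. Qed.

Lemma lincombZ F a P : lincomb F (a *: P) = a *: lincomb F P.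
Proof. by rewrite -[_ *: P]addr0 lincombD lincomb0 addr0. Qed.

Lemma lincombXn F i : lincomb F 'X^i = F i.
Proof.
rewrite (@lincombE i.+1) ?size_polyXn// big_ord_recr /= coefXn eqxx scale1r.
rewrite big1 ?add0r// => j _; rewrite coefXn ltn_eqF ?scale0r//; exact: ltn_ord.
Qed.

End lincomb.

Section quotient_construction.
Context {R : realType} {X X' : normedModType R} {Y : completeNormedModType R}.
Context (B : X -> X' -> R) (ys : nat -> Y -> R) (g : nat -> X') (L D : R).
Hypothesis dB : duality B.
Hypothesis ysD : forall i a y z, ys i (a *: y + z) = a * ys i y + ys i z.
Hypothesis ys1 : forall i y, `|ys i y| <= `|y|.
Hypothesis ysn : forall y, exists i, `|y| <= 2 * `|ys i y|.
Hypothesis gU : forall N (a : nat -> R) C, 0 <= C ->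
  (forall y, `|\sum_(i < N) a i * ys i y| <= C * `|y|) ->
  `|\sum_(i < N) a i *: g i| <= L * C.
Hypothesis gL : forall N (a : nat -> R) y,
  `|\sum_(i < N) a i * ys i y| <= D * `|\sum_(i < N) a i *: g i| * `|y|.
Hypothesis L0 : 0 < L.
Hypothesis D0 : 0 < D.

Let graph m y := forall i, B m (g i) = ys i y.

Let ys0 i : ys i 0 = 0.
Proof. by have := ysD i (-1) 0 0; rewrite scaler0 addr0; lra. Qed.

Let ysB i y z : ys i (y - z) = ys i y - ys i z.
Proof. by rewrite addrC -scaleN1r ysD mulN1r addrC. Qed.

Let graph0 : graph 0 0.
Proof. by move=> i; rewrite (pair0l dB) ys0. Qed.

Let graphD a m y m' y' : graph m y -> graph m' y' ->
  graph (a *: m + m') (a *: y + y').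
Proof.
by move=> h h' i; rewrite (pairDl dB.1) (pairZl dB.1) h h' ysD.
Qed.

Let graphB m y m' y' : graph m y -> graph m' y' -> graph (m - m') (y - y').
Proof.
by move=> h h' i; rewrite (pairBl dB) h h' ysB.
Qed.

Let norm_g i : `|g i| <= L.
Proof.
have := @gU i.+1 (fun j => (j == i)%:R) 1 ler01.
have E (V : lmodType R) (F : nat -> V) :
    \sum_(j < i.+1) (j == i :> nat)%:R *: F j = F i.
  rewrite big_ord_recr /= eqxx scale1r big1 ?add0r// => j _.
  by rewrite ltn_eqF ?scale0r//; exact: ltn_ord.
rewrite E mulr1; apply => y.
by have := E R^o (ys ^~ y); rewrite /GRing.scale/= => ->; rewrite mul1r.
Qed.

Let graph_le m y : graph m y -> `|y| <= 2 * L * `|m|.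
Proof.
move=> h; have [i] := ysn y; rewrite -h => yi; apply: le_trans yi _.
rewrite -mulrA ler_pM2l// mulrC; apply: le_trans (pair_le dB.1 _ _) _.
by rewrite ler_wpM2l.
Qed.

Let yP y (P : {poly R}) := @lincomb R R^o (ys ^~ y) P.

Let yP_le y P : `|yP y P| <= D * `|lincomb g P| * `|y|.
Proof. exact: gL. Qed.

(** The lower estimate [gL] says that evaluation at y is a bounded functional on the span of the
    [g i]; a representing point is a preimage of y. *)
Let graph_surj y : exists m, graph m y.
Proof.
have [||||m hm] := @riesz_subspace _ _ _ B dB {poly R} setT (lincomb g) (yP y)
   I (fun _ _ _ _ _ => I) _ (D * `|y|).
- by move=> a P Q; rewrite lincombD.
- by move=> a P Q; rewrite /yP lincombD.
- by rewrite mulr_ge0// ltW.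
- by move=> P _; rewrite mulrAC; exact: yP_le.
by exists m => i; have := hm 'X^i I; rewrite /yP !lincombXn.
Qed.

(** By [graph_le] the second coordinates form a Cauchy sequence whenever the first ones converge;
    here the completeness of [Y] enters. *)
Let graph_closed x : (forall e, 0 < e -> exists m y, graph m y /\ `|m - x| <= e) ->
  exists y, graph x y.
Proof.
move=> h.
have /choice[my hmy] : forall n : nat, exists my : X * Y,
    graph my.1 my.2 /\ `|my.1 - x| <= n.+1%:R^-1.
  by move=> n; have [|m [y ?]] := h n.+1%:R^-1; [rewrite invr_gt0|exists (m, y)].
have small (e : R) : 0 < e -> \forall n \near \oo, `|(my n).1 - x| < e.
  move=> e0; near=> n; apply: le_lt_trans (hmy n).2 _.
  near: n; exact: near_infty_natSinv_lt (PosNum e0).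
have cy : cvgn (fun n => (my n).2).
  apply/cauchy_cvgP/cauchyP => e e0.
  have e'0 : 0 < e / (4 * L) by rewrite divr_gt0// mulr_gt0.
  have [N _ hN] := small _ e'0.
  exists (my N).2, N => // n /= Nn; rewrite -ball_normE /=.
  apply: le_lt_trans (graph_le (graphB (hmy N).1 (hmy n).1)) _.
  have := hN N (leqnn _); have := hN n Nn => /= h1 h2.
  have : `|(my N).1 - (my n).1| < 2 * (e / (4 * L)).
    apply: le_lt_trans (ler_distD x _ _) _.
    by rewrite [`|x - _|]distrC mulr2n mulrDl !mul1r ltrD.
  rewrite mulrA ltr_pdivlMr ?mulr_gt0// => h3.
  by rewrite -(ltr_pM2r (_ : 0 < 2 :> R))//; lra.
exists (limn (fun n => (my n).2)) => i.
have [y yE] : {y | y = limn (fun n => (my n).2)} by exists (limn (fun n => (my n).2)).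
rewrite -yE; apply/eqP; rewrite -subr_eq0 -normr_le0; apply/ler_addgt0Pr => e e0.
rewrite add0r.
have e'0 : 0 < e / (2 * (L + 1)) by rewrite divr_gt0// mulr_gt0// addr_gt0.
have /cvgrPdist_lt /(_ _ e'0) h2 := cy.
near \oo => n.
have h1 : `|(my n).1 - x| < e / (2 * (L + 1)) by near: n; exact: small.
have h3 : `|y - (my n).2| < e / (2 * (L + 1)) by rewrite yE; near: n.
rewrite -[B x _](subrK (B (my n).1 (g i))) -(pairBl dB) (hmy n).1 -addrA -ysB.
apply: le_trans (ler_normD _ _) _.
have k1 := pair_le dB.1 (x - (my n).1) (g i).
have k2 := ys1 i ((my n).2 - y).
have k3 : `|x - (my n).1| * `|g i| <= `|x - (my n).1| * L by rewrite ler_wpM2l.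
rewrite distrC in h3; rewrite distrC in h1.
rewrite !ltr_pdivlMr ?mulr_gt0// ?addr_gt0// in h1 h3.
have n1 := normr_ge0 (x - (my n).1); have n2 := normr_ge0 ((my n).2 - y).
have n3 : 0 <= `|(my n).2 - y| * L by rewrite mulr_ge0// ltW.
lra.
Unshelve. all: by end_near. Qed.

(** The domain is closed, so a missing point is separated from it by some h. Such an h is a limit of
    combinations of the [g i], yet it annihilates preimages of all y; the corresponding functionals
    on [Y] are therefore small, and [gU] forces h = 0. *)
Let graph_total x : exists y, graph x y.
Proof.
apply: contrapT => nx.
have [d d0 hd] : exists2 d : R, 0 < d & forall m y, graph m y -> d <= `|m + x|.
  apply: contrapT => nd; apply: nx.
  have [|y hy] := @graph_closed (- x).
    move=> e e0; apply: contrapT => ne; apply: nd; exists e => // m y my.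
    rewrite leNgt; apply/negP => mx; apply: ne; exists m, y; split=> //.
    by rewrite opprK ltW.
  exists (- y); rewrite -[x]opprK -scaleN1r -[- y]scaleN1r.
  by have := graphD (-1) hy graph0; rewrite !addr0.
(* h vanishes on the domain of the graph but not at x *)
have [h [hx h0]] : exists h, B x h = 1 /\ forall m y, graph m y -> B m h = 0.
  have [||||||h hh] := @riesz_subspace _ _ _ _ (duality_flip dB) (X * Y * R)%type
      [set e | graph e.1.1 e.1.2] (fun e => e.1.1 + e.2 *: x) (fun e => e.2)
      _ _ _ d^-1.
  - exact: graph0.
  - by move=> a e e' h h'; exact: graphD.
  - by move=> a e e' /=; rewrite scalerDr scalerDl scalerA addrACA.
  - by [].
  - by rewrite invr_ge0 ltW.
  - move=> [[m y] t] /= my; rewrite -ler_pdivrMl ?invr_gt0// invrK.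
    have [->|t0] := eqVneq t 0; first by rewrite normr0 mulr0.
    have := hd (t^-1 *: m) (t^-1 *: y).
    have my' : graph (t^-1 *: m) (t^-1 *: y).
      by have := graphD t^-1 my graph0; rewrite !addr0.
    move=> /(_ my'); rewrite -(ler_pM2r (_ : 0 < `|t|)) ?normr_gt0// => h.
    apply: le_trans h _; rewrite mulrC -normrZ scalerDr scalerA mulfV//.
    by rewrite scale1r.
  exists h; split.
    by have := hh (0, 0, 1) graph0; rewrite /= add0r scale1r.
  by move=> m y my; have := hh (m, y, 0) my; rewrite /= scale0r addr0.
(* Otherwise some m annihilates every [g i] but not h. Then m lies over 0, hence in the domain of
   the graph, where h vanishes. *)
have happrox e : 0 < e -> exists P, `|lincomb g P + h| < e.
  move=> e0; apply: contrapT => ne.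
  have he P : e <= `|lincomb g P + h|.
    by rewrite leNgt; apply/negP => Pe; apply: ne; exists P.
  have [||||m hm] := @riesz_subspace _ _ _ B dB ({poly R} * R)%type
      setT (fun e => lincomb g e.1 + e.2 *: h) (fun e => e.2)
      I (fun _ _ _ _ _ => I) _ e^-1.
  - by move=> a c c' /=; rewrite lincombD scalerDr scalerDl scalerA addrACA.
  - by [].
  - by rewrite invr_ge0 ltW.
  - move=> [P t] /= _; rewrite -ler_pdivrMl ?invr_gt0// invrK.
    have [->|t0] := eqVneq t 0; first by rewrite normr0 mulr0.
    have := he (t^-1 *: P); rewrite lincombZ.
    rewrite -(ler_pM2r (_ : 0 < `|t|)) ?normr_gt0// => h'.
    apply: le_trans h' _; rewrite mulrC -normrZ scalerDr scalerA mulfV//.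
    by rewrite scale1r.
  have m0 : graph m 0.
    move=> i; have := hm ('X^i, 0) I.
    by rewrite /= lincombXn scale0r addr0 ys0.
  have := hm (0, 1) I; rewrite /= (pairDr dB) scale1r (h0 _ _ m0) addr0.
  rewrite lincomb0 (pair0r dB) => /eqP.
  by rewrite eq_sym oner_eq0.
have : h = 0.
  apply/eqP; rewrite -normr_le0; apply/ler_addgt0Pr => e e0; rewrite add0r.
  have LD0 : 0 < L * (2 * D) + 1 by rewrite addr_gt0// !mulr_gt0.
  pose e1 := e / (L * (2 * D) + 1).
  have e10 : 0 < e1 by rewrite divr_gt0.
  have e1e : e1 * (L * (2 * D) + 1) = e by rewrite divfK ?gt_eqF.
  have [P hP] := happrox _ e10.
  (* The bound must not involve the norm of a preimage m of y. A second approximation Q, chosen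
     after m, makes [yP y Q] arbitrarily small, while the difference of P and Q is controlled by
     [gL] alone. *)
  have yPP y : `|yP y P| <= 2 * D * e1 * `|y|.
    have [m my] := graph_surj y.
    apply/ler_addgt0Pr => e' e'0.
    pose e2 := Num.min e1 (e' / (`|m| + 1)).
    have m10 : 0 < `|m| + 1 by rewrite ltr_wpDl.
    have e20 : 0 < e2 by rewrite lt_min e10 divr_gt0.
    have [Q hQ] := happrox _ e20.
    have yQ : `|yP y Q| <= e'.
      have -> : yP y Q = B m (lincomb g Q + h).
        rewrite (pairDr dB) (h0 _ _ my) addr0 /lincomb (pair_sumr dB).
        by apply: eq_bigr => i _; rewrite (pairZr dB) my.
      apply: le_trans (pair_le dB.1 _ _) _.
      have : `|lincomb g Q + h| <= e' / (`|m| + 1).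
        by apply: le_trans (ltW hQ) _; rewrite ge_min lexx orbT.
      rewrite ler_pdivlMr// => k; apply: le_trans k; rewrite mulrDr mulr1 mulrC.
      by rewrite lerDl.
    have hQ1 : `|lincomb g Q + h| < e1.
      by apply: lt_le_trans hQ _; rewrite ge_min lexx.
    have yPQ : `|yP y (- 1 *: Q + P)| <= D * (2 * e1) * `|y|.
      apply: le_trans (yP_le _ _) _; rewrite ler_wpM2r// ler_pM2l//.
      rewrite lincombD scaleN1r addrC.
      have -> : lincomb g P - lincomb g Q = (lincomb g P + h) - (lincomb g Q + h).
        by rewrite opprD addrACA subrr addr0.
      apply: le_trans (ler_normB _ _) _; lra.
    have yPQE : yP y (- 1 *: Q + P) = yP y P - yP y Q.
      by rewrite /yP lincombD /GRing.scale /= mulN1r addrC.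
    rewrite yPQE in yPQ.
    have := ler_normD (yP y P - yP y Q) (yP y Q); rewrite subrK.
    lra.
  have e1D : 0 <= 2 * D * e1 by apply: mulr_ge0; [apply: mulr_ge0|]; rewrite ?ltW.
  have := gU e1D yPP; rewrite -/(lincomb g P) => hh.
  have -> : h = (lincomb g P + h) - lincomb g P.
    by rewrite [lincomb g P + h]addrC addrK.
  have -> : e = e1 + L * (2 * D * e1) by rewrite -e1e; ring.
  by apply: le_trans (ler_normB _ _) _; rewrite lerD// ltW.
by move: hx => /[swap] ->; rewrite (pair0r dB) => /eqP; rewrite eq_sym oner_eq0.
Qed.

Lemma dual_embedding_quotient : linear_quotient X Y.
Proof.
have [T hT] := choice graph_total.
have graph_inj m y z : graph m y -> graph m z -> y = z.
  move=> my mz; apply/eqP; rewrite -subr_eq0 -normr_le0.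
  by apply: le_trans (graph_le (graphB my mz)) _; rewrite subrr normr0 mulr0.
have Tlin : linear T.
  by move=> a u v; apply: graph_inj (hT _) _; exact: graphD.
pose Tm := GRing.isLinear.Build R X Y *:%R T Tlin.
pose TL : {linear X -> Y} := HB.pack T Tm.
exists TL; split; last first.
  by move=> y; have [m my] := graph_surj y; exists m; exact: graph_inj (hT m) my.
apply/linear_boundedP; exists (2 * L); split; first exact: num_real.
move=> M LM x; apply: le_trans (graph_le (hT x)) _.
by rewrite ler_wpM2r// ltW.
Qed.

End quotient_construction.

(** * From coarse to linear quotients for abstract dual pairs *)

Section coarse_quotient_linear.
Context {R : realType} {X X' : normedModType R} {Y : completeNormedModType R}.
Context (B : X -> X' -> R).

Definition dense_seq {V : normedModType R} (d : nat -> V) :=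
  forall v (e : R), 0 < e -> exists i, `|v - d i| < e.

(* Up to passing to the limit along a filter, bounded arrays have a single
   sequence as a limit in the sense of norms of linear combinations; for the
   Lq spaces this says that ultrapowers are locally Lq spaces. *)
Definition array_limits (V : normedModType R) :=
  forall (G : nat -> nat -> V) (A : R), (forall n i, `|G n i| <= A) ->
  exists (U : set_system nat) (g : nat -> V),
    [/\ ProperFilter U, \oo `<=` U & forall N (a : nat -> R),
      (fun n => `|\sum_(i < N) a i *: G n i|) @ U --> `|\sum_(i < N) a i *: g i|].

(** The i-th functional norms [d i]. If [d i] is within |y|/4 of y, its value at y is at least
    [|d i| - |y| / 4], hence at least |y|/2. *)
Lemma norming_sequence (d : nat -> Y) : dense_seq d ->
  exists ys : nat -> Y -> R,
    [/\ forall i a y z, ys i (a *: y + z) = a * ys i y + ys i z,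
        forall i y, `|ys i y| <= `|y| &
        forall y, exists i, `|y| <= 2 * `|ys i y| ].
Proof.
move=> dd; have [ys hys] := choice (fun i => norming_functional (d i)).
exists ys; split.
- by move=> i; case: (hys i).
- by move=> i; case: (hys i).
move=> y; have [->|y0] := eqVneq y 0; first by exists 0; rewrite normr0 mulr_ge0.
have [|i hi] := dd y (`|y| / 4); first by rewrite divr_gt0// normr_gt0.
exists i; have [lin le1 nd] := hys i.
have : ys i y = ys i (y - d i) + ys i (d i).
  by rewrite -[ys i (y - _)]mul1r -lin scale1r subrK.
have h1 := le1 (y - d i); rewrite nd => E.
have h2 : `|ys i y| >= `|d i| - `|y - d i|.
  rewrite E; apply: le_trans (ler_norm _); rewrite addrC lerD2r.
  by move: h1; rewrite ler_norml => /andP[].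
have := ler_distD (d i) y 0; rewrite !subr0 => h3.
lra.
Qed.

(** The images of a dense sequence come within the fixed distance [K + 2 * L] of every point;
    dividing them by large integers makes this distance as small as desired. *)
Lemma coarse_lipschitz_quotient_dense (L D K : R) (f : X -> Y) (xs : nat -> X) :
  0 < L -> 0 <= K -> coarse_lipschitz_quotient L D K f -> dense_seq xs ->
  exists d : nat -> Y, dense_seq d.
Proof.
move=> L0 K0 [fL fD] dx.
exists (fun k => if unpickle k is Some (n, j) then (n.+1%:R)^-1 *: f (xs j) else 0).
move=> y e e0.
have KL : 0 < K + L * 2 by rewrite ltr_wpDl// mulr_gt0.
pose n := Num.bound ((K + L * 2) / e).
have n0 : 0 < n.+1%:R :> R by rewrite ltr0n.
have nKL : K + L * 2 < n.+1%:R * e.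
  rewrite -ltr_pdivrMr//; apply: lt_trans (_ : n%:R < _); last by rewrite ltr_nat.
  by apply: archi_boundP; rewrite divr_ge0// ltW.
have [z _ hz] := fD 0 (n.+1%:R *: y).
have [j hj] := dx z 1 ltr01.
exists (pickle (n, j)); rewrite pickleK.
have -> : y - n.+1%:R^-1 *: f (xs j) = n.+1%:R^-1 *: (n.+1%:R *: y - f (xs j)).
  by rewrite scalerBr scalerA mulVf ?gt_eqF// scale1r.
rewrite normrZ gtr0_norm ?invr_gt0// ltr_pdivrMl//.
apply: le_lt_trans nKL; apply: le_trans (ler_distD (f z) _ _) _; apply: lerD => //.
by apply: le_trans (fL _ _) _; rewrite ler_pM2l// (natrD _ 1 1) lerD2r ltW.
Qed.

Theorem coarse_quotient_linear_quotient (xs : nat -> X) (u : X) :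
  duality B -> `|u| = 1 -> dense_seq xs -> array_limits X' ->
  coarse_quotient (norm_metric X) (norm_metric Y) -> linear_quotient X Y.
Proof.
move=> dB u1 dx lim cq.
have [f [L [D [K [L0 D0 K0 fLD]]]]] := coarse_quotient_lipschitz cq.
have [d dd] := coarse_lipschitz_quotient_dense L0 K0 fLD dx.
have [ys [ysD ys1 ysn]] := norming_sequence dd.
have ys0 i : ys i 0 = 0.
  by have := ysD i (-1) 0 0; rewrite scaler0 addr0; lra.
have ysZ i a y : ys i (a *: y) = a * ys i y.
  by have := ysD i a y 0; rewrite ys0 !addr0.
have ysB i y z : ys i (y - z) = ys i y - ys i z.
  by rewrite addrC -scaleN1r ysD mulN1r addrC.
have e0 n : 0 < n.+1%:R^-1 :> R by rewrite invr_gt0.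
have [h hh] := choice (fun n =>
  functional_approximation dB u1 L0 D0 K0 fLD ysB ysZ ys1 n (e0 n)).
(* Row n knows only the first n functionals. The padding by 0 is invisible in the limit, as for
   fixed i it concerns finitely many n. *)
pose G n i := if (i < n)%N then h n i else 0.
have pad (V : lmodType R) N n (a : nat -> R) (F : nat -> V) : (N <= n)%N ->
    \sum_(i < n) (if (i < N)%N then a i else 0) *: F i = \sum_(i < N) a i *: F i.
  move=> Nn; rewrite (big_ord_widen n (fun i => a i *: F i))// [RHS]big_mkcond.
  by apply: eq_bigr => i _; case: ifP => //; rewrite scale0r.
have padG N n (a : nat -> R) : (N <= n)%N ->
    \sum_(i < n) (if (i < N)%N then a i else 0) *: h n i = \sum_(i < N) a i *: G n i.
  move=> Nn; rewrite pad//; apply: eq_bigr => i _.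
  by rewrite /G (leq_trans (ltn_ord i) Nn).
have pady N n (a : nat -> R) y : (N <= n)%N ->
    \sum_(i < n) (if (i < N)%N then a i else 0) * ys i y =
    \sum_(i < N) a i * ys i y.
  exact: (pad R^o N n a (ys ^~ y)).
have pada N n (a : nat -> R) : (N <= n)%N ->
    \sum_(i < n) `|if (i < N)%N then a i else 0| = \sum_(i < N) `|a i|.
  move=> Nn; rewrite (big_ord_widen n (fun i => `|a i|))// [RHS]big_mkcond.
  by apply: eq_bigr => i _; case: ifP => //; rewrite normr0.
have GU N n (a : nat -> R) C : (N <= n)%N -> 0 <= C ->
    (forall y, `|\sum_(i < N) a i * ys i y| <= C * `|y|) ->
    `|\sum_(i < N) a i *: G n i| <= 2 * L * C + n.+1%:R^-1 * \sum_(i < N) `|a i|.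
  move=> Nn C0 hC; rewrite -padG// -(pada N n)//.
  apply: (hh n (fun i => if (i < N)%N then a i else 0)).1 => // y.
  by rewrite pady.
have GL N n (a : nat -> R) y : (N <= n)%N -> `|\sum_(i < N) a i * ys i y| <=
    (2 * D * `|\sum_(i < N) a i *: G n i| + n.+1%:R^-1 * \sum_(i < N) `|a i|) * `|y|.
  move=> Nn; rewrite -padG// -(pada N n)// -(pady N n)//.
  exact: (hh n (fun i => if (i < N)%N then a i else 0)).2.
have GA n i : `|G n i| <= 2 * L + 1.
  rewrite /G; case: ifP => ni; last by rewrite normr0; lra.
  have one (V : lmodType R) (F : nat -> V) :
      \sum_(j < i.+1) (j == i :> nat)%:R *: F j = F i.
    rewrite big_ord_recr /= eqxx scale1r big1 ?add0r// => j _.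
    by rewrite ltn_eqF ?scale0r//; exact: ltn_ord.
  have := GU i.+1 n (fun j => (j == i)%:R) 1 ni ler01.
  rewrite one /G ni => hle; apply: le_trans (hle _) _.
    move=> y; have := one R^o (ys ^~ y); rewrite /GRing.scale/= => ->.
    by rewrite mul1r.
  rewrite mulr1 lerD2l (eq_bigr (fun j : 'I_i.+1 => (j == i :> nat)%:R)).
    have := one R^o (fun=> 1); rewrite /GRing.scale/=.
    under eq_bigr do rewrite mulr1.
    by move=> ->; rewrite mulr1 invf_le1// ler1n.
  by move=> j _; rewrite normr_nat.
have [U [g [FU ooU lg]]] := lim G _ GA.
have [L2 D2] : 0 < 2 * L /\ 0 < 2 * D by lra.
(* As [U] contains all cofinite sets, a single index can satisfy the two conditions on large n and
   the one on limits along [U]. Both estimates for row n then pass to [g] with an arbitrarily small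
   error. *)
have near_le N (a : nat -> R) e : 0 < e -> exists n, [/\ (N <= n)%N,
    n.+1%:R^-1 * \sum_(i < N) `|a i| <= e &
    `| `|\sum_(i < N) a i *: g i| - `|\sum_(i < N) a i *: G n i| | <= e].
  move=> e'0; set A := \sum_(i < N) `|a i|.
  have A0 : 0 <= A by apply: sumr_ge0.
  have A10 : 0 < A + 1 by lra.
  have /cvgrPdist_le /(_ _ e'0) c1 := lg N a.
  have c2 : \forall n \near U, (N <= n)%N by apply: ooU; exists N.
  have c3 : \forall n \near U, n.+1%:R^-1 * A <= e.
    apply: ooU; near=> n; apply: (@le_trans _ _ (n.+1%:R^-1 * (A + 1))).
      by rewrite ler_wpM2l ?(ltW (e0 n))//; lra.
    rewrite -ler_pdivlMr//; apply: ltW; near: n.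
    by apply: (near_infty_natSinv_lt (PosNum (divr_gt0 e'0 A10))).
  have [n [? [? ?]]] := filter_ex (filterI c2 (filterI c3 c1)).
  by exists n; split.
apply: (@dual_embedding_quotient _ _ _ _ B ys g (2 * L) (2 * D)) => //.
- move=> N a C C0 hC; apply/ler_addgt0Pr => e e'0.
  have [|n [Nn h1 h2]] := near_le N a (e / 2); first by rewrite divr_gt0.
  have h3 := GU _ _ _ _ Nn C0 hC; move: h2; rewrite ler_norml => /andP[_].
  rewrite lerBlDr => h2; apply: le_trans h2 _.
  rewrite (_ : 2 * L * C + e = e / 2 + (2 * L * C + e / 2)); last by field.
  by rewrite lerD2l; apply: le_trans h3 _; rewrite lerD2l.
- move=> N a y; apply/ler_addgt0Pr => e e'0.
  have y10 : 0 < `|y| + 1 by rewrite ltr_wpDl.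
  have D10 : 0 < 2 * D + 1 by lra.
  have c0 : 0 < e / (`|y| + 1) / (2 * D + 1) by rewrite !divr_gt0.
  have [n [Nn h1 h2]] := near_le N a _ c0.
  apply: le_trans (GL _ _ _ _ Nn) _.
  move: h2; rewrite ler_norml => /andP[h2 _].
  set e' := e / (`|y| + 1) / (2 * D + 1) in c0 h1 h2.
  have ee : e = e' * (2 * D + 1) * (`|y| + 1) by rewrite /e' !divfK ?gt_eqF.
  set p := `|\sum_(i < N) a i *: G n i| in h2 *.
  set q := `|\sum_(i < N) a i *: g i| in h2 *.
  set r := n.+1%:R^-1 * _ in h1 *.
  have pq : 2 * D * p <= 2 * D * (q + e') by rewrite ler_pM2l//; lra.
  apply: (@le_trans _ _ ((2 * D * q + e' * (2 * D + 1)) * `|y|)).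
    by rewrite ler_wpM2r//; lra.
  have e'D : 0 < e' * (2 * D + 1) by apply: mulr_gt0.
  by rewrite mulrDl lerD2l [leRHS]ee ler_pM2l// lerDl.
Unshelve. all: by end_near. Qed.

End coarse_quotient_linear.

(** * Duality of the Lebesgue spaces *)

Section powR_inequalities.
Context {R : realType}.
Implicit Types (p a b : R).

(** The tangent inequality for the convex function t^p is Young's inequality for b and a^(p - 1)
    with the conjugate exponent. *)
Lemma powR_tangent p a b : 1 < p -> 0 <= a -> 0 <= b ->
  a `^ p + p * a `^ (p - 1) * (b - a) <= b `^ p.
Proof.
move=> p1 a0 b0.
have p0 : 0 < p by lra.
pose q := p / (p - 1).
have q0 : 0 < q by rewrite divr_gt0//; lra.
have pq : p^-1 + q^-1 = 1 by rewrite /q; field; apply/andP; split; lra.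
have := conjugate_powR b0 (powR_ge0 a (p - 1)) p0 q0 pq.
rewrite -powRrM (_ : (p - 1) * q = p); last by rewrite /q; field; lra.
have -> : q^-1 = 1 - p^-1 by lra.
have aE : a * a `^ (p - 1) = a `^ p by rewrite mulr_powRB1.
have : p * p^-1 = 1 by rewrite mulfV// gt_eqF.
rewrite -aE; move: (a `^ (p - 1)) (b `^ p) p^-1 => A C i pi h.
have : p * (b * A) <= p * (C * i + a * A * (1 - i)) by rewrite ler_pM2l.
have -> : p * (C * i + a * A * (1 - i)) = (p * i) * C + p * (a * A) - (p * i) * (a * A).
  by ring.
rewrite pi; lra.
Qed.

Lemma powR_bernoulli p x : 1 < p -> -1 <= x -> 1 + p * x <= (1 + x) `^ p.
Proof.
move=> p1 x1; have := @powR_tangent p 1 (1 + x) p1 ler01.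
by rewrite !powR1 mulr1 [1 + x]addrC addrK [x + 1]addrC; apply; lra.
Qed.

Lemma powR_lipschitz p M a b : 1 < p -> `|a| <= M -> `|b| <= M ->
  `| `|a| `^ p - `|b| `^ p| <= p * M `^ (p - 1) * `|a - b|.
Proof.
move=> p1.
wlog ab : a b / `|b| <= `|a|.
  move=> wl aM bM; have [ba|/ltW ba] := leP `|b| `|a|; first exact: wl.
  by rewrite distrC [`|a - b|]distrC; exact: wl.
move=> aM bM; have p10 : 0 <= p - 1 by lra.
rewrite ger0_norm ?subr_ge0; last first.
  by apply: ge0_ler_powR; rewrite ?nnegrE//; lra.
have := powR_tangent p1 (normr_ge0 a) (normr_ge0 b).
have : `|a| `^ (p - 1) <= M `^ (p - 1).
  by apply: ge0_ler_powR; rewrite ?nnegrE// (le_trans _ aM).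
have := lerB_dist a b; have := powR_ge0 `|a| (p - 1).
have : 0 <= `|a| - `|b| by rewrite subr_ge0.
move: `|a - b| `|a| `|b| (`|a| `^ (p - 1)) (M `^ (p - 1)) (`|a| `^ p) (`|b| `^ p).
move=> w x y A C X Z xy A0 xyw AC h.
have : A * (x - y) <= C * w by apply: ler_pM.
move=> h1; have : p * (A * (x - y)) <= p * (C * w) by rewrite ler_pM2l//; lra.
lra.
Qed.

Let powR_near1 p e : 1 < p -> 0 < e -> exists2 r : R, 0 < r < 1 &
  forall t, `|t| <= r -> `|(1 + t) `^ (p - 1) - 1| <= e.
Proof.
move=> p1 e0.
have /cvgrPdist_lt /(_ _ e0) : (fun t : R => t `^ (p - 1)) @ (1 : R) --> (1 : R) `^ (p - 1).
  have : {for (1 : R), continuous (fun t : R => t `^ (p - 1))}.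
    apply/differentiable_continuous/derivable1_diffP.
    by case: (is_derive1_powR (p - 1) (ltr01 : 0 < 1 :> R)).
  by [].
rewrite powR1 => /nbhs_ballP [r /= r0 hr].
exists (Num.min (r / 2) 2^-1).
  rewrite lt_min divr_gt0//= invr_gt0 ltr0n /= gt_min orbC.
  by rewrite invf_lt1// ltr1n.
move=> t; rewrite le_min => /andP[tr _].
rewrite distrC ltW//; apply: hr; rewrite -ball_normE /=.
rewrite opprD addrA subrr sub0r normrN; lra.
Qed.

(* (a + b)^p is compared with its tangent at a when |b| is small relative to
   a, and with a multiple of |b|^p otherwise. *)
Lemma powR_smooth p e : 1 < p -> 0 < e -> exists2 C : R, 0 <= C & forall a b,
  `|a + b| `^ p <= `|a| `^ p + p * (`|a| `^ (p - 1) * Num.sg a) * b +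
    e * (`|a| `^ (p - 1) * `|b|) + C * `|b| `^ p.
Proof.
move=> p1 e0.
have ep : 0 < e / p by rewrite divr_gt0//; lra.
have [r /andP[r0 r1] hr] := powR_near1 p1 ep.
have [p0 p10] : 0 <= p /\ 0 <= p - 1 by lra.
pose C := (1 + r^-1) `^ p + p * r^-1 `^ (p - 1).
exists C; first by rewrite addr_ge0 ?powR_ge0// mulr_ge0// powR_ge0.
have main a b : 0 < a -> `|a + b| `^ p <= a `^ p + p * a `^ (p - 1) * b +
    e * (a `^ (p - 1) * `|b|) + C * `|b| `^ p.
  move=> a0; have [ba|ba] := leP `|b| (r * a).
    have ab0 : 0 <= a + b by move: ba; rewrite ler_norml => /andP[]; nra.
    rewrite ger0_norm//.
    have := powR_tangent p1 ab0 (ltW a0).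
    have -> : a - (a + b) = - b by rewrite opprD addNKr.
    have /hr : `|b / a| <= r by rewrite normrM normfV (gtr0_norm a0) ler_pdivrMr.
    have -> : (a + b) `^ (p - 1) = a `^ (p - 1) * (1 + b / a) `^ (p - 1).
      rewrite -powRM ?(ltW a0)//; last first.
        by rewrite -(pmulr_rge0 _ a0) mulrDr mulrCA mulfV ?gt_eqF// !mulr1.
      by rewrite mulrDr mulrCA mulfV ?gt_eqF// !mulr1.
    have := powR_ge0 a (p - 1).
    have : 0 <= C * `|b| `^ p.
      by rewrite mulr_ge0 ?powR_ge0// addr_ge0 ?powR_ge0// mulr_ge0 ?powR_ge0.
    move: (a `^ (p - 1)) ((1 + b / a) `^ (p - 1)) (_ `^ p) (_ `^ p) (C * _).
    move=> A t X Z W W0 A0 ht h.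
    have : (t - 1) * b <= e / p * `|b|.
      apply: le_trans (ler_norm _) _; rewrite normrM ler_wpM2r//.
    move=> h1; have : p * A * ((t - 1) * b) <= p * A * (e / p * `|b|).
      by rewrite ler_wpM2l// mulr_ge0.
    have -> : p * A * (e / p * `|b|) = e * (A * `|b|) by field; lra.
    lra.
  have b0 : 0 < `|b| by apply: le_lt_trans ba; rewrite mulr_ge0// ltW.
  have ab : a <= r^-1 * `|b| by rewrite ler_pdivlMl// ltW.
  have r'0 : 0 <= r^-1 by rewrite invr_ge0 ltW.
  have h1 : `|a + b| `^ p <= (1 + r^-1) `^ p * `|b| `^ p.
    rewrite -powRM ?addr_ge0//; apply: ge0_ler_powR; rewrite ?nnegrE//.
      by rewrite mulr_ge0 ?addr_ge0.
    by apply: le_trans (ler_normD _ _) _; rewrite gtr0_norm//; lra.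
  have h2 : a `^ (p - 1) <= r^-1 `^ (p - 1) * `|b| `^ (p - 1).
    rewrite -powRM//; apply: ge0_ler_powR; rewrite ?nnegrE ?(ltW a0)//.
    by rewrite mulr_ge0.
  have h3 : a `^ (p - 1) * `|b| <= r^-1 `^ (p - 1) * `|b| `^ p.
    rewrite -(mulr_powRB1 (normr_ge0 b)); last by lra.
    by rewrite [`|b| * _]mulrC mulrA ler_wpM2r.
  have h4 : - (a `^ (p - 1) * `|b|) <= a `^ (p - 1) * b.
    by rewrite -mulrN ler_wpM2l ?powR_ge0// lerNl -normrN ler_norm.
  have h5 : 0 <= e * (a `^ (p - 1) * `|b|).
    by rewrite mulr_ge0 ?(ltW e0)// mulr_ge0 ?powR_ge0.
  have h6 : 0 <= a `^ p by rewrite powR_ge0.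
  have h7 : p * (- (a `^ (p - 1) * `|b|)) <= p * (a `^ (p - 1) * b) by rewrite ler_wpM2l.
  have h8 : p * (a `^ (p - 1) * `|b|) <= p * (r^-1 `^ (p - 1) * `|b| `^ p) by rewrite ler_wpM2l.
  rewrite /C; lra.
move=> a b; have [a0|a0|->] := ltgtP a 0.
- have := main (- a) (- b); rewrite oppr_gt0 -opprD !normrN => /(_ a0).
  by rewrite (ltr0_norm a0) (ltr0_sg a0) !mulrN mulr1 mulNr.
- by have := main a b a0; rewrite (gtr0_norm a0) (gtr0_sg a0) mulr1.
rewrite sgr0 normr0 add0r !powR0 ?gt_eqF//; try lra.
rewrite !(mulr0, mul0r, add0r, addr0) ler_peMl ?powR_ge0// /C.
apply: (@le_trans _ _ ((1 + r^-1) `^ p)); last by rewrite lerDl mulr_ge0// powR_ge0.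
apply: (@le_trans _ _ (1 `^ p)); first by rewrite powR1.
apply: ge0_ler_powR; rewrite ?nnegrE// ?addr_ge0 ?invr_ge0 ?(ltW r0)//.
by rewrite lerDl invr_ge0 ltW.
Qed.

End powR_inequalities.

Section Lspace_functions.
Context d (T : measurableType d) (R : realType).
Variables (mu : {measure set T -> \bar R}) (r : R) (r1 : (1 <= r%:E)%E).
Local Notation Lp := (LspaceType mu r1).
Implicit Types (x y : Lp) (f g : T -> R).

Lemma Lspace_measurable x : measurable_fun [set: T] (x : T -> R).
Proof. exact: (measurable_funPT (Lrepr x)). Qed.

Definition powR_integrable f :=
  measurable_fun [set: T] f /\ mu.-integrable [set: T] (fun t => (`|f t| `^ r)%:E).

Lemma Lspace_integrable x : powR_integrable x.
Proof.
split; first exact: Lspace_measurable.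
by apply: Lfun_integrable; [rewrite -lee_fin|exact: (LfunP (Lrepr x))].
Qed.

Lemma Lspace_exists f : powR_integrable f ->
  exists x : Lp, (x : T -> R) = f %[ae mu].
Proof.
move=> [mf intf].
have fL : f \in Lfun mu r%:E.
  rewrite inE; apply/andP; split; rewrite inE//= /finite_norm unlock poweR_lty//=.
  exact: integrable_lty intf.
exists (Lclass (Lfun_Sub r1 fL)); exact: LclassK.
Qed.

Let Lclass_ae (z : Lp) (f : LfunType mu r1) :
  z = Lclass f -> (z : T -> R) = (f : T -> R) %[ae mu].
Proof. by move=> E; subst z; exact: LclassK. Qed.

Lemma LspaceDE x y : ((x + y : Lp) : T -> R) = (x : T -> R) \+ y %[ae mu].
Proof.
apply: (@Lclass_ae _ (Lrepr x + Lrepr y)); by rewrite LclassD !LreprK.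
Qed.

Lemma LspaceZE (a : R) x : ((a *: x : Lp) : T -> R) = (fun t => a * x t) %[ae mu].
Proof.
apply: (@Lclass_ae _ (a *: Lrepr x)); by rewrite LclassZ LreprK.
Qed.

Lemma Lspace0E : ((0 : Lp) : T -> R) = (fun=> 0) %[ae mu].
Proof.
have : ((0 : Lp) : T -> R) = ((0 *: Lrepr 0 : LfunType mu r1) : T -> R) %[ae mu].
  by apply: Lclass_ae; rewrite LclassZ LreprK scaler0.
by apply: filterS => t h /h ->; exact: mul0r.
Qed.

Lemma Lspace_norm_powR x : `|x| `^ r = \int[mu]_t (`|x t| `^ r).
Proof.
have r0 : r != 0 by rewrite gt_eqF// (lt_le_trans ltr01)// -lee_fin.
rewrite -[LHS]/(Lspace_norm x `^ r) /Lspace_norm.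
by rewrite -fine_poweR poweR_Lnorm.
Qed.

Lemma Lspace_norm_le x (C : R) : 0 <= C ->
  \int[mu]_t (`|x t| `^ r) <= C `^ r -> `|x| <= C.
Proof.
move=> C0; rewrite -Lspace_norm_powR.
have r0 : 0 < r by rewrite (lt_le_trans ltr01)// -lee_fin.
apply: contraTT; rewrite -!ltNge => Cx.
by apply: gt0_ltr_powR; rewrite ?nnegrE.
Qed.

End Lspace_functions.

Section Rintegral_extra.
Context d (T : measurableType d) (R : realType).
Variables (mu : {measure set T -> \bar R}).
Implicit Types f g : T -> R.

Lemma ae_eq_Rintegral f g : measurable_fun [set: T] f ->
  measurable_fun [set: T] g -> f = g %[ae mu] ->
  \int[mu]_t f t = \int[mu]_t g t.
Proof.
move=> mf mg fg; rewrite /Rintegral; congr fine.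
apply: ae_eq_integral => //; [exact: measurableT_comp|exact: measurableT_comp|].
by apply: filterS fg => t h /h ->.
Qed.

Definition Rintegrable f := mu.-integrable [set: T] (EFin \o f).

Lemma RintegrableD f g : Rintegrable f -> Rintegrable g -> Rintegrable (f \+ g).
Proof. by move=> hf hg; exact: (integrableD measurableT hf hg). Qed.

Lemma RintegrableZ a f : Rintegrable f -> Rintegrable (fun t => a * f t).
Proof. by move=> hf; exact: (integrableZl measurableT a hf). Qed.

Lemma ae_eq_Rintegrable f g : Rintegrable f -> measurable_fun [set: T] g ->
  f = g %[ae mu] -> Rintegrable g.
Proof.
move=> hf mg fg; have /integrableP[mf ff] := hf.
apply/integrableP; split; first exact/measurable_EFinP.
rewrite (ae_eq_integral (fun t => `|(f t)%:E|%E))//.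
- by apply: measurableT_comp => //; exact/measurable_EFinP.
- exact: measurableT_comp.
- by apply: filterS fg => t h /h /= ->.
Qed.

Lemma Rintegrable_le f g : measurable_fun [set: T] f -> Rintegrable g ->
  (forall t, `|f t| <= g t) -> Rintegrable f.
Proof.
move=> mf hg fg; apply: (le_integrable measurableT _ _ hg).
  exact/measurable_EFinP.
by move=> t _ /=; rewrite lee_fin (le_trans (fg t))// ler_norm.
Qed.

Lemma Rintegrable_norm f : Rintegrable f -> Rintegrable (fun t => `|f t|).
Proof. by move=> hf; have := integrable_norm hf. Qed.

Lemma Rintegrable_sum (I : Type) (s : seq I) (F : I -> T -> R) :
  (forall i, Rintegrable (F i)) -> Rintegrable (fun t => \sum_(i <- s) F i t).
Proof.
move=> h; elim: s => [|i s IH].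
  rewrite (_ : (fun t => _) = cst 0); first exact: integrable0.
  by apply/funext => t; rewrite big_nil.
rewrite (_ : (fun t => _) = F i \+ (fun t => \sum_(j <- s) F j t)).
  exact: RintegrableD.
by apply/funext => t; rewrite big_cons.
Qed.

Lemma Rintegral_sum (I : Type) (s : seq I) (F : I -> T -> R) :
  (forall i, Rintegrable (F i)) ->
  \int[mu]_t (\sum_(i <- s) F i t) = \sum_(i <- s) \int[mu]_t F i t.
Proof.
move=> h; elim: s => [|i s IH].
  rewrite big_nil; under eq_Rintegral do rewrite big_nil.
  by rewrite /Rintegral integral0.
rewrite big_cons -IH -RintegralD//.
- by apply: eq_Rintegral => t _; rewrite big_cons.
- exact: h.
- exact: Rintegrable_sum.
Qed.

End Rintegral_extra.

Section monotone_bound.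
Context d (T : measurableType d) (R : realType).
Variables (mu : {measure set T -> \bar R}).

(** Monotone convergence with a real-valued bound. The limit may be infinite on a null set, where
    [fine] turns it into 0; hence domination only almost everywhere. *)
Lemma monotone_bound (F : nat -> T -> R) (K : R) :
    (forall n, Rintegrable mu (F n)) -> (forall n t, 0 <= F n t) ->
    (forall t, {homo F ^~ t : n m / (n <= m)%N >-> n <= m}) ->
    (forall n, \int[mu]_t F n t <= K) ->
  exists H : T -> R, [/\ Rintegrable mu H, forall t, 0 <= H t,
    \int[mu]_t H t <= K & \forall t \ae mu, forall n, F n t <= H t].
Proof.
move=> intF F0 ndF FK.
have mF n : measurable_fun [set: T] (EFin \o F n) by case/integrableP: (intF n).
pose L t := limn (fun n => (F n t)%:E).
have ndE t : nondecreasing_seq (fun n => (F n t)%:E).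
  by move=> n m nm; rewrite lee_fin; exact: ndF.
have cvL t : (fun n => (F n t)%:E) @ \oo --> L t.
  exact: ereal_nondecreasing_is_cvgn.
have FL n t : ((F n t)%:E <= L t)%E.
  apply: lime_ge; first exact: ereal_nondecreasing_is_cvgn.
  by exists n => // m /= nm; exact: ndE.
have mL : measurable_fun [set: T] L.
  by apply: (emeasurable_fun_cvg (fun n t => (F n t)%:E)) => // t _; exact: cvL.
have L0 t : (0 <= L t)%E by apply: le_trans (FL 0%N t); rewrite lee_fin.
have LK : (\int[mu]_t L t <= K%:E)%E.
  have := @cvg_monotone_convergence _ _ _ mu setT measurableT
    (fun n t => (F n t)%:E) mF (fun n t _ => F0 n t) (fun t _ => ndE t).
  move=> c; rewrite -(cvg_lim _ c)//; apply: lime_le; first by apply/cvg_ex; eexists; exact: c.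
  apply: nearW => n; rewrite -[leLHS]fineK; last by apply: integrable_fin_num => //; exact: intF.
  by rewrite lee_fin; exact: FK.
have iL : mu.-integrable [set: T] L.
  apply/integrableP; split => //; under eq_integral do rewrite gee0_abs//.
  by apply: le_lt_trans LK _; rewrite ltry.
have aeL := integrable_ae measurableT iL.
have mH : measurable_fun [set: T] (fun t => fine (L t)).
  exact: (measurableT_comp (fine_measurable measurableT)).
have HL : {ae mu, forall t, [set: T] t -> L t = (fine (L t))%:E}.
  by apply: filterS aeL => t /(_ I) h _; rewrite fineK.
have EH : (\int[mu]_t (fine (L t))%:E = \int[mu]_t L t)%E.
  apply: ae_eq_integral => //; first exact/measurable_EFinP.
  by apply: filterS HL => t h /h ->.
exists (fun t => fine (L t)); split.
- apply/integrableP; split; first exact/measurable_EFinP.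
  under eq_integral do rewrite /= ger0_norm ?fine_ge0//.
  by rewrite EH; apply: le_lt_trans LK _; rewrite ltry.
- by move=> t; rewrite fine_ge0.
- rewrite -lee_fin /Rintegral fineK EH//.
  by rewrite ge0_fin_numE ?integral_ge0//; apply: le_lt_trans LK _; rewrite ltry.
- apply: filterS aeL => t /(_ I) h n.
  by rewrite -lee_fin fineK.
Qed.

End monotone_bound.

Section Lspace_pairing.
Context d (T : measurableType d) (R : realType).
Variables (mu : {measure set T -> \bar R}) (r q : R).
Variables (r1 : (1 <= r%:E)%E) (q1 : (1 <= q%:E)%E).
Hypotheses (r_gt1 : 1 < r) (q_gt1 : 1 < q) (rq : r^-1 + q^-1 = 1).
Local Notation X := (LspaceType mu r1).
Local Notation X' := (LspaceType mu q1).

Definition Lpairing (x : X) (g : X') : R := \int[mu]_t (x t * g t).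

Let r_gt0 : 0 < r. Proof. exact: lt_trans r_gt1. Qed.
Let q_gt0 : 0 < q. Proof. exact: lt_trans q_gt1. Qed.

Lemma powR_integrableM (f g : T -> R) : powR_integrable mu r f ->
  powR_integrable mu q g -> Rintegrable mu (fun t => f t * g t).
Proof.
move=> [mf hf] [mg hg].
apply: (@Rintegrable_le _ _ _ _ _ (fun t => r^-1 * `|f t| `^ r + q^-1 * `|g t| `^ q)).
- exact: measurable_funM.
- by apply: RintegrableD; apply: RintegrableZ.
- move=> t; rewrite normrM mulrC [_^-1 * _]mulrC [q^-1 * _]mulrC mulrC.
  exact: conjugate_powR.
Qed.

Lemma LpairingE_integrable (x : X) (g : X') : Rintegrable mu (fun t => x t * g t).
Proof. by apply: powR_integrableM; exact: Lspace_integrable. Qed.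

Lemma Lpairing_norm_le (x : X) (g : X') :
  \int[mu]_t `|x t * g t| <= `|x| * `|g|.
Proof.
have := hoelder mu (Lspace_measurable x) (Lspace_measurable g) r_gt0 q_gt0 rq.
rewrite Lnorm1.
have fx : ('N[mu]_r%:E[EFin \o (x : T -> R)] \is a fin_num)%E.
  by rewrite ge0_fin_numE ?Lnorm_ge0//; exact: Lebesgue_finite.
have fg : ('N[mu]_q%:E[EFin \o (g : T -> R)] \is a fin_num)%E.
  by rewrite ge0_fin_numE ?Lnorm_ge0//; exact: Lebesgue_finite.
rewrite -(fineK fx) -(fineK fg) -EFinM => h.
rewrite -lee_fin /Rintegral fineK//.
apply: integrable_fin_num => //.
exact: (Rintegrable_norm (LpairingE_integrable x g)).
Qed.

Let mpair (x : X) (g : X') : measurable_fun [set: T] (fun t => x t * g t).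
Proof. by apply: measurable_funM; exact: Lspace_measurable. Qed.

Lemma Lpairing_Dl u v g : Lpairing (u + v) g = Lpairing u g + Lpairing v g.
Proof.
rewrite /Lpairing -RintegralD//; try exact: LpairingE_integrable.
apply: ae_eq_Rintegral.
- exact: mpair.
- by apply: measurable_funD; exact: mpair.
by apply: filterS (LspaceDE u v) => t h /h /= ->; rewrite mulrDl.
Qed.

Lemma Lpairing_Zl a u g : Lpairing (a *: u) g = a * Lpairing u g.
Proof.
rewrite /Lpairing -RintegralZl//; last exact: LpairingE_integrable.
apply: ae_eq_Rintegral.
- exact: mpair.
- by apply: measurable_funM => //; exact: mpair.
by apply: filterS (LspaceZE a u) => t h /h /= ->; rewrite mulrA.
Qed.

Lemma Lpairing_le u g : `|Lpairing u g| <= `|u| * `|g|.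
Proof.
apply: le_trans (Lpairing_norm_le u g).
by apply: le_normr_Rintegral => //; exact: LpairingE_integrable.
Qed.

Lemma powR_integrable_ae (f g : T -> R) : powR_integrable mu r f ->
  measurable_fun [set: T] g -> f = g %[ae mu] ->
  \int[mu]_t (`|f t| `^ r) = \int[mu]_t (`|g t| `^ r).
Proof.
move=> [mf _] mg fg; apply: ae_eq_Rintegral.
- by apply: (measurableT_comp (measurable_powR r)); exact: measurableT_comp.
- by apply: (measurableT_comp (measurable_powR r)); exact: measurableT_comp.
by apply: filterS fg => t h /h ->.
Qed.

End Lspace_pairing.

(** * Uniform smoothness of the norm of L_r *)

Section Lspace_smoothness.
Context d (T : measurableType d) (R : realType).
Variable mu : {measure set T -> \bar R}.

Lemma measurable_sg (f : T -> R) : measurable_fun [set: T] f ->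
  measurable_fun [set: T] (fun t => Num.sg (f t)).
Proof.
move=> mf; rewrite (_ : (fun t => _) =
    (fun t => if 0 < f t then 1 else if f t < 0 then -1 else 0)).
  apply: measurable_fun_ifT => //; first exact: measurable_fun_ltr.
  by apply: measurable_fun_ifT => //; exact: measurable_fun_ltr.
apply/funext => t; case: ltgtP => h; rewrite ?(gtr0_sg h) ?(ltr0_sg h)//.
by rewrite -h sgr0.
Qed.

Lemma measurable_powR_norm (f : T -> R) (r : R) : measurable_fun [set: T] f ->
  measurable_fun [set: T] (fun t => `|f t| `^ r).
Proof.
by move=> mf; apply: (measurableT_comp (measurable_powR r)); exact: measurableT_comp.
Qed.

Lemma powR_small (s C e : R) : 0 < s -> 0 <= C -> 0 < e ->
  exists2 x, 0 < x <= 1 & C * x `^ s <= e.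
Proof.
move=> s0 C0 e0; pose y := (e / (C + 1)) `^ s^-1.
have C10 : 0 < C + 1 by lra.
have y0 : 0 < y by rewrite powR_gt0// divr_gt0.
exists (Num.min y 1); first by rewrite lt_min y0 ltr01 /= ge_min lexx orbT.
apply: (@le_trans _ _ (C * (e / (C + 1)))).
  apply: ler_wpM2l => //.
  have -> : e / (C + 1) = y `^ s.
    by rewrite /y -powRrM mulVf ?gt_eqF// powRr1// divr_ge0// ltW.
  apply: ge0_ler_powR; rewrite ?nnegrE ?(ltW s0)// ?(ltW y0)//.
    by rewrite le_min ler01 ltW.
  by rewrite ge_min lexx.
rewrite mulrA ler_pdivrMr// mulrC; have : e * C <= e * (C + 1) by rewrite ler_pM2l//; lra.
by [].
Qed.

(** The duality map at w is |w|^(r - 1) sg w. Integrating [powR_smooth] bounds |w + u|^r by 1 + r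
    <u, g> plus two errors, each at most (r e / 2) |u| once |u| <= s; [powR_bernoulli] then extracts
    the r-th root. The radius s depends on e and r alone, which gives the uniformity in w. *)
Lemma Lpairing_smooth (r q : R) (r1 : (1 <= r%:E)%E) (q1 : (1 <= q%:E)%E) :
  1 < r -> 1 < q -> r^-1 + q^-1 = 1 -> forall e : R, 0 < e ->
  exists2 s : R, 0 < s & forall w : LspaceType mu r1, `|w| = 1 ->
  exists2 g : LspaceType mu q1, `|g| <= 1 & forall u : LspaceType mu r1,
    `|u| <= s -> `|w + u| <= 1 + Lpairing u g + e * `|u|.
Proof.
move=> r_gt1 q_gt1 rq e e0.
have r0 : 0 < r by lra.
have q0 : 0 < q by lra.
have rqE : (r - 1) * q = r.
  have : r * q * (r^-1 + q^-1) = r * q by rewrite rq mulr1.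
  rewrite mulrDr mulrAC mulfV ?gt_eqF// mul1r -mulrA mulfV ?gt_eqF// mulr1; lra.
have re0 : 0 < r * e / 2 by rewrite divr_gt0// mulr_gt0.
have [C C0 hC] := powR_smooth r_gt1 re0.
have [s /andP[s0 s1] hs] : exists2 x, 0 < x <= 1 & C * x `^ (r - 1) <= r * e / 2.
  by apply: powR_small => //; lra.
exists s => // w w1.
have [mw iw] := Lspace_integrable w.
pose psi t := `|w t| `^ (r - 1) * Num.sg (w t).
have psiE t : `|psi t| `^ q = `|w t| `^ r.
  rewrite /psi; have [->|w0] := eqVneq (w t) 0.
    by rewrite sgr0 mulr0 normr0 !powR0// gt_eqF.
  rewrite normrM normr_sg w0 mulr1 ger0_norm ?powR_ge0//.
  by rewrite -powRrM rqE.
have npsi t : `|psi t| = `|w t| `^ (r - 1).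
  rewrite /psi; have [->|w0] := eqVneq (w t) 0.
    by rewrite sgr0 mulr0 normr0 powR0// gt_eqF// subr_gt0.
  by rewrite normrM normr_sg w0 mulr1 ger0_norm ?powR_ge0.
have mpsi : measurable_fun [set: T] psi.
  by apply: measurable_funM; [exact: measurable_powR_norm|exact: measurable_sg].
have ipsi : powR_integrable mu q psi.
  split=> //; move: iw; congr (is_true (mu.-integrable _ _)).
  by apply/funext => t; rewrite psiE.
have [g gE] := Lspace_exists q1 ipsi.
have g1 : `|g| <= 1.
  apply: Lspace_norm_le => //; rewrite powR1.
  rewrite -(powR_integrable_ae ipsi (Lspace_measurable g)); last first.
    by apply: filterS gE => t h /h ->.
  under eq_Rintegral do rewrite psiE.
  by rewrite -Lspace_norm_powR w1 powR1.
exists g => // u us.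
have wr : \int[mu]_t (`|w t| `^ r) = 1 by rewrite -Lspace_norm_powR w1 powR1.
have [mu_ iu] := Lspace_integrable u.
have mg := Lspace_measurable g.
have ugE : \int[mu]_t (u t * psi t) = Lpairing u g.
  apply: ae_eq_Rintegral; [exact: measurable_funM|exact: measurable_funM|].
  by apply: filterS gE => t h /h ->.
have uagE : \int[mu]_t `|u t * psi t| <= `|u|.
  have E : \int[mu]_t `|u t * psi t| = \int[mu]_t `|u t * g t|.
    apply: ae_eq_Rintegral;
      [exact/measurableT_comp/measurable_funM|exact/measurableT_comp/measurable_funM|].
    by apply: filterS gE => t h /h ->.
  rewrite E; apply: le_trans (Lpairing_norm_le r_gt1 q_gt1 rq u g) _.
  by rewrite ler_piMr.
have iug : Rintegrable mu (fun t => u t * psi t).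
  exact: (powR_integrableM r_gt1 q_gt1 rq).
have iaug := Rintegrable_norm iug.
have mwu : measurable_fun [set: T] (fun t => w t + u t) by exact: measurable_funD.
pose F t := `|w t| `^ r + r * (u t * psi t) + (r * e / 2) * `|u t * psi t| + C * `|u t| `^ r.
have i1 : Rintegrable mu (fun t => `|w t| `^ r + r * (u t * psi t)).
  by apply: (@RintegrableD _ _ _ _ (fun t => `|w t| `^ r)) => //; exact: RintegrableZ.
have i2 : Rintegrable mu (fun t => `|w t| `^ r + r * (u t * psi t) + (r * e / 2) * `|u t * psi t|).
  by apply: (RintegrableD i1); exact: RintegrableZ.
have iF : Rintegrable mu F by apply: (RintegrableD i2); exact: RintegrableZ.
have EF : \int[mu]_t F t = 1 + r * Lpairing u g +
    (r * e / 2) * \int[mu]_t `|u t * psi t| + C * `|u| `^ r.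
  rewrite /F RintegralD//; last exact: RintegrableZ.
  rewrite RintegralD//; last exact: RintegrableZ.
  rewrite RintegralD//; last exact: RintegrableZ.
  by rewrite !RintegralZl// wr ugE -Lspace_norm_powR.
have wuE : `|w + u| `^ r = \int[mu]_t (`|w t + u t| `^ r).
  rewrite Lspace_norm_powR; apply: (powR_integrable_ae (Lspace_integrable _)) => //.
  exact: LspaceDE.
have wuF : `|w + u| `^ r <= \int[mu]_t F t.
  have pt t : `|w t + u t| `^ r <= F t.
    apply: le_trans (hC _ _) _; rewrite /F normrM npsi.
    rewrite [`|u t| * _]mulrC [u t * _]mulrC [r * (psi t * _)]mulrA.
    by rewrite lexx.
  rewrite wuE; apply: le_Rintegral => //.
  apply: (Rintegrable_le _ iF) => [|t]; first exact: measurable_powR_norm.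
  by rewrite ger0_norm ?powR_ge0.
have bern : 1 + r * (Lpairing u g + e * `|u|) <= (1 + (Lpairing u g + e * `|u|)) `^ r.
  apply: powR_bernoulli => //.
  have := Lpairing_le r_gt1 q_gt1 rq u g; rewrite ler_norml => /andP[h _].
  have h2 : `|u| * `|g| <= 1 by apply: mulr_ile1 => //; apply: le_trans s1.
  have : 0 <= e * `|u| by rewrite mulr_ge0// ltW.
  lra.
have nonneg : 0 <= 1 + (Lpairing u g + e * `|u|).
  have := Lpairing_le r_gt1 q_gt1 rq u g; rewrite ler_norml => /andP[h _].
  have h2 : `|u| * `|g| <= 1 by apply: mulr_ile1 => //; apply: le_trans s1.
  have : 0 <= e * `|u| by rewrite mulr_ge0// ltW.
  lra.
rewrite -addrA; apply: Lspace_norm_le => //; rewrite -Lspace_norm_powR.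
apply: le_trans bern; apply: le_trans wuF _; rewrite EF.
have k1 : (r * e / 2) * \int[mu]_t `|u t * psi t| <= (r * e / 2) * `|u|.
  by rewrite ler_pM2l.
have k2 : C * `|u| `^ r <= (r * e / 2) * `|u|.
  rewrite -(mulr_powRB1 (normr_ge0 u) r0) mulrCA mulrC ler_wpM2r//.
  apply: le_trans hs; apply: ler_wpM2l => //.
  by apply: ge0_ler_powR; rewrite ?nnegrE//; lra.
lra.
Qed.

End Lspace_smoothness.

(** * Summation of geometrically bounded series in L_r *)

Section Lspace_completeness.
Context d (T : measurableType d) (R : realType).
Variable mu : {measure set T -> \bar R}.

Lemma LspaceE_sum (r : R) (r1 : (1 <= r%:E)%E) (x : nat -> LspaceType mu r1) n :
  ((\sum_(k < n) x k : LspaceType mu r1) : T -> R) =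
  (fun t => \sum_(k < n) x k t) %[ae mu].
Proof.
elim: n => [|n IH].
  rewrite big_ord0; apply: filterS (@Lspace0E _ _ _ mu _ r1) => t h /h ->.
  by rewrite big_ord0.
rewrite big_ord_recr /=.
apply: filterS2 IH (LspaceDE (\sum_(k < n) x k) (x n)) => t h h' It.
by rewrite (h' It) /= (h It) big_ord_recr.
Qed.

Lemma Lspace_abs (r : R) (r1 : (1 <= r%:E)%E) (x : LspaceType mu r1) :
  exists2 a : LspaceType mu r1, (a : T -> R) = (fun t => `|x t|) %[ae mu] &
    `|a| = `|x|.
Proof.
have r0 : 0 < r by apply: lt_le_trans ltr01 _; rewrite -lee_fin.
have [mx ix] := Lspace_integrable x.
have ia : powR_integrable mu r (fun t => `|x t|).
  split; first exact: measurableT_comp.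
  by move: ix; congr (is_true (mu.-integrable _ _)); apply/funext => t; rewrite normr_id.
have [a aE] := Lspace_exists r1 ia; exists a => //.
have : `|a| `^ r = `|x| `^ r.
  rewrite !Lspace_norm_powR -(powR_integrable_ae ia (Lspace_measurable a)).
    by apply: eq_Rintegral => t _; rewrite normr_id.
  by apply: filterS aE => t h /h ->.
by move=> /powR_injective; apply; rewrite ?nnegrE ?gt_eqF.
Qed.

(** The Riesz-Fischer argument: the partial sums of the |m k| have norm at most 2C, so by monotone
    convergence they have a common majorant in L_r, and dominated convergence applies to the
    products with g. *)
Lemma Lpairing_sum (r q : R) (r1 : (1 <= r%:E)%E) (q1 : (1 <= q%:E)%E) :
  1 < r -> 1 < q -> r^-1 + q^-1 = 1 ->
  forall (C : R) (m : nat -> LspaceType mu r1),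
    (forall k, `|m k| <= C * 2^-1 ^+ k) ->
  exists2 s : LspaceType mu r1, `|s| <= 2 * C &
    forall g : LspaceType mu q1,
      (fun n => Lpairing (\sum_(k < n) m k) g) @ \oo --> Lpairing s g.
Proof.
move=> r_gt1 q_gt1 rq C m mC.
have r0 : 0 < r by lra.
have C0 : 0 <= C by have := mC 0%N; rewrite expr0 mulr1; exact: le_trans.
have geo n : \sum_(k < n) C * 2^-1 ^+ k <= 2 * C.
  have -> : \sum_(k < n) C * 2^-1 ^+ k = C * (2 - 2 * 2^-1 ^+ n).
    elim: n => [|n IH]; first by rewrite big_ord0 expr0; lra.
    by rewrite big_ord_recr /= IH exprS; field.
  have : 0 <= C * 2^-1 ^+ n by rewrite mulr_ge0// exprn_ge0.
  lra.
have /choice[a ha] : forall k, exists a : LspaceType mu r1,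
    ((a : T -> R) = (fun t => `|m k t|) %[ae mu]) /\ `|a| = `|m k|.
  by move=> k; have [a ? ?] := Lspace_abs (m k); exists a.
pose F n t := (\sum_(k < n) `|m k t|) `^ r.
have mm k := Lspace_measurable (m k).
have aE n : ((\sum_(k < n) a k : LspaceType mu r1) : T -> R) =
    (fun t => \sum_(k < n) `|m k t|) %[ae mu].
  elim: n => [|n IH].
    by apply: filterS (LspaceE_sum a 0) => t h /h ->; rewrite !big_ord0.
  rewrite big_ord_recr /=.
  apply: filterS3 IH (LspaceDE (\sum_(k < n) a k) (a n)) (ha n).1.
  by move=> t h h' h'' It; rewrite (h' It) /= (h It) (h'' It) big_ord_recr.
have sum0 n t : 0 <= \sum_(k < n) `|m k t| by apply: sumr_ge0.
have mS n : measurable_fun [set: T] (fun t => \sum_(k < n) `|m k t|).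
  by apply: measurable_sum => k; exact: measurableT_comp.
have mF n : measurable_fun [set: T] (F n).
  by apply: (measurableT_comp (measurable_powR r)).
have FE n : \int[mu]_t F n t = `|\sum_(k < n) a k| `^ r.
  rewrite Lspace_norm_powR; apply/esym.
  rewrite (powR_integrable_ae (Lspace_integrable _) (mS n) (aE n)).
  by apply: eq_Rintegral => t _; rewrite ger0_norm.
have iF n : Rintegrable mu (F n).
  apply: ae_eq_Rintegrable (Lspace_integrable (\sum_(k < n) a k)).2 (mF n) _.
  by apply: filterS (aE n) => t h /h ->; rewrite ger0_norm.
have ndF t : {homo F ^~ t : n k / (n <= k)%N >-> n <= k}.
  move=> n k nk; apply: ge0_ler_powR; rewrite ?nnegrE ?(ltW r0)//.
  rewrite -!(big_mkord xpredT (fun i => `|m i t|)) (big_cat_nat (leq0n n) nk) /=.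
  by rewrite lerDl sumr_ge0.
have FC n : \int[mu]_t F n t <= (2 * C) `^ r.
  rewrite FE; apply: ge0_ler_powR; rewrite ?nnegrE ?(ltW r0) ?mulr_ge0//.
  apply: le_trans (ler_norm_sum _ _ _) _; apply: le_trans (geo n).
  by apply: ler_sum => k _; rewrite (ha k).2.
have [H [iH H0 HC HF]] := monotone_bound iF (fun n t => powR_ge0 _ _) ndF FC.
have mH : measurable_fun [set: T] H by apply/measurable_EFinP; case/integrableP: iH.
(* The terms are replaced by 0 off this set of full measure, so that the series converges and is
   dominated at every point, not only almost everywhere. *)
pose A := \bigcap_n [set t | F n t <= H t].
have mA : measurable A.
  apply: bigcapT_measurable => n.
  have := measurable_fun_ler (mF n) mH measurableT (_ : measurable [set true]).
  by rewrite setTI; exact.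
have AE : \forall t \ae mu, A t.
  by apply: filterS HF => t h n _; exact: h.
pose m' k t := m k t * \1_A t.
have mm' k : measurable_fun [set: T] (m' k).
  by apply: measurable_funM => //; exact: measurable_indic.
pose h t := H t `^ r^-1.
have h0 t : 0 <= h t by rewrite powR_ge0.
have hr t : `|h t| `^ r = H t.
  by rewrite ger0_norm// /h -powRrM mulVf ?gt_eqF// powRr1.
have mh : measurable_fun [set: T] h.
  by apply: (measurableT_comp (measurable_powR r^-1)).
have ih : powR_integrable mu r h.
  by split=> //; move: iH; congr (is_true (mu.-integrable _ _));
    apply/funext => t; rewrite hr.
have absS n t : \sum_(k < n) `|m' k t| <= h t.
  have [At|nAt] := pselect (A t).
    rewrite (eq_bigr (fun k : 'I_n => `|m k t|)) => [|k _]; last first.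
      by rewrite /m' indicE mem_set// mulr1.
    have := At n I; rewrite /= /F => hF.
    have -> : \sum_(k < n) `|m k t| = ((\sum_(k < n) `|m k t|) `^ r) `^ r^-1.
      by rewrite -powRrM mulfV ?gt_eqF// powRr1.
    by apply: ge0_ler_powR; rewrite ?nnegrE ?powR_ge0// invr_ge0 ltW.
  rewrite big1// => k _; rewrite /m' indicE memNset// mulr0 normr0//.
have Sh n t : `|\sum_(k < n) m' k t| <= h t.
  exact: le_trans (ler_norm_sum _ _ _) (absS n t).
have cvgS t : cvgn (fun n => \sum_(k < n) m' k t).
  have -> : (fun n => \sum_(k < n) m' k t) = series (m' ^~ t).
    by apply/funext => n; rewrite /series /= big_mkord.
  have nE n : [normed series (m' ^~ t)] n = \sum_(k < n) `|m' k t|.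
    by rewrite -(big_mkord xpredT (fun k => `|m' k t|)).
  apply: normed_cvg; apply: nondecreasing_is_cvgn.
    apply/nondecreasing_seqP => n; rewrite !nE big_ord_recr /= lerDl.
    exact: normr_ge0.
  by exists (h t) => _ [n _ <-]; rewrite nE.
pose s t := limn (fun n => \sum_(k < n) m' k t).
have ms : measurable_fun [set: T] s.
  apply: (measurable_fun_cvg (h := fun n t => \sum_(k < n) m' k t)) => [n|t _].
    exact: measurable_sum.
  exact: cvgS.
have sh t : `|s t| <= h t.
  rewrite /s -lim_norm//; apply: limr_le; first exact: is_cvg_norm.
  by apply: nearW => n.
have sH t : `|s t| `^ r <= H t.
  by rewrite -hr; apply: ge0_ler_powR; rewrite ?nnegrE ?(ltW r0)// [leRHS]ger0_norm.
have is' : Rintegrable mu (fun t => `|s t| `^ r).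
  apply: (Rintegrable_le _ iH) => [|t]; first exact: measurable_powR_norm.
  by rewrite ger0_norm ?powR_ge0.
have ps : powR_integrable mu r s by [].
have [x xE] := Lspace_exists r1 ps.
exists x.
  apply: Lspace_norm_le; first by rewrite mulr_ge0.
  have -> : \int[mu]_t (`|x t| `^ r) = \int[mu]_t (`|s t| `^ r).
    apply/esym/(powR_integrable_ae ps (Lspace_measurable x)).
    by apply: filterS xE => t E /E ->.
  by apply: le_trans HC; apply: le_Rintegral.
move=> g; have [mg ig] := Lspace_integrable g.
have ihg : Rintegrable mu (fun t => `|h t * g t|).
  by apply: Rintegrable_norm; exact: (powR_integrableM r_gt1 q_gt1 rq).
have mSg n : measurable_fun [set: T] (fun t => (\sum_(k < n) m' k t) * g t).
  by apply: measurable_funM => //; exact: measurable_sum.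
have nE n : Lpairing (\sum_(k < n) m k) g = \int[mu]_t ((\sum_(k < n) m' k t) * g t).
  apply: ae_eq_Rintegral; [|exact: mSg|].
    by apply: measurable_funM => //; exact: Lspace_measurable.
  apply: filterS2 AE (LspaceE_sum m n) => t At E It.
  rewrite (E It); congr (_ * _); apply: eq_bigr => k _.
  by rewrite /m' indicE mem_set// mulr1.
have sE : Lpairing x g = \int[mu]_t (s t * g t).
  apply: ae_eq_Rintegral; [|exact: measurable_funM|].
    by apply: measurable_funM => //; exact: Lspace_measurable.
  by apply: filterS xE => t E /E ->.
rewrite sE (_ : (fun n => _) =
    (fun n => \int[mu]_t ((\sum_(k < n) m' k t) * g t))); last exact/funext.
have [|||||_ _ c] := @dominated_convergence _ _ _ mu setT measurableT
  (fun n t => ((\sum_(k < n) m' k t) * g t)%:E) (fun t => (s t * g t)%:E)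
  (fun t => `|h t * g t|%:E).
- by move=> n; exact/measurable_EFinP.
- exact/measurable_EFinP/measurable_funM.
- apply: aeW => t _; apply: cvg_EFin; first exact: nearW.
  by apply: cvgMl; exact: cvgS.
- exact: ihg.
- apply: aeW => t n _; rewrite lee_fin !normrM ler_wpM2r//.
  by apply: le_trans (Sh n t) _; rewrite ler_norm.
have isg : Rintegrable mu (fun t => s t * g t) by exact: (powR_integrableM r_gt1 q_gt1 rq).
apply: fine_cvg; rewrite /Rintegral fineK; first exact: c.
by apply: integrable_fin_num.
Qed.

Lemma Lspace_half_duality (r q : R) (r1 : (1 <= r%:E)%E) (q1 : (1 <= q%:E)%E) :
  1 < r -> 1 < q -> r^-1 + q^-1 = 1 ->
  half_duality (@Lpairing _ T R mu r q r1 q1).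
Proof.
move=> r_gt1 q_gt1 rq; split.
- by move=> u v g; exact: Lpairing_Dl.
- by move=> a u g; exact: Lpairing_Zl.
- by move=> u g; exact: Lpairing_le.
- by move=> e e0; exact: Lpairing_smooth.
- exact: Lpairing_sum.
Qed.

Lemma Lspace_duality (r q : R) (r1 : (1 <= r%:E)%E) (q1 : (1 <= q%:E)%E) :
  1 < r -> 1 < q -> r^-1 + q^-1 = 1 -> duality (@Lpairing _ T R mu r q r1 q1).
Proof.
move=> r_gt1 q_gt1 rq; split; first exact: Lspace_half_duality.
have -> : (fun g u => Lpairing u g) = @Lpairing _ T R mu q r q1 r1.
  apply/funext => g; apply/funext => u; rewrite /Lpairing.
  by apply: eq_Rintegral => t _; rewrite mulrC.
by apply: Lspace_half_duality => //; rewrite addrC.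
Qed.

End Lspace_completeness.

(** * Separability *)

Section total_dense.
Context {R : realType} {X X' : normedModType R} (B : X -> X' -> R).
Hypothesis dB : duality B.

Lemma rat_lincomb_approx (s : nat -> X) (N : nat) (a : nat -> R) (e : R) : 0 < e ->
  exists l : nat -> rat, `|\sum_(i < N) (a i - ratr (l i)) *: s i| < e.
Proof.
elim: N e => [|N IH] e e0; first by exists (fun=> 0); rewrite big_ord0 normr0.
have e20 : 0 < e / 2 by rewrite divr_gt0.
have [l hl] := IH _ e20.
have sN : 0 < `|s N| + 1 by rewrite ltr_wpDl.
have d0 : 0 < e / 2 / (`|s N| + 1) by rewrite divr_gt0.
have [|z] := rat_in_itvoo (_ : a N - e / 2 / (`|s N| + 1) < a N).
  by rewrite ltrBlDr ltrDl.
rewrite in_itv /= => /andP[z1 z2].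
exists (fun i => if i == N then z else l i).
rewrite big_ord_recr /= eqxx.
rewrite (eq_bigr (fun i : 'I_N => (a i - ratr (l i)) *: s i)); last first.
  by move=> i _; rewrite ltn_eqF.
apply: le_lt_trans (ler_normD _ _) _; rewrite [ltRHS]splitr; apply: ltr_leD => //.
rewrite normrZ gtr0_norm ?subr_gt0//.
apply: (@le_trans _ _ (e / 2 / (`|s N| + 1) * (`|s N| + 1))); last by rewrite divfK ?gt_eqF.
apply: ler_pM; rewrite ?subr_ge0 ?(ltW z2)//.
  by rewrite lerBlDr -lerBlDl ltW.
by rewrite lerDl.
Qed.

(** If the span of s stayed away from some x, a functional equal to 1 at x and 0 on the span would
    be bounded; its representative contradicts totality. Rational coefficient lists are enumerated
    by [pickle]. *)
Lemma total_dense (s : nat -> X) :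
  (forall g, (forall i, B (s i) g = 0) -> g = 0) -> exists d, @dense_seq R X d.
Proof.
move=> tot.
pose dec (k : nat) : seq rat := odflt [::] (unpickle k).
exists (fun k => \sum_(i < size (dec k)) ratr (nth 0 (dec k) i) *: s i).
move=> x e e0; have e20 : 0 < e / 2 by rewrite divr_gt0.
have [P hP] : exists P, `|lincomb s P + x| < e / 2.
  apply: contrapT => nP.
  have dP P : e / 2 <= `|lincomb s P + x|.
    by rewrite leNgt; apply/negP => Pe; apply: nP; exists P.
  have [||||g hg] := @riesz_subspace _ _ _ _ (duality_flip dB) ({poly R} * R)%type
      setT (fun c => lincomb s c.1 + c.2 *: x) (fun c => c.2)
      I (fun _ _ _ _ _ => I) _ (e / 2)^-1.
  - by move=> a c c' /=; rewrite lincombD scalerDr scalerDl scalerA addrACA.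
  - by [].
  - by rewrite invr_ge0 ltW.
  - move=> [P t] /= _; rewrite -ler_pdivrMl ?invr_gt0// invrK.
    have [->|t0] := eqVneq t 0; first by rewrite normr0 mulr0.
    have := dP (t^-1 *: P); rewrite lincombZ.
    rewrite -(ler_pM2r (_ : 0 < `|t|)) ?normr_gt0// => h'.
    apply: le_trans h' _; rewrite mulrC -normrZ scalerDr scalerA mulfV//.
    by rewrite scale1r.
  have g0 : g = 0.
    apply: tot => i; have := hg ('X^i, 0) I.
    by rewrite /= lincombXn scale0r addr0.
  have := hg (0, 1) I; rewrite /= g0 (pair0r dB) => /eqP.
  by rewrite eq_sym oner_eq0.
have [l hl] := rat_lincomb_approx s (size P) (fun i => - P`_i) e20.
exists (pickle (mkseq l (size P))); rewrite /dec pickleK /= size_mkseq.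
rewrite (eq_bigr (fun i : 'I_(size P) => ratr (l i) *: s i)); last first.
  by move=> i _; rewrite nth_mkseq.
have -> : x - \sum_(i < size P) ratr (l i) *: s i =
    (lincomb s P + x) + \sum_(i < size P) (- P`_i - ratr (l i)) *: s i.
  have -> : \sum_(i < size P) (- P`_i - ratr (l i)) *: s i =
      - lincomb s P - \sum_(i < size P) ratr (l i) *: s i.
    rewrite -sumrN -sumrB; apply: eq_bigr => i _.
    by rewrite scalerBl scaleNr.
  by rewrite addrACA subrr add0r.
by apply: le_lt_trans (ler_normD _ _) _; rewrite [ltRHS]splitr ltrD.
Qed.

End total_dense.

Section Lspace_separable.
Context {R : realType} (mu : {finite_measure set (measurableTypeR R) -> \bar R}).

Let rays := [set A : set (measurableTypeR R) | exists z : rat, A = `]ratr z, +oo[%classic].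

Let rays_measurableE : @measurable _ (measurableTypeR R) = <<s rays >>.
Proof.
rewrite [LHS]RGenOInfty.measurableE; apply/seteqP; split.
  apply: smallest_sub; first exact: smallest_sigma_algebra.
  move=> _ [x ->].
  have -> : `]x, +oo[%classic =
      \bigcup_(z in [set z : rat | x < ratr z]) `]ratr z : R, +oo[%classic.
    apply/seteqP; split=> [y /=|y [z /= xz]]; rewrite !in_itv /= !andbT.
      move=> xy; have [z] := rat_in_itvoo xy; rewrite in_itv /= => /andP[xz zy].
      by exists z => //=; rewrite in_itv /= zy.
    exact: lt_trans xz.
  rewrite bigcup_mkcond.
  apply: (@bigcupT_measurable_rat _ (g_sigma_algebraType rays)) => z.
  by case: ifP => _; [apply: sub_sigma_algebra; exists z|exact: measurable0].
apply: smallest_sub; first exact: smallest_sigma_algebra.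
by move=> _ [z ->]; apply: sub_sigma_algebra; exists (ratr z).
Qed.

Let setI_rays : setI_closed rays.
Proof.
move=> _ _ [y ->] [z ->]; exists (Num.max y z).
apply/seteqP; split=> x /=; rewrite !in_itv /= !andbT.
  by case=> yx zx; case: (leP y z).
case: (leP y z) => yz xx; split=> //.
  by apply: le_lt_trans xx; rewrite ler_rat.
by apply: lt_trans xx; rewrite ltr_rat.
Qed.

(** Rays with rational endpoints are closed under intersection and generate the Borel sets, so
    Dynkin's theorem extends the vanishing of the integral to all Borel sets. *)
Lemma integral_rays_eq0 (f : measurableTypeR R -> R) : Rintegrable mu f ->
  (\int[mu]_t (f t)%:E = 0)%E ->
  (forall z : rat, \int[mu]_(t in `]ratr z, +oo[) (f t)%:E = 0)%E ->
  f = (fun=> 0) %[ae mu].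
Proof.
move=> intf f0 fz.
have all0 S : measurable S -> (\int[mu]_(t in S) (f t)%:E = 0)%E.
  rewrite rays_measurableE; apply: (dynkin_induction rays_measurableE setI_rays
    (P := fun S => \int[mu]_(t in S) (f t)%:E = 0)%E).
  - by [].
  - by move=> _ [z ->]; exact: fz.
  - move=> A mA A0; move: f0; rewrite -(setUv A) integral_setU//.
    + by rewrite A0 add0e.
    + exact: measurableC.
    + by rewrite setUv; case/integrableP: intf.
    + exact/disj_setPCl.
  - move=> F mF tF F0; rewrite integral_bigcup//.
      by rewrite eseries0// => i _ _; exact: F0.
    by apply: integrableS intf => //; exact: bigcupT_measurable.
have := @integral_ae_eq _ _ _ mu setT measurableT (cst 0%E) (EFin \o f) intf.
move=> h; have {h}/h : measurable_fun [set: measurableTypeR R] (cst (0 : \bar R)) by [].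
move=> h; have {}h := h (fun E _ mE => etrans (all0 E mE) (esym (integral0 _ _))).
by apply: filterS h => t h /h [].
Qed.

(** The indicators of the whole line and of the rational rays are total by [integral_rays_eq0]; they
    lie in L_r because the measure is finite. *)
Lemma Lspace_separable (r q : R) (r1 : (1 <= r%:E)%E) (q1 : (1 <= q%:E)%E) :
  1 < r -> 1 < q -> r^-1 + q^-1 = 1 ->
  exists d, @dense_seq R (LspaceType mu r1) d.
Proof.
move=> r_gt1 q_gt1 rq.
have dB := Lspace_duality mu r1 q1 r_gt1 q_gt1 rq.
have ind (A : set (measurableTypeR R)) : measurable A -> exists x : LspaceType mu r1,
    (x : _ -> R) = \1_A %[ae mu].
  move=> mA; apply: Lspace_exists; split; first exact: measurable_indic.
  apply: (Rintegrable_le (g := cst 1)) => [||t].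
  - by apply: measurable_powR_norm; exact: measurable_indic.
  - exact: finite_measure_integrable_cst.
  - rewrite ger0_norm ?powR_ge0// indicE; case: (_ \in _).
      by rewrite normr1 powR1.
    by rewrite normr0 powR0// gt_eqF//; lra.
pose A (i : nat) : set (measurableTypeR R) :=
  if i is i'.+1 then
    if unpickle i' is Some z then `](ratr (z : rat)), +oo[%classic else setT
  else setT.
have mA i : measurable (A i).
  by case: i => //= i; case: unpickle => // z; exact: measurable_itv.
have [s hs] := choice (fun i => ind _ (mA i)).
apply: (total_dense dB (s := s)) => g hg.
have [mg _] := Lspace_integrable g.
have intg : Rintegrable mu (g : _ -> R).
  have [x hx] := ind _ measurableT.
  apply: ae_eq_Rintegrable (LpairingE_integrable r_gt1 q_gt1 rq x g) mg _.
  by apply: filterS hx => t h /h ->; rewrite indicT mul1r.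
have hA i : (\int[mu]_(t in A i) (g t)%:E = 0)%E.
  have fin : (\int[mu]_(t in A i) (g t)%:E \is a fin_num)%E.
    by apply: integrable_fin_num => //; apply: integrableS intg.
  rewrite -(fineK fin); congr EFin.
  transitivity (Lpairing (s i) g); last exact: hg.
  rewrite -[LHS]/(Rintegral mu (A i) g) Rintegral_mkcond /Lpairing.
  apply: ae_eq_Rintegral.
  - apply/(measurable_restrictT _ (mA i)).
    exact: measurable_funS measurableT (@subsetT _ _) mg.
  - by apply: measurable_funM => //; exact: Lspace_measurable.
  apply: filterS (hs i) => t h /h ->; rewrite patchE indicE.
  by case: (_ \in _); rewrite ?mul1r ?mul0r.
have g0 : (g : _ -> R) = (fun=> 0) %[ae mu].
  apply: integral_rays_eq0 => //; first exact: (hA 0%N).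
  by move=> z; have := hA (pickle z).+1; rewrite /= pickleK.
apply/Lspace_eqP; apply: filterS2 g0 (@Lspace0E _ _ _ mu _ q1) => t h h' It.
by rewrite (h It) (h' It).
Qed.

End Lspace_separable.

(** * Limits of arrays in the Lebesgue spaces *)

Section binary_digits.
Context {R : realType}.
Implicit Types (b : nat -> bool) (x : R).

(* The digit string b encodes the point -1 + sum_j b_j 2^-j of [-1, 1]. *)
Definition bit_sum b (K : nat) : R := -1 + \sum_(j < K) (b j)%:R * 2^-1 ^+ j.

Definition bit_val b : R := limn (bit_sum b).

Lemma bit_sumS b K : bit_sum b K.+1 = bit_sum b K + (b K)%:R * 2^-1 ^+ K.
Proof. by rewrite /bit_sum big_ord_recr addrA. Qed.

(** The upper bound is the exact geometric sum of the weights from K to K + k - 1, which is the form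
    that passes through the induction. *)
Lemma bit_sum_shift b K k : bit_sum b K <= bit_sum b (K + k) <=
  bit_sum b K + 2 * 2^-1 ^+ K - 2 * 2^-1 ^+ (K + k).
Proof.
elim: k => [|k /andP[IH1 IH2]]; first by rewrite addn0 addrK !lexx.
rewrite addnS bit_sumS exprS.
have := exprn_ge0 (K + k) (_ : 0 <= 2^-1 :> R); rewrite invr_ge0 ler0n.
move=> /(_ isT); move: (2^-1 ^+ (K + k)) IH1 IH2 => p.
by case: (b _) => /= IH1 IH2 p0; rewrite ?mul1r ?mul0r; apply/andP; split; lra.
Qed.

Lemma cvg_bit_sum b : bit_sum b @ \oo --> bit_val b.
Proof.
apply: nondecreasing_is_cvgn.
  by apply/nondecreasing_seqP => n; have := bit_sum_shift b n 1; rewrite addn1 => /andP[].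
exists (bit_sum b 0 + 2) => _ [n _ <-].
have := bit_sum_shift b 0 n; rewrite add0n expr0 mulr1 => /andP[_].
have := exprn_ge0 n (_ : 0 <= 2^-1 :> R); rewrite invr_ge0 ler0n => /(_ isT); lra.
Qed.

Lemma bit_val_approx b K : `|bit_val b - bit_sum b K| <= 2 * 2^-1 ^+ K.
Proof.
have p0 n : 0 <= 2^-1 ^+ n :> R by rewrite exprn_ge0// invr_ge0.
have h1 : bit_sum b K <= bit_val b.
  apply: limr_ge; first exact: cvg_bit_sum.
  exists K => // n /= Kn; have := bit_sum_shift b K (n - K).
  by rewrite subnKC// => /andP[].
have h2 : bit_val b <= bit_sum b K + 2 * 2^-1 ^+ K.
  apply: limr_le; first exact: cvg_bit_sum.
  exists K => // n /= Kn; have := bit_sum_shift b K (n - K).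
  by rewrite subnKC// => /andP[_]; have := p0 n; lra.
by rewrite ger0_norm ?subr_ge0//; lra.
Qed.

Lemma bit_sum_le1 b K : `|bit_sum b K| <= 1.
Proof.
have b0 : bit_sum b 0 = -1 by rewrite /bit_sum big_ord0 addr0.
have := bit_sum_shift b 0 K; rewrite add0n expr0 mulr1 b0.
have := exprn_ge0 K (_ : 0 <= 2^-1 :> R); rewrite invr_ge0 ler0n => /(_ isT).
by move=> ? /andP[? ?]; rewrite ler_norml; apply/andP; split; lra.
Qed.

Lemma bit_val_le1 b : `|bit_val b| <= 1.
Proof.
have c : cvgn (bit_sum b) by apply/cvg_ex; exists (bit_val b); exact: cvg_bit_sum.
rewrite /bit_val -lim_norm//.
apply: limr_le; first exact: is_cvg_norm.
by apply: nearW => n; exact: bit_sum_le1.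
Qed.

(** Greedy expansion from below: a weight is taken whenever the sum stays at most x. Being defined
    by comparisons, the digits are measurable in x. *)
Fixpoint bit_approx (K : nat) x : R := if K is K'.+1 then
    if bit_approx K' x + 2^-1 ^+ K' <= x then bit_approx K' x + 2^-1 ^+ K'
    else bit_approx K' x
  else -1.

Definition digit x (j : nat) := bit_approx j x + 2^-1 ^+ j <= x.

Lemma bit_approxE K x : bit_approx K x = bit_sum (digit x) K.
Proof.
elim: K => [|K IH]; first by rewrite /bit_sum big_ord0 addr0.
rewrite bit_sumS -IH /= -/(digit x K); case: (digit x K).
  by rewrite mul1r.
by rewrite mul0r addr0.
Qed.

Lemma digit_val x : `|x| <= 1 -> bit_val (digit x) = x.
Proof.
rewrite ler_norml => /andP[x1 x2].
have bound K : bit_approx K x <= x <= bit_approx K x + 2 * 2^-1 ^+ K.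
  elim: K => [|K /andP[IH1 IH2]] /=; first by rewrite x1 expr0; lra.
  rewrite exprS; case: ifP => [h|/negbT]; first by rewrite h; lra.
  by rewrite -ltNge => h; rewrite IH1; lra.
suff c : bit_sum (digit x) @ \oo --> x.
  exact: (cvg_unique _ (@cvg_bit_sum (digit x)) c).
apply/cvgrPdist_le => e e0.
have : (fun K => 2 * 2^-1 ^+ K : R) @ \oo --> (2 * 0 : R).
  apply: cvgM; first exact: cvg_cst.
  by apply: cvg_expr; rewrite ger0_norm ?invr_ge0//; lra.
rewrite mulr0 => /cvgrPdist_le /(_ _ e0); apply: filterS => K.
rewrite sub0r normrN; apply: le_trans; apply: le_trans (ler_norm _).
rewrite -bit_approxE; have /andP[h1 h2] := bound K.
by rewrite ger0_norm ?subr_ge0//; lra.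
Qed.

End binary_digits.

Section binary_digits_measurable.
Context d (T : measurableType d) (R : realType).

Lemma measurable_bit_approx K (f : T -> R) : measurable_fun [set: T] f ->
  measurable_fun [set: T] (fun t => bit_approx K (f t)).
Proof.
move=> mf; elim: K => [|K IH] /=; first exact: measurable_cst.
by apply: measurable_fun_ifT => //;
  [apply: measurable_fun_ler => //; exact: measurable_funD|exact: measurable_funD].
Qed.

Lemma measurable_digit (f : T -> R) j : measurable_fun [set: T] f ->
  measurable_fun [set: T] (fun t => digit (f t) j).
Proof.
move=> mf; apply: measurable_fun_ler => //.
by apply: measurable_funD => //; exact: measurable_bit_approx.
Qed.

Lemma measurable_bit_val (b : nat -> T -> bool) :
  (forall j, measurable_fun [set: T] (b j)) ->
  measurable_fun [set: T] (fun t => bit_val (b ^~ t) : R).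
Proof.
move=> mb; apply: (measurable_fun_cvg (h := fun n t => bit_sum (b ^~ t) n)) => [n|t _].
  apply: measurable_funD => //; apply: measurable_sum => j.
  apply: measurable_funM => //.
  rewrite (_ : (fun t => _) = (fun t => if b j t then 1 else 0)).
    exact: measurable_fun_ifT.
  by apply/funext => t; case: (b j t).
exact: cvg_bit_sum.
Qed.

End binary_digits_measurable.

Lemma mkseqS (A : Type) (f : nat -> A) n : mkseq f n.+1 = rcons (mkseq f n) (f n).
Proof. by rewrite /mkseq -addn1 iotaD map_cat cats1. Qed.

(** * Laws of digit sequences and their realisation on [0, 1] *)

Section words.
Context d (T : measurableType d) (R : realType) (mu : {measure set T -> \bar R}).
Variable b : nat -> T -> bool.
Hypothesis mb : forall l, measurable_fun [set: T] (b l).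

Definition has_word (w : seq bool) (t : T) := mkseq (b ^~ t) (size w) == w.

Lemma has_word_rcons w c t :
  has_word (rcons w c) t = has_word w t && (b (size w) t == c).
Proof. by rewrite /has_word size_rcons mkseqS eqseq_rcons. Qed.

Lemma measurable_has_word w : measurable_fun [set: T] (has_word w).
Proof.
elim/last_ind: w => [|w c IH]; first exact: measurable_cst.
rewrite (_ : has_word _ = (fun t => has_word w t && (b (size w) t == c))).
  apply: measurable_and => //; case: c.
    by rewrite (_ : (fun t => _) = b (size w))//; apply/funext => t; rewrite eqb_id.
  rewrite (_ : (fun t => _) = (fun t => ~~ b (size w) t)).
    exact: measurable_neg.
  by apply/funext => t; rewrite eqbF_neg.
by apply/funext => t; rewrite has_word_rcons.
Qed.

Variable h : T -> R.
Hypothesis ih : Rintegrable mu h.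

(** The law of the digit sequence under the measure with density h, evaluated on the cylinder of
    w. *)
Definition word_mass (w : seq bool) : R := \int[mu]_t ((has_word w t)%:R * h t).

Lemma Rintegrable_word w : Rintegrable mu (fun t => (has_word w t)%:R * h t).
Proof.
apply: (Rintegrable_le _ (Rintegrable_norm ih)) => [|t].
  apply: measurable_funM; last by apply/measurable_EFinP; case/integrableP: ih.
  rewrite (_ : (fun t => _) = (fun t => if has_word w t then 1 else 0)).
    by apply: measurable_fun_ifT => //; exact: measurable_has_word.
  by apply/funext => t; case: (has_word w t).
by case: (has_word w t); rewrite ?mul1r// mul0r normr0.
Qed.

Lemma word_mass_nil : word_mass [::] = \int[mu]_t h t.
Proof. by apply: eq_Rintegral => t _; rewrite mul1r. Qed.

Lemma word_mass_split w :
  word_mass w = word_mass (rcons w false) + word_mass (rcons w true).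
Proof.
rewrite /word_mass -RintegralD//; try exact: Rintegrable_word.
apply: eq_Rintegral => t _; rewrite !has_word_rcons.
by case: (has_word w t); case: (b _ t); rewrite /= ?(mul0r, mul1r, addr0, add0r).
Qed.

Lemma word_mass_ge0 w : (forall t, 0 <= h t) -> 0 <= word_mass w.
Proof. by move=> h0; apply: Rintegral_ge0 => t _; rewrite mulr_ge0. Qed.

Lemma word_function (F : seq bool -> R) k t : F (mkseq (b ^~ t) k) * h t =
  \sum_(w : k.-tuple bool) F w * ((has_word w t)%:R * h t).
Proof.
have sz : size (mkseq (b ^~ t) k) == k by rewrite size_mkseq.
rewrite (bigD1 (Tuple sz))//= big1 ?addr0 => [|w wt].
  by rewrite /has_word /= size_mkseq eqxx mul1r.
rewrite /has_word size_tuple (_ : (_ == _) = false) ?mul0r ?mulr0//.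
by apply: contraNF wt => /eqP E; apply/eqP/val_inj; rewrite /= E.
Qed.

(** A function of finitely many digits is integrated by a finite sum over cylinders, so convergence
    of the cylinder masses is enough for its integral to converge. *)
Lemma Rintegral_word (F : seq bool -> R) k :
  Rintegrable mu (fun t => F (mkseq (b ^~ t) k) * h t) /\
  \int[mu]_t (F (mkseq (b ^~ t) k) * h t) =
    \sum_(w : k.-tuple bool) F w * word_mass w.
Proof.
have iw (w : k.-tuple bool) : Rintegrable mu (fun t => F w * ((has_word w t)%:R * h t)).
  by apply: RintegrableZ; exact: Rintegrable_word.
have -> : (fun t => F (mkseq (b ^~ t) k) * h t) =
    (fun t => \sum_(w : k.-tuple bool) F w * ((has_word w t)%:R * h t)).
  by apply/funext => t; exact: word_function.
split; first exact: Rintegrable_sum.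
rewrite Rintegral_sum//; apply: eq_bigr => w _.
by rewrite RintegralZl//; exact: Rintegrable_word.
Qed.

End words.

Section bit_process.
Context {R : realType}.
Local Notation mu := (@lebesgue01 R).

(* Nested intervals of lengths m w, ordered lexicographically, tile [0, 1). *)
Lemma bit_process (m : seq bool -> R) : (forall w, 0 <= m w) -> m [::] = 1 ->
    (forall w, m w = m (rcons w false) + m (rcons w true)) ->
  exists2 b : nat -> measurableTypeR R -> bool,
    forall l, measurable_fun [set: measurableTypeR R] (b l) &
    forall w, mu [set t | has_word b w t] = (m w)%:E.
Proof.
move=> m0 m1 msplit.
(* A state is the left end of the current interval together with the word read so far. The part for
   the digit [false] comes first, so [true] moves the left end by its length. *)
pose step (lw : R * seq bool) (c : bool) :=
  (if c then lw.1 + m (rcons lw.2 false) else lw.1, rcons lw.2 c).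
pose bit (lw : R * seq bool) (t : R) := lw.1 + m (rcons lw.2 false) <= t.
pose state := fix state k t := if k is k'.+1 then
  step (state k' t) (bit (state k' t) t) else (0, [::]).
pose b k (t : measurableTypeR R) := bit (state k t) t.
have stateE k t : (state k t).2 = mkseq (b ^~ t) k.
  by elim: k => //= k IH; rewrite mkseqS IH.
pose lo (w : seq bool) := foldl step (0, [::]) w.
have lo2 w : (lo w).2 = w.
  by elim/last_ind: w => // w c IH; rewrite /lo -cats1 foldl_cat /= -/(lo w) IH cats1.
have loS w c : lo (rcons w c) = step (lo w) c.
  by rewrite /lo -cats1 foldl_cat.
have stlo k t : state k t = lo (mkseq (b ^~ t) k).
  elim: k => //= k IH; rewrite mkseqS loS -IH.
  by [].
have bE k w t : size w = k -> has_word b w t ->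
    b k t = ((lo w).1 + m (rcons w false) <= t).
  move=> <- /eqP wE; rewrite /b /bit stlo wE lo2; by [].
have itv w : [set t : R | 0 <= t < 1 /\ has_word b w t] =
    `[(lo w).1, (lo w).1 + m w[%classic.
  elim/last_ind: w => [|w c IH].
    apply/seteqP; split=> t; rewrite /= in_itv /= add0r m1; first by case.
    by move=> ?; split.
  have -> : [set t : R | 0 <= t < 1 /\ has_word b (rcons w c) t] =
      `[(lo w).1, (lo w).1 + m w[%classic `&`
      [set t | ((lo w).1 + m (rcons w false) <= t) = c].
    rewrite -IH; apply/seteqP; split=> t /=.
      move=> [t01]; rewrite has_word_rcons => /andP[hw /eqP <-].
      by rewrite (bE _ w)//; split=> //; split.
    by move=> [[t01 hw] <-]; rewrite has_word_rcons hw (bE _ w)//= eqxx.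
  rewrite (msplit w) loS /step lo2.
  have := m0 (rcons w false); have := m0 (rcons w true).
  case: c => /=; move: (lo w).1 (m (rcons w false)) (m (rcons w true)) => l x y y0 x0;
    apply/seteqP; split=> t /=; rewrite !in_itv /=.
  - by move=> [/andP[t1 t2] ->]; rewrite -addrA.
  - by rewrite -addrA => /andP[t1 ->]; rewrite t1 andbT; split=> //; lra.
  - by move=> [/andP[t1 t2] /negbT]; rewrite -ltNge => ->; rewrite t1.
  - move=> /andP[t1 t2]; rewrite t1 /=; split; first by lra.
    by apply/negbTE; rewrite -ltNge.
(* [itv] describes the words on [0, 1) only, while measurability is required on the whole line;
   hence a separate induction with half-lines. *)
have mhas w : measurable [set t : measurableTypeR R | has_word b w t].
  elim/last_ind: w => [|w c IH].
    rewrite (_ : [set t | _] = setT)//; exact/seteqP.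
  have -> : [set t | has_word b (rcons w c) t] = [set t | has_word b w t] `&`
      (if c then `[(lo w).1 + m (rcons w false), +oo[%classic
       else `]-oo, (lo w).1 + m (rcons w false)[%classic).
    apply/seteqP; split=> t /=; rewrite has_word_rcons.
      move=> /andP[hw]; rewrite (bE _ w)//; split=> //.
      by case: c b0 => /=; rewrite in_itv/= ?andbT; [move/eqP|rewrite ltNge => /eqP ->].
    by move=> [hw]; rewrite hw (bE _ w)//=; case: c; rewrite /= in_itv /= ?andbT;
      [move=> ->|rewrite ltNge => /negbTE ->].
  by apply: measurableI => //; case: c; exact: measurable_itv.
exists b.
  move=> l; apply: (measurable_fun_bool true); rewrite setTI.
  rewrite (_ : _ @^-1` _ =
      \bigcup_(w : l.-tuple bool) [set t | has_word b (rcons w true) t]).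
    by apply: countable_bigcupT_measurable => // w; exact: mhas.
  apply/seteqP; split=> t /=.
    move=> blt; have sz : size (mkseq (b ^~ t) l) == l by rewrite size_mkseq.
    by exists (Tuple sz) => //=; rewrite has_word_rcons size_mkseq blt /has_word
      size_mkseq !eqxx.
  by move=> [w _] /=; rewrite has_word_rcons size_tuple => /andP[_ /eqP].
move=> w; rewrite /lebesgue01 /mrestr.
have itv_mass : lebesgue_measure `[(lo w).1, (lo w).1 + m w[%classic = (m w)%:E.
  rewrite lebesgue_measure_itv /= lte_fin ltrDl; case: ifP => [_|/negbT].
    by rewrite -EFinD addrC addKr.
  by rewrite -leNgt => mw; congr EFin; apply/eqP; rewrite eq_le m0 mw.
rewrite -itv_mass -itv.
have mE : measurable ([set t | has_word b w t] `&` `[0, 1]%classic).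
  by apply: measurableI => //; exact: measurable_itv.
have mI : measurable [set t : measurableTypeR R | 0 <= t < 1 /\ has_word b w t].
  by rewrite itv; exact: measurable_itv.
(* [lebesgue01] also sees the point 1, which [itv] leaves out; it is a null set. *)
apply/eqP; rewrite eq_le; apply/andP; split.
  apply: (@le_trans _ _ (lebesgue_measure
      ([set t : measurableTypeR R | 0 <= t < 1 /\ has_word b w t] `|` [set 1]))).
    apply: le_measure; rewrite ?inE//; first exact: measurableU.
    move=> t [/= hw]; rewrite in_itv /= => /andP[t0]; rewrite le_eqVlt.
    by move=> /predU1P[->|t1]; [right|left; rewrite t0 t1].
  apply: le_trans (measureU2 _ _ _) _ => //.
  by rewrite [X in (_ + X)%E]lebesgue_measure_set1 adde0.
apply: le_measure; rewrite ?inE// => t /= [/andP[t0 t1] hw].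
by split=> //=; rewrite in_itv /= t0 ltW.
Qed.

End bit_process.

Lemma ultra_cvg_bounded (R : realType) (U : set_system nat) (u : nat -> R) (a b : R) :
  UltraFilter U -> (forall n, a <= u n <= b) -> exists l : R, u @ U --> l.
Proof.
move=> UU uab.
have uU : (u @ U) `[a, b]%classic.
  rewrite /fmap /=; apply: filterE => n; rewrite /= in_itv /=; exact: uab.
have [p [_ pu]] := @segment_compact R a b (u @ U) _ uU.
exists p => V pV; case: (in_ultra_setVsetC (u @^-1` V) UU) => // nV.
have [y [nVy Vy]] := pu (~` V) V nV pV.
by case: (nVy Vy).
Qed.

Section lebesgue01_finite.
Context {R : realType}.

Lemma lebesgue01_setT : @lebesgue01 R setT = 1%E.
Proof.
by rewrite /lebesgue01 /mrestr setTI lebesgue_measure_itv /= lte_fin ltr01 oppr0 adde0.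
Qed.

Let lebesgue01_fin : fin_num_fun (@lebesgue01 R).
Proof.
move=> A mA; rewrite ge0_fin_numE//; apply: (@le_lt_trans _ _ (@lebesgue01 R setT)).
  by apply: le_measure; rewrite ?inE.
by rewrite lebesgue01_setT ltry.
Qed.

HB.instance Definition _ := @Measure_isFinite.Build _ _ R (@lebesgue01 R) lebesgue01_fin.

End lebesgue01_finite.

Section word_approximation.
Context d (T : measurableType d) (R : realType) (mu : {measure set T -> \bar R}).

Lemma word_approximation (b : nat -> T -> bool) (h : T -> R)
    (Psi : (nat -> bool) -> R) (F : seq bool -> R) (e : R) k :
  (forall l, measurable_fun [set: T] (b l)) -> Rintegrable mu h ->
  (forall t, 0 <= h t) -> \int[mu]_t h t = 1 ->
  (forall c, `|Psi c - F (mkseq c k)| <= e) ->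
  Rintegrable mu (fun t => Psi (b ^~ t) * h t) ->
  `|\int[mu]_t (Psi (b ^~ t) * h t) - \sum_(w : k.-tuple bool) F w * word_mass mu b h w|
    <= e.
Proof.
move=> mb ih h0 h1 PF iP.
have [iF <-] := Rintegral_word mb ih F k.
rewrite -RintegralB//.
have iB : Rintegrable mu
    (fun t => Psi (b ^~ t) * h t - F (mkseq (b ^~ t) k) * h t).
  exact: (integrableB measurableT iP iF).
apply: le_trans (le_normr_Rintegral _ iB) _ => //.
rewrite -[leRHS]mulr1 -h1 -RintegralZl//; apply: le_Rintegral => //.
- exact: Rintegrable_norm.
- exact: RintegrableZ.
- by move=> t _; rewrite -mulrBl normrM (ger0_norm (h0 t)) ler_wpM2r.
Qed.

End word_approximation.

(** Superadditivity of t^q. It turns convergence of q-th powers of norms into convergence of the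
    norms. *)
Lemma powR_dist (R : realType) (q x y : R) : 1 < q -> 0 <= x -> 0 <= y ->
  `|x - y| `^ q <= `|x `^ q - y `^ q|.
Proof.
move=> q1; have q0 : 0 < q by lra.
have superadd (u v : R) : 0 <= u -> 0 <= v -> u `^ q + v `^ q <= (u + v) `^ q.
  move=> u0 v0; have uv0 : 0 <= u + v by rewrite addr_ge0.
  rewrite -(mulr_powRB1 u0 q0) -(mulr_powRB1 v0 q0) -(mulr_powRB1 uv0 q0) mulrDl.
  have q10 : 0 <= q - 1 by lra.
  by apply: lerD; apply: ler_wpM2l => //;
    apply: ge0_ler_powR; rewrite ?nnegrE ?lerDl ?lerDr.
wlog yx : x y / y <= x.
  move=> wl x0 y0; have [xy|/ltW yx] := leP y x; first exact: wl.
  by rewrite distrC [`|_ `^ _ - _|]distrC; exact: wl.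
move=> x0 y0; rewrite ger0_norm ?subr_ge0// ger0_norm.
  rewrite lerBrDr; apply: le_trans (superadd _ _ _ _) _; rewrite ?subr_ge0//.
  by rewrite subrK.
by rewrite subr_ge0; apply: ge0_ler_powR; rewrite ?nnegrE ?(ltW q0).
Qed.

Section array_limit.
Context {R : realType}.

(** One digit sequence carries countably many points of [-1, 1], so a single bit process realises
    the joint law of a whole sequence of functions. *)
Definition bit_row (c : nat -> bool) (i j : nat) : bool := c (pickle (i, j)).

Definition bit_comb (q : R) N (a : nat -> R) (c : nat -> bool) : R :=
  `|\sum_(i < N) a i * bit_val (bit_row c i)| `^ q.

Let word_comb (q : R) N K (a : nat -> R) (w : seq bool) : R :=
  `|\sum_(i < N) a i * bit_sum (bit_row (nth false w) i) K| `^ q.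

Lemma bit_comb_approx (q : R) N (a : nat -> R) (e : R) : 1 < q -> 0 < e ->
  exists k F, forall c, `|bit_comb q N a c - F (mkseq c k)| <= e.
Proof.
move=> q1 e0; pose A := \sum_(i < N) `|a i|.
have A0 : 0 <= A by apply: sumr_ge0.
have p0 : 0 <= q * A `^ (q - 1) * A * 2 by rewrite !mulr_ge0 ?powR_ge0//; lra.
have [K hK] : exists K, q * A `^ (q - 1) * A * 2 * 2^-1 ^+ K <= e.
  have : (fun K => q * A `^ (q - 1) * A * 2 * 2^-1 ^+ K : R) @ \oo -->
      (q * A `^ (q - 1) * A * 2 * 0 : R).
    apply: cvgM; first exact: cvg_cst.
    by apply: cvg_expr; rewrite ger0_norm ?invr_ge0//; lra.
  rewrite mulr0 => /cvgrPdist_le /(_ _ e0) [K _ /(_ K (leqnn K))] /=.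
  by rewrite sub0r normrN => h; exists K; apply: le_trans (ler_norm _) h.
(* A prefix of this length contains the first K digits of each of the first N rows. *)
pose k := (\max_(i < N) \max_(j < K) pickle (val i, val j)).+1.
exists k, (word_comb q N K a) => c.
have -> : word_comb q N K a (mkseq c k) =
    `|\sum_(i < N) a i * bit_sum (bit_row c i) K| `^ q.
  congr (`|_| `^ _); apply: eq_bigr => i _; congr (_ * (_ + _)).
  apply: eq_bigr => j _; congr (_%:R * _); rewrite /bit_row nth_mkseq// ltnS.
  apply: leq_trans (leq_bigmax i); exact: leq_bigmax.
have bound (f : nat -> R) : (forall i, `|f i| <= 1) -> `|\sum_(i < N) a i * f i| <= A.
  move=> f1; apply: le_trans (ler_norm_sum _ _ _) _; apply: ler_sum => i _.
  by rewrite normrM ler_piMr.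
apply: le_trans (powR_lipschitz q1
  (bound (fun i => bit_val (bit_row c i)) (fun i => bit_val_le1 _))
  (bound (fun i => bit_sum (bit_row c i) K) (fun i => bit_sum_le1 _ _))) _.
apply: le_trans hK; rewrite -!mulrA ler_wpM2l//; first lra.
rewrite ler_wpM2l ?powR_ge0// -sumrB /A mulr_suml.
apply: le_trans (ler_norm_sum _ _ _) _; apply: ler_sum => i _.
by rewrite -mulrBr normrM ler_wpM2l// bit_val_approx.
Qed.

Lemma measurable_bit_comb d (T : measurableType d) (q : R) N (a : nat -> R) (b : nat -> T -> bool) :
  (forall l, measurable_fun [set: T] (b l)) ->
  measurable_fun [set: T] (fun t => bit_comb q N a (b ^~ t)).
Proof.
move=> mb; apply: measurable_powR_norm; apply: measurable_sum => i.
apply: measurable_funM => //.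
exact: (@measurable_bit_val _ _ _ (fun j => b (pickle (val i, j)))).
Qed.

Context d (T : measurableType d) (nu : {measure set T -> \bar R}).

(** Dividing row n by the q-th root of a density h n gives functions with values in [-1, 1], and the
    integrals become expectations, under h n, of one fixed function of their digits. The cylinder
    masses converge along an ultrafilter, and [bit_process] realises their limit. *)
Lemma array_limit (q : R) (f : nat -> nat -> T -> R) : 1 < q ->
    nu setT = 1%E -> (forall n i, powR_integrable nu q (f n i)) ->
    (forall n, \sum_(i < n) \int[nu]_t (`|f n i t| `^ q) <= 1) ->
  exists U (s : nat -> measurableTypeR R -> R), [/\ ProperFilter U, \oo `<=` U,
    forall i, measurable_fun setT (s i), forall i t, `|s i t| <= 1 &
    forall N (a : nat -> R),
      (fun n => \int[nu]_t (`|\sum_(i < N) a i * f n i t| `^ q)) @ U -->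
      \int[@lebesgue01 R]_t (`|\sum_(i < N) a i * s i t| `^ q) ].
Proof.
move=> q1 nu1 fL fsum.
have q0 : 0 < q by lra.
have [U [UU ooU]] := @ultraFilterLemma _ \oo _.
have ifq n i : Rintegrable nu (fun t => `|f n i t| `^ q) := (fL n i).2.
have i1 : Rintegrable nu (cst 1).
  apply/integrableP; split; first exact/measurable_EFinP/measurable_cst.
  rewrite (eq_integral (cst 1%E)) => [|t _].
    by rewrite integral_cst// mul1e nu1 ltry.
  by rewrite /= normr1.
have int1 (x : R) : \int[nu]_t x = x.
  by rewrite Rintegral_cst//; rewrite /= nu1 /= mulr1.
pose M n := \sum_(i < n) \int[nu]_t (`|f n i t| `^ q).
(* The sum dominates every [|f n i|^q] with i < n; the constant brings the integral to 1, so that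
   the digits have a probability law. *)
pose h n t := \sum_(i < n) `|f n i t| `^ q + (1 - M n).
have M1 n : 0 <= 1 - M n by rewrite subr_ge0; exact: fsum.
have hS0 n t : 0 <= \sum_(i < n) `|f n i t| `^ q.
  by apply: sumr_ge0 => i _; exact: powR_ge0.
have h0 n t : 0 <= h n t := addr_ge0 (hS0 n t) (M1 n).
have iS n : Rintegrable nu (fun t => \sum_(i < n) `|f n i t| `^ q).
  by apply: Rintegrable_sum => i; exact: ifq.
have ic (x : R) : Rintegrable nu (fun=> x).
  by have := RintegrableZ x i1; congr Rintegrable; apply/funext => t /=; rewrite mulr1.
have ih n : Rintegrable nu (h n) by apply: RintegrableD (iS n) (ic _).
have h1 n : \int[nu]_t h n t = 1.
  rewrite RintegralD//; try exact: ic; try exact: iS.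
  by rewrite int1 Rintegral_sum ?subrKC// => i; exact: ifq.
have mh n : measurable_fun [set: T] (h n) by apply/measurable_EFinP; case/integrableP: (ih n).
(* Where h vanishes, the quotient is 0 by convention, which is correct because [f n i] vanishes
   there for i < n. *)
pose sg n i t := f n i t / (h n t) `^ q^-1.
have fh n i t : (i < n)%N -> `|f n i t| `^ q <= h n t.
  move=> ni; rewrite /h (bigD1 (Ordinal ni))//= -addrA lerDl.
  by rewrite addr_ge0// sumr_ge0// => j _; exact: powR_ge0.
have fh' n i t : (i < n)%N -> `|f n i t| <= (h n t) `^ q^-1.
  move=> ni; have -> : `|f n i t| = (`|f n i t| `^ q) `^ q^-1.
    by rewrite -powRrM mulfV ?gt_eqF// powRr1.
  by apply: ge0_ler_powR; rewrite ?nnegrE ?powR_ge0 ?invr_ge0 ?(ltW q0)// fh.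
have sg1 n i t : (i < n)%N -> `|sg n i t| <= 1.
  move=> ni; rewrite /sg normrM normfV [X in _ / X]ger0_norm ?powR_ge0//.
  have := powR_ge0 (h n t) q^-1; rewrite le_eqVlt => /predU1P[<-|hp].
    by rewrite invr0 mulr0.
  by rewrite ler_pdivrMr// mul1r fh'.
have fE n i t : (i < n)%N -> f n i t = sg n i t * (h n t) `^ q^-1.
  move=> ni; rewrite /sg; have [h0'|h0'] := eqVneq ((h n t) `^ q^-1) 0.
    have := fh' n i t ni; rewrite h0' normr_le0 => /eqP ->.
    by rewrite !mul0r.
  by rewrite divfK.
have msg n i : measurable_fun [set: T] (sg n i).
  apply: measurable_funM; first exact: (fL n i).1.
  rewrite (_ : (fun t => _) = (fun t => (h n t) `^ (- q^-1))).
    exact: (measurableT_comp (measurable_powR _)).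
  by apply/funext => t; rewrite powRN.
pose b n l t := if unpickle l is Some (i, j) then digit (sg n i t) j else false.
have mb n l : measurable_fun [set: T] (b n l).
  rewrite /b; case: (unpickle l) => [[i j]|]; last exact: measurable_cst.
  exact: measurable_digit.
have brow n i t : (i < n)%N -> bit_val (bit_row (b n ^~ t) i) = sg n i t.
  move=> ni; rewrite -[RHS]digit_val ?sg1//; congr bit_val.
  by apply/funext => j; rewrite /bit_row /b pickleK.
have PsiE n N (a : nat -> R) t : (N <= n)%N ->
    `|\sum_(i < N) a i * f n i t| `^ q = bit_comb q N a (b n ^~ t) * h n t.
  move=> Nn; rewrite /bit_comb.
  rewrite (eq_bigr (fun i : 'I_N => (a i * sg n i t) * (h n t) `^ q^-1)); last first.
    by move=> i _; rewrite fE ?mulrA// (leq_trans (ltn_ord i)).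
  rewrite -mulr_suml normrM [X in _ * X]ger0_norm ?powR_ge0// powRM ?powR_ge0//.
  rewrite -powRrM mulVf ?gt_eqF// powRr1//.
  congr (`|_| `^ _ * _); apply: eq_bigr => i _.
  by rewrite brow// (leq_trans (ltn_ord i)).
have bcomb_le N (a : nat -> R) c : bit_comb q N a c <= (\sum_(i < N) `|a i|) `^ q.
  apply: ge0_ler_powR; rewrite ?nnegrE ?(ltW q0) ?sumr_ge0//.
  apply: le_trans (ler_norm_sum _ _ _) _; apply: ler_sum => i _.
  by rewrite normrM ler_piMr// bit_val_le1.
have iPsi n N (a : nat -> R) : Rintegrable nu (fun t => bit_comb q N a (b n ^~ t) * h n t).
  apply: (Rintegrable_le _ (RintegrableZ ((\sum_(i < N) `|a i|) `^ q) (ih n))) => [|t].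
    by apply: measurable_funM => //; exact: measurable_bit_comb.
  by rewrite normrM ger0_norm ?powR_ge0// ger0_norm// ler_wpM2r.
(* limit of the laws of the digits *)
pose mass n w := word_mass nu (b n) (h n) w.
have mass0 n w : 0 <= mass n w by apply: word_mass_ge0.
have masssplit n w : mass n w = mass n (rcons w false) + mass n (rcons w true).
  exact: (word_mass_split (mb n) (ih n)).
have mass_nil n : mass n [::] = 1 by rewrite /mass word_mass_nil.
have mass_le1 n w : 0 <= mass n w <= 1.
  rewrite mass0 /=; elim/last_ind: w => [|w c IH]; first by rewrite mass_nil.
  apply: le_trans IH; rewrite (masssplit n w).
  by case: c; rewrite ?lerDl ?lerDr.
have [m hm] := choice (fun w => ultra_cvg_bounded UU (fun n => mass_le1 n w)).
have UP : ProperFilter U by exact: ultra_proper.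
have [|||bb mbb bbm] := @bit_process R m.
- move=> w; rewrite -(cvg_lim (@Rhausdorff R) (hm w)); apply: limr_ge.
    by apply/cvg_ex; exists (m w); exact: hm.
  by apply: nearW => n; exact: mass0.
- have c : mass ^~ [::] @ U --> (1 : R).
    by rewrite (_ : mass ^~ _ = cst 1); [exact: cvg_cst|exact/funext].
  exact: (cvg_unique _ (hm [::]) c).
- move=> w.
  have c : mass ^~ w @ U --> m (rcons w false) + m (rcons w true).
    rewrite (_ : mass ^~ w = mass ^~ (rcons w false) \+ mass ^~ (rcons w true)).
      by apply: cvgD; exact: hm.
    exact/funext.
  exact: (cvg_unique _ (hm w) c).
pose s i t := bit_val (bit_row (bb ^~ t) i) : R.
have ms i : measurable_fun [set: measurableTypeR R] (s i).
  exact: (@measurable_bit_val _ _ _ (fun j => bb (pickle (i, j)))).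
exists U, s; split=> //; first by move=> i t; exact: bit_val_le1.
move=> N a; apply/cvgrPdist_le => e e0.
have e30 : 0 < e / 3 by rewrite divr_gt0.
(* The same function F of k digits approximates the integrals for all n and for the limit; between
   them stand finitely many masses converging along [U]. Each of the three errors is at most e/3. *)
have [k [F hF]] := bit_comb_approx N a q1 e30.
have ic1 : Rintegrable (@lebesgue01 R) (cst 1) by exact: finite_measure_integrable_cst.
have mass_bb w : word_mass (@lebesgue01 R) bb (cst 1) w = m w.
  have mw : measurable [set t | has_word bb w t].
    have := measurable_has_word mbb w measurableT (_ : measurable [set true]).
    by rewrite setTI; exact.
  rewrite /word_mass /Rintegral (eq_integral (fun t => (\1_[set t | has_word bb w t] t)%:E)).
    by rewrite integral_indic// setIT [X in fine X](bbm w).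
  move=> t _; rewrite mulr1 indicE.
  have [hw|hw] := boolP (has_word bb w t); first by rewrite mem_set.
  by rewrite memNset//=; exact/negP.
have cF : (fun n => \sum_(w : k.-tuple bool) F w * mass n w) @ U -->
    \sum_(w : k.-tuple bool) F w * m w.
  elim: (index_enum _) => [|w r IH].
    rewrite big_nil (_ : (fun n => _) = cst 0); first exact: cvg_cst.
    by apply/funext => n; rewrite big_nil.
  rewrite big_cons (_ : (fun n => _) =
      (fun n => F w * mass n w) \+ (fun n => \sum_(j <- r) F j * mass n j)).
    by apply: cvgD IH; apply: cvgM; [exact: cvg_cst|exact: hm].
  by apply/funext => n; rewrite big_cons.
have /cvgrPdist_le /(_ _ e30) near1 := cF.
have near2 : \forall n \near U, (N <= n)%N by apply: ooU; exists N.
apply: filterS2 near1 near2 => n d1 Nn.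
have d2 := word_approximation (mb n) (ih n) (h0 n) (h1 n) hF (iPsi n N a).
have ibb : Rintegrable (@lebesgue01 R) (fun t => bit_comb q N a (bb ^~ t) * cst 1 t).
  apply: (Rintegrable_le _ (RintegrableZ ((\sum_(i < N) `|a i|) `^ q) ic1)) => [|t].
    by apply: measurable_funM => //; exact: measurable_bit_comb.
  by rewrite normrM ger0_norm ?powR_ge0// ger0_norm// ler_wpM2r.
have one : \int[@lebesgue01 R]_t (cst 1 t) = 1.
  by rewrite Rintegral_cst// [X in fine X]lebesgue01_setT mulr1.
have d3 := word_approximation mbb ic1 (fun t => ler01) one hF ibb.
have -> : \int[nu]_t (`|\sum_(i < N) a i * f n i t| `^ q) =
    \int[nu]_t (bit_comb q N a (b n ^~ t) * h n t).
  by apply: eq_Rintegral => t _; exact: PsiE.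
have -> : \int[@lebesgue01 R]_t (`|\sum_(i < N) a i * s i t| `^ q) =
    \int[@lebesgue01 R]_t (bit_comb q N a (bb ^~ t) * cst 1 t).
  by apply: eq_Rintegral => t _; rewrite mulr1.
rewrite (eq_bigr (fun w : k.-tuple bool => F w * m w)) in d3; last first.
  by move=> w _; rewrite mass_bb.
move: d1 d2 d3; rewrite -/mass.
set I1 := \int[nu]_t _; set I2 := \int[lebesgue01]_t _.
set S1 := \sum_w _; set S2 := \sum_w _.
rewrite !ler_norml => /andP[? ?] /andP[? ?] /andP[? ?].
by apply/andP; split; lra.
Qed.

End array_limit.

Section Lp01_array_limits.
Context {R : realType}.
Let lam : {measure set (measurableTypeR R) -> \bar R} := @lebesgue01 R.

Lemma LspaceE_lincomb d (T : measurableType d) (mu : {measure set T -> \bar R})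
    (r : R) (r1 : (1 <= r%:E)%E) (x : nat -> LspaceType mu r1) (a : nat -> R) N :
  ((\sum_(i < N) a i *: x i : LspaceType mu r1) : T -> R) =
  (fun t => \sum_(i < N) a i * x i t) %[ae mu].
Proof.
have sum_ae (y : nat -> LspaceType mu r1) (f : nat -> T -> R) :
    (forall i, (y i : T -> R) = f i %[ae mu]) ->
    ((\sum_(i < N) y i : LspaceType mu r1) : T -> R) =
    (fun t => \sum_(i < N) f i t) %[ae mu].
  move=> yf.
  have : \forall t \ae mu, forall i, y i t = f i t.
    by apply/ae_foralln => i; apply: filterS (yf i) => t h; exact: h.
  apply: filterS2 (LspaceE_sum y N) => t h h' It.
  by rewrite (h It); apply: eq_bigr => i _; exact: h'.
exact: (sum_ae (fun i => a i *: x i) (fun i t => a i * x i t)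
  (fun i => LspaceZE (a i) (x i))).
Qed.

Lemma Lp01_array_limits (q : R) (q1 : (1 <= q%:E)%E) : 1 < q ->
  array_limits (LspaceType (@lebesgue01 R) q1).
Proof.
move=> q_gt1 G A GA.
have q0 : 0 < q by lra.
have A0 : 0 <= A by apply: le_trans (GA 0 0)%N.
have A10 : 0 < A + 1 by lra.
(* [array_limit] needs q-th powers with total integral at most 1 in each row. Geometric weights
   achieve this for a bounded array and are undone in the coefficients as [a i / kp i]. *)
pose p2 (i : nat) : R := 2^-1 ^+ i.+1.
have p20 i : 0 < p2 i by rewrite exprn_gt0// invr_gt0.
have p21 i : p2 i <= 1 by rewrite exprn_ile1// ?invr_ge0// invf_le1// ler1n.
pose kp i := p2 i / (A + 1).
have kp0 i : 0 < kp i by rewrite divr_gt0.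
pose f n i t := kp i * G n i t.
have fE n i t : `|f n i t| `^ q = kp i `^ q * `|G n i t| `^ q.
  by rewrite /f normrM (gtr0_norm (kp0 i)) powRM// ltW.
have fL n i : powR_integrable (@lebesgue01 R) q (f n i).
  have [mG iG] := Lspace_integrable (G n i).
  split; first exact: measurable_funM.
  have := RintegrableZ (kp i `^ q) iG; congr (is_true (_.-integrable _ _)).
  by apply/funext => t /=; rewrite fE.
have fsum n : \sum_(i < n) \int[@lebesgue01 R]_t (`|f n i t| `^ q) <= 1.
  have -> : 1 = 1 - 2^-1 ^+ n + 2^-1 ^+ n :> R by rewrite subrK.
  apply: (@le_trans _ _ (\sum_(i < n) p2 i)); last first.
    have -> : \sum_(i < n) p2 i = 1 - 2^-1 ^+ n.
      elim: n => [|n IH]; first by rewrite big_ord0 expr0 subrr.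
      by rewrite big_ord_recr /= IH /p2 exprS; field.
    by rewrite lerDl exprn_ge0// invr_ge0.
  apply: ler_sum => i _.
  have [_ iG] := Lspace_integrable (G n i).
  have -> : \int[@lebesgue01 R]_t (`|f n i t| `^ q) =
      \int[@lebesgue01 R]_t (kp i `^ q * `|G n i t| `^ q).
    by apply: eq_Rintegral => t _; exact: fE.
  rewrite RintegralZl// -Lspace_norm_powR -powRM ?(ltW (kp0 i))//.
  apply: (@le_trans _ _ (p2 i `^ q)).
    apply: ge0_ler_powR; rewrite ?nnegrE ?(ltW q0) ?(ltW (p20 i))//.
      by rewrite mulr_ge0// ltW.
    rewrite /kp mulrAC ler_pdivrMr// ler_pM2l//.
    by apply: le_trans (GA n i) _; rewrite lerDl.
  rewrite -(mulr_powRB1 (ltW (p20 i)) q0) ler_piMr ?(ltW (p20 i))//.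
  apply: (@le_trans _ _ (1 `^ (q - 1))); last by rewrite powR1.
  by apply: ge0_ler_powR; rewrite ?nnegrE ?(ltW (p20 i))//; lra.
have [U [s [UP ooU ms s1 lim]]] :=
  @array_limit R _ _ (@lebesgue01 R : {measure set (measurableTypeR R) -> \bar R})
    q f q_gt1 lebesgue01_setT fL fsum.
have gex i : exists g : LspaceType (@lebesgue01 R) q1,
    (g : _ -> R) = (fun t => (kp i)^-1 * s i t) %[ae lam].
  apply: Lspace_exists; split; first exact: measurable_funM.
  have ic : Rintegrable (@lebesgue01 R) (cst ((kp i)^-1 `^ q)).
    exact: finite_measure_integrable_cst.
  apply: (Rintegrable_le _ ic) => [|t].
    by apply: measurable_powR_norm; exact: measurable_funM.
  rewrite ger0_norm ?powR_ge0//; apply: ge0_ler_powR;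
    rewrite ?nnegrE ?(ltW q0) ?invr_ge0 ?(ltW (kp0 i))//.
  rewrite normrM ger0_norm ?invr_ge0 ?(ltW (kp0 i))//.
  by rewrite ler_piMr ?invr_ge0 ?(ltW (kp0 i)).
have [g gE] := choice gex.
exists U, g; split=> // N a.
have key (x : nat -> LspaceType (@lebesgue01 R) q1) (y : nat -> measurableTypeR R -> R) :
    (forall i, measurable_fun setT (y i)) ->
    (forall i, (x i : _ -> R) = (fun t => (kp i)^-1 * y i t) %[ae lam]) ->
    `|\sum_(i < N) a i *: x i| `^ q =
      \int[@lebesgue01 R]_t (`|\sum_(i < N) (a i / kp i) * y i t| `^ q).
  move=> my xy; rewrite Lspace_norm_powR; apply: powR_integrable_ae.
  - exact: Lspace_integrable.
  - by apply: measurable_sum => i; exact: measurable_funM.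
  have : \forall t \ae lam, forall i, x i t = (kp i)^-1 * y i t.
    by apply/ae_foralln => i; apply: filterS (xy i) => t h; exact: h.
  apply: filterS2 (LspaceE_lincomb x a N) => t h h' It.
  by rewrite (h It); apply: eq_bigr => i _; rewrite h' mulrA.
have GE n : `|\sum_(i < N) a i *: G n i| `^ q =
    \int[@lebesgue01 R]_t (`|\sum_(i < N) (a i / kp i) * f n i t| `^ q).
  apply: key => [i|i]; first exact: (fL n i).1.
  by apply: aeW => t _; rewrite /f mulKf// gt_eqF.
have gE' := key g s ms gE.
apply/cvgrPdist_lt => e e0.
have eq0 : 0 < e `^ q by rewrite powR_gt0.
have /cvgrPdist_lt /(_ _ eq0) := lim N (fun i => a i / kp i).
apply: filterS => n; rewrite -GE -gE' => hn.
rewrite ltNge; apply/negP => he; move: hn; apply/negP; rewrite -leNgt.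
apply: le_trans (powR_dist q_gt1 (normr_ge0 _) (normr_ge0 _)).
by apply: ge0_ler_powR; rewrite ?nnegrE ?(ltW q0) ?(ltW e0).
Qed.

Lemma Lp01_unit (r : R) (r1 : (1 <= r%:E)%E) :
  exists u : LspaceType (@lebesgue01 R) r1, `|u| = 1.
Proof.
have r0 : 0 < r by apply: lt_le_trans ltr01 _; rewrite -lee_fin.
have i1 : powR_integrable (@lebesgue01 R) r (cst 1).
  split; first exact: measurable_cst.
  have := finite_measure_integrable_cst (@lebesgue01 R) (1 : R)
    (@measurableT _ (measurableTypeR R)).
  congr (is_true (_.-integrable _ _)).
  by apply/funext => t /=; rewrite normr1 powR1.
have [u uE] := Lspace_exists r1 i1; exists u.
have : `|u| `^ r = 1 `^ r.
  rewrite Lspace_norm_powR -(powR_integrable_ae i1 (Lspace_measurable u)).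
    have -> : \int[@lebesgue01 R]_t (`|cst 1 t : R| `^ r) = \int[@lebesgue01 R]_t (cst 1 t).
      by apply: eq_Rintegral => t _; rewrite normr1 powR1.
    by rewrite powR1 Rintegral_cst// [X in fine X]lebesgue01_setT mulr1.
  by apply: filterS uE => t h /h ->.
by move=> /powR_injective; apply; rewrite ?nnegrE ?gt_eqF.
Qed.

End Lp01_array_limits.

Theorem corollary3p6 (R : realType) (p : \bar R)
    (p1 : (1 < p)%E) (py : (p < +oo)%E) (Y : completeNormedModType R) :
  coarse_quotient (norm_metric (Lp01 (ltW p1))) (norm_metric Y) ->
  exists Z : completeNormedModType R,
    linear_quotient (Lp01 (ltW p1)) Z /\ isomorphic Y Z.
Proof.
(* The map constructed is onto [Y] itself, so the isomorphism is the identity. *)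
case: p p1 py => [r|//|//] p1 _ cq; exists Y; split.
  have r_gt1 : 1 < r by rewrite -lte_fin.
  pose q := r / (r - 1).
  have q_gt1 : 1 < q by rewrite ltr_pdivlMr ?subr_gt0// mul1r ltrBlDr ltrDl.
  have q1 : (1 <= q%:E)%E by rewrite lee_fin ltW.
  have rq : r^-1 + q^-1 = 1.
    by rewrite /q invf_div -[X in X + _]div1r -mulrDl subrKC divff ?gt_eqF ?(lt_trans ltr01).
  have [u u1] := Lp01_unit (ltW p1).
  have [d dd] := Lspace_separable (@lebesgue01 R) (ltW p1) q1 r_gt1 q_gt1 rq.
  apply: (coarse_quotient_linear_quotient (Lspace_duality _ _ _ r_gt1 q_gt1 rq)
    u1 dd (Lp01_array_limits (q1 := q1) q_gt1) cq).
have bnd : bounded_near (idfun : Y -> Y) (nbhs (0 : Y)).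
  apply/linear_boundedP; exists 1; split; first exact: num_real.
  by move=> M M1 x; rewrite ler_peMl// ltW.
by exists idfun, idfun.
Qed.
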